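(* Let $F\in H^{-2}(\Omega)$, $F\neq0$, be independent of time, let $0<\alpha<\frac{\nu\bar\lambda_1}{4}$ and let $\Delta t>0$ satisfy $\big(\frac{\nu\Delta t\bar\lambda_1}{4}+1\big)>e^{\alpha\Delta t}$. There exists a bounded absorbing set $$B^h_{\rho_0}(0):=\{v\in S_h^0:\|\nabla v\|\leq\rho_0\},\qquad\text{where}\quad\rho_0^2=\frac{\mu^2e^{2\alpha\Delta t}}{\alpha\nu}\|F\|_{-2}^2,$$ for the backward Euler scheme, in the sense that for $\rho>0$ there is $t_{n^*}(\rho)>0$ such that for all $t_N\geq t_{n^*}$, $$\mathcal{S}^N(t_N)B^h_\rho(0)\subset B^h_{\rho_0}(0).$$
   Context: $\Omega\subset\mathbb{R}^2$ is a bounded domain, $\nu>0$, $\mu>0$ constants, $(\cdot,\cdot)$, $\|\cdot\|$ the $L^2(\Omega)$ inner product and norm, $H^{-2}(\Omega)$ the dual of $H^2_0(\Omega)$ with norm $\|\cdot\|_{-2}$ dual to $\|\Delta\cdot\|$, $\langle\cdot,\cdot\rangle$ the $L^2$ inner product or duality pairing. $\bar\lambda_1>0$ is the minimum eigenvalue of $-\Delta\phi=\bar\lambda\phi$ in $\Omega$ with homogeneous Dirichlet boundary condition. $\mathcal{T}_h$ is a shape regular partition of $\overline\Omega$; $S_h\subset C^1(\Omega)\cap\mathcal{P}$ is a $C^1$-conforming finite element space of piecewise polynomials ($\mathcal P$ a piecewise polynomial space) of degree up to $k\ge3$, and $S_h^0=\{v\in S_h: v=\partial_{\mathbf n}v=0\text{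 on }\partial\Omega\}$. $B^h_\rho(0)=\{v\in S_h^0:\|\nabla v\|\le\rho\}$. Set $a(v,w)=(\Delta v,\Delta w)$, $b_0(v,w)=-\frac12[(v_x,w)-(v,w_x)]$, $b(\psi;v,w)=(\Delta\psi,\,v_yw_x-v_xw_y)$. With time step $\Delta t$, $t_n=n\Delta t$ and $\overline\partial_t\Psi^n=(\Psi^n-\Psi^{n-1})/\Delta t$, the backward Euler scheme is: given $\Psi^0\in S_h^0$, find $\Psi^n\in S_h^0$, $n=1,2,\dots$, such that $$\langle\nabla\overline\partial_t\Psi^n,\nabla\chi\rangle+\nu a(\Psi^n,\chi)+b(\Psi^n;\Psi^n,\chi)+\mu b_0(\Psi^n,\chi)=\mu\langle F,\chi\rangle\quad\forall\chi\in S_h^0 .$$ The scheme is uniquely solvable at each step, and $\mathcal{S}^N(t_N)$ denotes the discrete solution operator on $S_h^0$ taking $\Psi^0$ to $\Psi^N$. *)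

(* Defs.v *)
From HB Require Import structures.
From mathcomp Require Import all_boot all_order all_algebra.
From mathcomp Require Import all_classical all_reals all_analysis.

Set Implicit Arguments.
Unset Strict Implicit.
Unset Printing Implicit Defensive.

Import Order.TTheory GRing.Theory Num.Theory.
Import numFieldNormedType.Exports.

Local Open Scope classical_set_scope.
Local Open Scope ring_scope.

Section plane.
Context {R : realType}.
Implicit Types (Om K : set (R * R)) (u v w phi : R * R -> R) (p n z : R * R).

(* Euclidean; the library norm of R * R is the max norm. *)
Definition dot p n : R := p.1 * n.1 + p.2 * n.2.
Definition enorm z : R := Num.sqrt (dot z z).

Definition domain Om : Prop := [/\ open Om, connected Om & Om !=set0].

Definition boundary Om : set (R * R) := closure Om `\` interior Om.

Definition lincomb (a : R) u v : R * R -> R := fun z => a * u z + v z.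

Definition linear_subspace (V : set (R * R -> R)) : Prop :=
  V (cst 0) /\ forall a u v, V u -> V v -> V (lincomb a u v).

Definition pdx v : R * R -> R := fun z => derive1 (fun t => v (t, z.2)) z.1.
Definition pdy v : R * R -> R := fun z => derive1 (fun t => v (z.1, t)) z.2.

Fixpoint Ck (k : nat) v : Prop :=
  continuous v /\
  if k is k'.+1 then
    [/\ forall z, derivable (fun t => v (t, z.2)) z.1 1,
        forall z, derivable (fun t => v (z.1, t)) z.2 1,
        Ck k' (pdx v) & Ck k' (pdy v)]
  else True.

(* C_c^oo(Om); the functions are defined on the plane, extended by zero. *)
Definition test_function Om phi : Prop :=
  [/\ forall k, Ck k phi,
      compact (closure [set z | phi z != 0]) &
      closure [set z | phi z != 0] `<=` Om].

(* L^2(Om); functions are total and only their values on Om matter. *)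
Definition L2 Om u : Prop :=
  measurable_fun Om u /\
  (@lebesgue_measure R \x @lebesgue_measure R)%E.-integrable Om
    (fun z => (u z ^+ 2)%:E).

Definition ip Om u v : R :=
  \int[(@lebesgue_measure R \x @lebesgue_measure R)%E]_(z in Om) (u z * v z).

Definition L2norm Om u : R := Num.sqrt (ip Om u u).

(* The weak derivatives in L^2(Om), and a choice of one when there is any
   (they are unique up to a null set). *)
Definition weak_dx Om u : set (R * R -> R) :=
  [set g | L2 Om g /\
    forall phi, test_function Om phi -> ip Om u (pdx phi) = - ip Om g phi].
Definition weak_dy Om u : set (R * R -> R) :=
  [set g | L2 Om g /\
    forall phi, test_function Om phi -> ip Om u (pdy phi) = - ip Om g phi].
Definition dx Om u : R * R -> R := xget (cst 0) (weak_dx Om u).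
Definition dy Om u : R * R -> R := xget (cst 0) (weak_dy Om u).

Definition lap Om u : R * R -> R :=
  fun z => dx Om (dx Om u) z + dy Om (dy Om u) z.

Definition H1 Om u : Prop :=
  [/\ L2 Om u, weak_dx Om u !=set0 & weak_dy Om u !=set0].
Definition H2 Om u : Prop :=
  [/\ H1 Om u, H1 Om (dx Om u) & H1 Om (dy Om u)].

Definition H1norm Om u : R :=
  Num.sqrt (ip Om u u + ip Om (dx Om u) (dx Om u) + ip Om (dy Om u) (dy Om u)).
Definition H2norm Om u : R :=
  Num.sqrt (ip Om u u + H1norm Om (dx Om u) ^+ 2 + H1norm Om (dy Om u) ^+ 2).

Definition H10 Om u : Prop :=
  H1 Om u /\ forall e : R, 0 < e ->
    exists2 phi, test_function Om phi & H1norm Om (u \- phi) < e.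
Definition H20 Om u : Prop :=
  H2 Om u /\ forall e : R, 0 < e ->
    exists2 phi, test_function Om phi & H2norm Om (u \- phi) < e.

Definition grad_ip Om v w : R :=
  ip Om (dx Om v) (dx Om w) + ip Om (dy Om v) (dy Om w).
Definition grad_norm Om v : R := Num.sqrt (grad_ip Om v v).

(* H^{-2}(Om): F is only evaluated on H^2_0(Om), and F u is the duality
   pairing <F, u>. *)
Definition Hm2 Om (F : (R * R -> R) -> R) : Prop :=
  (forall a u v, H20 Om u -> H20 Om v -> F (lincomb a u v) = a * F u + F v) /\
  (exists C : R, forall u, H20 Om u -> `|F u| <= C * L2norm Om (lap Om u)).

Definition Hm2_nonzero Om (F : (R * R -> R) -> R) : Prop :=
  exists2 u, H20 Om u & F u != 0.

Definition Hm2norm Om (F : (R * R -> R) -> R) : R :=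
  sup [set `|F u| / L2norm Om (lap Om u) |
        u in [set u | H20 Om u /\ L2norm Om (lap Om u) != 0]].

(* Eigenvalues of - Laplace phi = lam phi, phi = 0 on the boundary, in the
   usual weak sense. *)
Definition dirichlet_eigenvalue Om (lam : R) : Prop :=
  exists phi, [/\ H10 Om phi, L2norm Om phi != 0 &
    forall w, H10 Om w -> grad_ip Om phi w = lam * ip Om phi w].
Definition min_dirichlet_eigenvalue Om (lam : R) : Prop :=
  dirichlet_eigenvalue Om lam /\
  forall lam', dirichlet_eigenvalue Om lam' -> lam <= lam'.

(* A mesh is a finite family of closed convex cells (for instance triangles
   or rectangles); sigma bounds the ratio of the diameter of a cell to the
   radius of a disc it contains. *)
Definition convex_cell K : Prop :=
  closed K /\ forall p q (t : R), K p -> K q -> 0 <= t <= 1 ->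
    K (t * p.1 + (1 - t) * q.1, t * p.2 + (1 - t) * q.2).

Definition shape_regular (sigma : R) K : Prop :=
  exists c, exists2 r : R, 0 < r &
    [set z | enorm (z - c) < r] `<=` K /\
    forall p q, K p -> K q -> enorm (p - q) <= sigma * r.

Definition shape_regular_partition Om (sigma : R) (m : nat)
    (T : 'I_m -> set (R * R)) : Prop :=
  [/\ forall i, convex_cell (T i),
      forall i, shape_regular sigma (T i),
      forall i j, i != j -> interior (T i) `&` interior (T j) = set0 &
      closure Om = \bigcup_i T i].

Definition poly_eval (k : nat) (c : nat -> nat -> R) z : R :=
  \sum_(i < k.+1) \sum_(j < k.+1 | (i + j <= k)%N) c i j * z.1 ^+ i * z.2 ^+ j.

Definition piecewise_poly (k m : nat) (T : 'I_m -> set (R * R)) v : Prop :=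
  forall i, exists c, forall z, T i z -> v z = poly_eval k c z.

(* C^1 functions on Om whose values and gradient extend continuously to
   closure Om; they are set to zero off closure Om, so that equality of such
   functions is equality on closure Om. *)
Definition C1_closure Om v : Prop :=
  [/\ {within closure Om, continuous v},
      exists g1 g2 : R * R -> R,
        [/\ {within closure Om, continuous g1},
            {within closure Om, continuous g2} &
            forall z, Om z ->
              is_derive z.1 1 (fun t => v (t, z.2)) (g1 z) /\
              is_derive z.2 1 (fun t => v (z.1, t)) (g2 z)] &
      forall z, ~ closure Om z -> v z = 0].

Definition C1_fe_space Om (k m : nat) (T : 'I_m -> set (R * R))
    (S : set (R * R -> R)) : Prop :=
  linear_subspace S /\
  forall v, S v -> C1_closure Om v /\ piecewise_poly k T v.

(* n is a unit normal (of either orientation) to the boundary at p: the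
   boundary is tangent at p to the line through p orthogonal to n.  There is
   none at a corner. *)
Definition unit_normal Om p n : Prop :=
  enorm n = 1 /\ forall e : R, 0 < e ->
    \forall x \near within (boundary Om) (nbhs p),
      `|dot (x - p) n| <= e * enorm (x - p).

(* The boundary value of the normal derivative is its limit from inside Om. *)
Definition normal_derivative_vanishes Om v : Prop :=
  forall p n, boundary Om p -> unit_normal Om p n ->
    (fun z => dot (pdx v z, pdy v z) n) @ within Om (nbhs p) --> (0 : R).

Definition fe_space0 Om (S : set (R * R -> R)) : set (R * R -> R) :=
  [set v | [/\ S v, forall p, boundary Om p -> v p = 0 &
               normal_derivative_vanishes Om v]].

Definition fe_ball Om (S0 : set (R * R -> R)) (rho : R) : set (R * R -> R) :=
  [set v | S0 v /\ grad_norm Om v <= rho].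

Definition form_a Om v w : R := ip Om (lap Om v) (lap Om w).
Definition form_b0 Om v w : R := - (1 / 2) * (ip Om (dx Om v) w - ip Om v (dx Om w)).
Definition form_b Om psi v w : R :=
  ip Om (lap Om psi)
    (fun z => dy Om v z * dx Om w z - dx Om v z * dy Om w z).

Definition backward_euler_step Om (S0 : set (R * R -> R)) (nu mu dt : R)
    (F : (R * R -> R) -> R) (Psi Psi' : R * R -> R) : Prop :=
  S0 Psi' /\ forall chi, S0 chi ->
    grad_ip Om (fun z => (Psi' z - Psi z) / dt) chi + nu * form_a Om Psi' chi
      + form_b Om Psi' Psi' chi + mu * form_b0 Om Psi' chi
    = mu * F chi.

(* SN N Psi is the N-th iterate of the scheme started at Psi.  When the scheme is
   uniquely solvable, this determines SN on S0. *)
Definition solution_operator Om (S0 : set (R * R -> R)) (nu mu dt : R)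
    (F : (R * R -> R) -> R) (SN : nat -> (R * R -> R) -> (R * R -> R)) : Prop :=
  forall Psi, S0 Psi -> SN 0%N Psi = Psi /\
    forall N, backward_euler_step Om S0 nu mu dt F (SN N Psi) (SN N.+1 Psi).

Definition time (dt : R) (N : nat) : R := N%:R * dt.

Definition bounded_absorbing_set Om (S0 : set (R * R -> R)) (dt : R)
    (SN : nat -> (R * R -> R) -> (R * R -> R)) (B : set (R * R -> R)) : Prop :=
  [/\ B `<=` S0,
      exists M : R, forall v, B v -> grad_norm Om v <= M &
      forall rho : R, 0 < rho -> exists nstar : nat, 0 < time dt nstar /\
        forall N : nat, time dt nstar <= time dt N ->
          SN N @` fe_ball Om S0 rho `<=` B].

End plane.

(* Main.v *)
(* Testing the scheme with its own solution kills the trilinear and the skew form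
   and, with lam1 |grad u|^2 <= |lap u|^2 on H^2_0, gives
     (1 + nu dt lam1) |grad Psi^n|^2 <= |grad Psi^(n-1)|^2 + dt mu^2 |F|^2 / nu,
   so that limsup |grad Psi^n|^2 <= mu^2 |F|^2 / (nu^2 lam1), which is below rho0^2
   because 4 alpha < nu lam1.

   The inequality on H^2_0 follows, by density and integration by parts, from
   lam1 |w|^2 <= |grad w|^2 for test functions w. If the latter failed, a minimizing
   sequence of the Rayleigh quotient would converge, by compactness, to an
   eigenfunction with eigenvalue below lam1.

   Elements of S_h^0 belong to H^2_0: the gradient vanishes on the whole boundary,
   since where it did not, its direction would be a unit normal; hence the extension
   by 0 is C^{1,1}. Blending its local polynomials with a smooth partition of unity
   on a grid, and dropping the boxes not inside the domain, gives test functions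
   whose derivatives up to order 2 are bounded and converge almost everywhere. *)
Require Import Defs.
From HB Require Import structures.
From mathcomp Require Import all_boot all_order all_algebra.
From mathcomp Require Import all_classical all_reals all_analysis.
From mathcomp Require Import measurable_realfun ring lra.

Set Implicit Arguments.
Unset Strict Implicit.
Unset Printing Implicit Defensive.

Import Order.TTheory GRing.Theory Num.Theory.
Import numFieldNormedType.Exports.

Local Open Scope classical_set_scope.
Local Open Scope ring_scope.

(** * Measure in the plane and square integrable functions *)

Section plane_measure.
Context {R : realType}.
Local Notation mu := (@lebesgue_measure R).
Local Notation mu2 := (@lebesgue_measure R \x @lebesgue_measure R)%E.

(** The boundary of [Om] is known only through the mesh, and H^2_0 is a closure of test functions,
    so a finite element function needs explicit compactly supported approximants. Dilating inward
    and mollifying would ask for a star-shaped or Lipschitz boundary. Scaling replaces it: value and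
    gradient vanish off [Om], so at distance O(1/N) from the complement the function is O(N^-2) and
    its gradient O(N^-1). Putting 0 for it on boxes of side O(1/N) then costs errors that the
    factors N^2 and N of differentiated weights bring back to O(1). Second derivatives stay bounded
    instead of converging uniformly, and dominated convergence does the rest. Compactness also
    avoids mollifiers, and convergence along an ultrafilter replaces the extraction of subsequences.
    The equation of the minimizer comes from the Cauchy-Schwarz inequality of the semidefinite form
    (grad, grad) - lam (., .), whose diagonal tends to 0 along the minimizing sequence. *)

Lemma open_boxP (A : set (R * R)) (z : R * R) : open A -> A z ->
  exists2 e : R, 0 < e & forall w : R * R,
    `|z.1 - w.1| < e -> `|z.2 - w.2| < e -> A w.
Proof.
move=> oA Az; have /nbhs_ballP[e /= e0 eA] : nbhs z A by exact: open_nbhs_nbhs.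
by exists e => // w w1 w2; apply: eA; split.
Qed.

Definition rat_box (q : rat * rat * rat * rat) : set (R * R) :=
  `]ratr q.1.1.1, ratr q.1.1.2[ `*` `]ratr q.1.2, ratr q.2[.

Definition rat_cbox (q : rat * rat * rat * rat) : set (R * R) :=
  `[ratr q.1.1.1, ratr q.1.1.2] `*` `[ratr q.1.2, ratr q.2].

Lemma rat_approx (x e : R) : 0 < e -> exists a b : rat,
  [/\ x - e < ratr a, ratr a < x, x < ratr b & ratr b < x + e].
Proof.
move=> e0.
have /rat_in_itvoo[a] : x - e < x by rewrite ltrBlDr ltrDl.
rewrite in_itv => /= /andP[xa ax].
have /rat_in_itvoo[b] : x < x + e by rewrite ltrDl.
rewrite in_itv => /= /andP[xb bx].
by exists a, b.
Qed.

(** Rational boxes are countably many, which gives measurability here and a countable union of null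
    sets in [orth_test_ae0]. It is the closed box that must lie in [A], so that functions supported
    in it are test functions. *)
Lemma open_rat_boxes (A : set (R * R)) : open A ->
  A = \bigcup_(q in [set q | rat_cbox q `<=` A]) rat_box q.
Proof.
move=> oA; rewrite eqEsubset; split=> [z Az|z [q qA] [/= z1 z2]]; last first.
  by apply: qA; split; apply: subset_itv_oo_cc.
have [e e0 eA] := open_boxP oA Az.
have [a [b [a1 a2 b1 b2]]] := rat_approx z.1 e0.
have [c [d [c1 c2 d1 d2]]] := rat_approx z.2 e0.
exists (a, b, c, d).
  move=> w [] /=; rewrite !in_itv/= => /andP[aw wb] /andP[cw wd].
  by apply: eA; rewrite ltr_norml; apply/andP; split; lra.
by split; rewrite /= in_itv/=; apply/andP; split.
Qed.

Lemma open_measurable2 (A : set (R * R)) : open A -> measurable A.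
Proof.
move=> /open_rat_boxes ->; rewrite bigcup_mkcond.
apply: countable_bigcupT_measurable => // q.
by case: ifP => _; [apply: measurableX; exact: measurable_itv|].
Qed.

Lemma closed_measurable2 (A : set (R * R)) : closed A -> measurable A.
Proof. by rewrite -openC => /open_measurable2/measurableC; rewrite setCK. Qed.

Lemma continuous_measurable2 (f : R * R -> R) :
  continuous f -> measurable_fun setT f.
Proof.
move=> cf; apply: (measurability _ (RGenOInfty.measurableE R)).
move=> _ [_ [x ->] <-]; rewrite setTI.
by apply: open_measurable2; apply: open_comp => // z _; exact: cf.
Qed.

(** Quadrants are stable under intersection, so that as generators they admit Dynkin induction in
    [orth_obox_ae]. *)
Lemma plane_measurable_rays : @measurable _ (R * R)%type =
  <<s [set A | exists x y : R, A = `]x, +oo[%classic `*` `]y, +oo[%classic] >>.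
Proof.
set G := [set A | _].
rewrite eqEsubset; split; last first.
  apply: smallest_sub; first exact: sigma_algebra_measurable.
  by move=> _ [x [y ->]]; apply: measurableX; exact: measurable_itv.
have m1 : measurable_fun (setT : set (g_sigma_algebraType G)) (fst : R * R -> R).
  apply: (measurability _ (RGenOInfty.measurableE R)).
  move=> _ [_ [x ->] <-]; rewrite setTI.
  rewrite [X in measurable X](_ : _ =
    \bigcup_n (`]x, +oo[%classic `*` `](- n%:R : R), +oo[%classic)).
    by apply: bigcupT_measurable => n; apply: sub_sigma_algebra; exists x, (- n%:R).
  rewrite eqEsubset; split=> [z /= xz|z [n _] [] //].
  exists (Num.bound z.2) => //; split => //=; rewrite in_itv/= andbT.
  by rewrite ltrNl unstable.ltrNbound.
have m2 : measurable_fun (setT : set (g_sigma_algebraType G)) (snd : R * R -> R).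
  apply: (measurability _ (RGenOInfty.measurableE R)).
  move=> _ [_ [x ->] <-]; rewrite setTI.
  rewrite [X in measurable X](_ : _ =
    \bigcup_n (`](- n%:R : R), +oo[%classic `*` `]x, +oo[%classic)).
    by apply: bigcupT_measurable => n; apply: sub_sigma_algebra; exists (- n%:R), x.
  rewrite eqEsubset; split=> [z /= xz|z [n _] [] //].
  exists (Num.bound z.1) => //; split => //=; rewrite in_itv/= andbT.
  by rewrite ltrNl unstable.ltrNbound.
rewrite measurable_prod_measurableType; apply: smallest_sub.
  exact: smallest_sigma_algebra.
move=> _ [A mA [B mB <-]].
have -> : A `*` B = (fst @^-1` A) `&` (snd @^-1` B) by [].
apply: (@measurableI _ (g_sigma_algebraType G)).
  by rewrite -[X in measurable X]setTI; exact: m1.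
by rewrite -[X in measurable X]setTI; exact: m2.
Qed.

Lemma bounded_cbox (A : set (R * R)) : bounded_set A ->
  exists2 M : R, 0 < M & forall z, A z -> `|z.1| < M /\ `|z.2| < M.
Proof.
move=> [M [_ bM]]; exists (`|M| + 2); first by rewrite ltr_wpDl.
move=> z Az; have := bM (`|M| + 1).
have -> : M < `|M| + 1 by rewrite ltr_pwDr// ler_norm.
move=> /(_ isT z Az); rewrite /= prod_normE ge_max => /andP[z1 z2].
by split; lra.
Qed.

Lemma bounded_measure_lty (A : set (R * R)) : measurable A -> bounded_set A ->
  (mu2 A < +oo)%E.
Proof.
move=> mA /bounded_cbox[M M0 AM].
apply: (@le_lt_trans _ _ (mu2 (`[- M, M] `*` `[- M, M]))).
  apply: le_measure; rewrite ?inE//; first exact: measurableX.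
  move=> z /AM; rewrite !ltr_norml => -[/andP[a b] /andP[c d]].
  by split; rewrite /= in_itv/= !ltW.
rewrite [X in (X < _)%E]product_measure1E//= !lebesgue_measure_itv/=.
by case: ifPn => _; rewrite ?mul0e// -EFinM ltry.
Qed.

End plane_measure.

(* ip and L2norm are sealed because failed unification of two of their instances
   would unfold the integrals. *)
HB.lock Definition sip (R : realType) (Om : set (R * R)) (u v : R * R -> R) : R :=
  ip Om u v.
HB.lock Definition nrm (R : realType) (Om : set (R * R)) (u : R * R -> R) : R :=
  L2norm Om u.

(** * The Hilbert space L^2: Cauchy-Schwarz, dominated convergence, completeness *)

Section square_integrable.
Context {R : realType} (Om : set (R * R)).
Hypothesis mOm : measurable (Om : set (measurableTypeR R * measurableTypeR R)).
Local Notation mu := (@lebesgue_measure R).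
Local Notation mu2 := (@lebesgue_measure R \x @lebesgue_measure R)%E.
Implicit Types u v w : R * R -> R.

Definition ae_eq_on u v : Prop := {ae mu2, forall z, Om z -> u z = v z}.

Lemma ae_imp (P Q : R * R -> Prop) : {ae mu2, forall z, P z} ->
  (forall z, P z -> Q z) -> {ae mu2, forall z, Q z}.
Proof.
move=> aP PQ; apply: (@filterS _ _ (ae_filter_ringOfSetsType mu2)) aP => z.
exact: PQ.
Qed.

Lemma ae_imp2 (P Q S : R * R -> Prop) : {ae mu2, forall z, P z} ->
  {ae mu2, forall z, Q z} -> (forall z, P z -> Q z -> S z) ->
  {ae mu2, forall z, S z}.
Proof.
move=> aP aQ h.
by apply: (@filterS2 _ _ (ae_filter_ringOfSetsType mu2)) aP aQ => z; exact: h.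
Qed.

Lemma L2_measurable u : L2 Om u -> measurable_fun Om u.
Proof. by case. Qed.

Lemma L2M_integrable u v : L2 Om u -> L2 Om v ->
  mu2.-integrable Om (fun z => (u z * v z)%:E).
Proof.
move=> [mu_ iu] [mv iv].
apply: (le_integrable mOm _ _ (integrableD mOm iu iv)).
  by apply/measurable_EFinP; exact: measurable_funM.
move=> z Dz; rewrite !abse_EFin lee_fin.
rewrite [X in _ <= X]ger0_norm ?addr_ge0 ?sqr_ge0// normrM.
have := sqr_ge0 (`|u z| - `|v z|); rewrite -(real_normK (num_real (u z))).
rewrite -(real_normK (num_real (v z))) => h.
have := sqr_ge0 `|u z|; have := sqr_ge0 `|v z|; nra.
Qed.

Lemma L2_sq_integrable u : L2 Om u -> mu2.-integrable Om (fun z => (u z * u z)%:E).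
Proof. by move=> h; exact: L2M_integrable. Qed.

Lemma L2_of_sq_integrable u : measurable_fun Om u ->
  mu2.-integrable Om (fun z => (u z * u z)%:E) -> L2 Om u.
Proof.
move=> m1 i1; split=> //; apply: eq_integrable i1 => // z _.
Qed.

Lemma L2_lincomb (a : R) u v : L2 Om u -> L2 Om v -> L2 Om (lincomb a u v).
Proof.
move=> hu hv; have [mu_ iu] := hu; have [mv iv] := hv.
apply: L2_of_sq_integrable.
  by apply: measurable_funD => //; exact: measurable_funM.
have i1 := integrableZl mOm (a ^+ 2) (L2_sq_integrable hu).
have i2 := integrableZl mOm (2 * a) (L2M_integrable hu hv).
have i3 := integrableD mOm i1 (integrableD mOm i2 (L2_sq_integrable hv)).
apply: eq_integrable i3 => // z _ /=.
by rewrite -!EFinM -!EFinD /lincomb; congr EFin; ring.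
Qed.

Lemma L2_cst0 : L2 Om (cst 0).
Proof.
apply: L2_of_sq_integrable => //.
by under eq_fun do rewrite mulr0; exact: integrable0.
Qed.

Lemma L2Z (a : R) u : L2 Om u -> L2 Om (fun z => a * u z).
Proof.
move=> hu; have := L2_lincomb a hu L2_cst0; rewrite /lincomb.
by under eq_fun do rewrite addr0.
Qed.

Lemma L2D u v : L2 Om u -> L2 Om v -> L2 Om (fun z => u z + v z).
Proof.
move=> hu hv; have := L2_lincomb 1 hu hv; rewrite /lincomb.
by under eq_fun do rewrite mul1r.
Qed.

Lemma L2B u v : L2 Om u -> L2 Om v -> L2 Om (fun z => u z - v z).
Proof.
move=> hu hv; have := L2_lincomb (-1) hv hu; rewrite /lincomb.
by under eq_fun do rewrite mulN1r addrC.
Qed.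

Lemma bounded_integrable u (C : R) : (mu2 Om < +oo)%E -> measurable_fun Om u ->
  (forall z, Om z -> `|u z| <= C) -> mu2.-integrable Om (fun z => (u z)%:E).
Proof.
move=> fOm mu_ bu; apply: (le_integrable mOm (g := cst C%:E)) => //.
- exact/measurable_EFinP.
- move=> z Oz; rewrite !abse_EFin lee_fin.
  by rewrite (le_trans (bu z Oz))// ler_norm.
- apply/integrableP; split; first exact: measurable_cst.
  by rewrite integral_cst//= lte_mul_pinfty.
Qed.

Lemma L2_bounded u (C : R) : (mu2 Om < +oo)%E -> measurable_fun Om u ->
  (forall z, Om z -> `|u z| <= C) -> L2 Om u.
Proof.
move=> fOm mu_ bu; apply: L2_of_sq_integrable => //.
apply: (bounded_integrable (C := C * C)) => //; first exact: measurable_funM.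
by move=> z Oz; rewrite normrM ler_pM// ?bu.
Qed.

Lemma L2_integrable u : (mu2 Om < +oo)%E -> L2 Om u ->
  mu2.-integrable Om (fun z => (u z)%:E).
Proof.
move=> fOm hu.
have h1 : L2 Om (cst 1).
  by apply: (L2_bounded (C := 1)) => // z _; rewrite normr1.
by apply: eq_integrable (L2M_integrable hu h1) => // z _ /=; rewrite mulr1.
Qed.

Lemma ipC u v : sip Om u v = sip Om v u.
Proof. by rewrite sip.unlock /ip; under eq_Rintegral do rewrite mulrC. Qed.

Lemma ip_lincombl (a : R) u v w : L2 Om u -> L2 Om v -> L2 Om w ->
  sip Om (lincomb a u v) w = a * sip Om u w + sip Om v w.
Proof.
move=> hu hv hw; rewrite sip.unlock /ip /lincomb.
rewrite -RintegralZl//; last exact: L2M_integrable.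
rewrite -RintegralD//; last 2 first.
- exact: (integrableZl mOm a (L2M_integrable hu hw)).
- exact: L2M_integrable.
by apply: eq_Rintegral => z _; ring.
Qed.

Lemma ip_lincombr (a : R) u v w : L2 Om u -> L2 Om v -> L2 Om w ->
  sip Om w (lincomb a u v) = a * sip Om w u + sip Om w v.
Proof. by move=> *; rewrite ipC ip_lincombl// !(ipC w). Qed.

Lemma ip0l w : sip Om (cst 0) w = 0.
Proof.
rewrite sip.unlock /ip (eq_Rintegral _ (g := cst 0)) => [|z _ /=]; last by rewrite mul0r.
by rewrite Rintegral_cst// mul0r.
Qed.

Lemma ipZl (a : R) u w : L2 Om u -> L2 Om w ->
  sip Om (fun z => a * u z) w = a * sip Om u w.
Proof.
move=> hu hw; have := ip_lincombl a hu L2_cst0 hw; rewrite ip0l addr0 => <-.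
by congr sip; apply/funext => z; rewrite /lincomb addr0.
Qed.

Lemma ipDl u v w : L2 Om u -> L2 Om v -> L2 Om w ->
  sip Om (fun z => u z + v z) w = sip Om u w + sip Om v w.
Proof.
move=> hu hv hw; have := ip_lincombl 1 hu hv hw; rewrite mul1r => <-.
by congr sip; apply/funext => z; rewrite /lincomb mul1r.
Qed.

Lemma ipBl u v w : L2 Om u -> L2 Om v -> L2 Om w ->
  sip Om (fun z => u z - v z) w = sip Om u w - sip Om v w.
Proof.
move=> hu hv hw; have := ip_lincombl (-1) hv hu hw; rewrite mulN1r addrC => <-.
by congr sip; apply/funext => z; rewrite /lincomb mulN1r addrC.
Qed.

Lemma ipZr (a : R) u w : L2 Om u -> L2 Om w ->
  sip Om w (fun z => a * u z) = a * sip Om w u.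
Proof. by move=> *; rewrite ipC ipZl// ipC. Qed.

Lemma ipDr u v w : L2 Om u -> L2 Om v -> L2 Om w ->
  sip Om w (fun z => u z + v z) = sip Om w u + sip Om w v.
Proof. by move=> *; rewrite ipC ipDl// !(ipC w). Qed.

Lemma ipBr u v w : L2 Om u -> L2 Om v -> L2 Om w ->
  sip Om w (fun z => u z - v z) = sip Om w u - sip Om w v.
Proof. by move=> *; rewrite ipC ipBl// !(ipC w). Qed.

Lemma ip_ge0 u : 0 <= sip Om u u.
Proof. by rewrite sip.unlock; apply: Rintegral_ge0 => z _; rewrite -expr2 sqr_ge0. Qed.

Lemma ip_sqD u v : L2 Om u -> L2 Om v ->
  sip Om (fun z => u z + v z) (fun z => u z + v z) =
  sip Om u u + 2 * sip Om u v + sip Om v v.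
Proof.
move=> hu hv; rewrite ipDl ?ipDr//; do ?exact: L2D.
by rewrite (ipC v u); ring.
Qed.

Lemma ip_sqB u v : L2 Om u -> L2 Om v ->
  sip Om (fun z => u z - v z) (fun z => u z - v z) =
  sip Om u u - 2 * sip Om u v + sip Om v v.
Proof.
move=> hu hv; rewrite ipBl ?ipBr//; do ?exact: L2B.
by rewrite (ipC v u); ring.
Qed.

(** Serves the inner product as well as the form [qtest], which is only semidefinite; hence the case
    a = 0. *)
Lemma quadratic_discr (a b c : R) : 0 <= a -> 0 <= c ->
  (forall t, 0 <= t ^+ 2 * a + 2 * t * b + c) -> b ^+ 2 <= a * c.
Proof.
move=> a0 c0 h; have [a_0|a_0] := eqVneq a 0.
  rewrite a_0 mul0r; have [->|b0] := eqVneq b 0; first by rewrite expr0n.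
  (* For a = 0 the polynomial is affine, and this t gives it the value -1. *)
  have := h (- (c + 1) / (2 * b)).
  have -> : (- (c + 1) / (2 * b)) ^+ 2 * a + 2 * (- (c + 1) / (2 * b)) * b + c
     = -1 by rewrite a_0; field.
  by rewrite lerNr oppr0 ler10.
have := h (- b / a).
have -> : (- b / a) ^+ 2 * a + 2 * (- b / a) * b + c = (a * c - b ^+ 2) / a.
  by field.
by rewrite pmulr_lge0 ?invr_gt0 ?lt_def ?a_0// subr_ge0.
Qed.

Lemma cauchy_schwarz u v : L2 Om u -> L2 Om v ->
  sip Om u v ^+ 2 <= sip Om u u * sip Om v v.
Proof.
move=> hu hv; apply: quadratic_discr; rewrite ?ip_ge0// => t.
have := ip_ge0 (lincomb t u v).
rewrite ip_lincombl ?ip_lincombr//; last exact: L2_lincomb.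
by rewrite (ipC v u); lra.
Qed.

Lemma sipE u v : sip Om u v = ip Om u v.
Proof. by rewrite sip.unlock. Qed.

Lemma nrmE u : nrm Om u = Num.sqrt (sip Om u u).
Proof. by rewrite nrm.unlock sip.unlock. Qed.

Lemma nrm_ge0 u : 0 <= nrm Om u.
Proof. by rewrite nrmE sqrtr_ge0. Qed.

Lemma nrm_sq u : nrm Om u ^+ 2 = sip Om u u.
Proof. by rewrite nrmE sqr_sqrtr// ip_ge0. Qed.

Lemma ip_le_nrm u v : L2 Om u -> L2 Om v ->
  `|sip Om u v| <= nrm Om u * nrm Om v.
Proof.
move=> hu hv; rewrite -ler_sqr ?nnegrE ?mulr_ge0 ?nrm_ge0//.
by rewrite exprMn !nrm_sq real_normK ?num_real// cauchy_schwarz.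
Qed.

Lemma nrmD u v : L2 Om u -> L2 Om v ->
  nrm Om (fun z => u z + v z) <= nrm Om u + nrm Om v.
Proof.
move=> hu hv; rewrite -ler_sqr ?nnegrE ?addr_ge0 ?nrm_ge0//.
rewrite nrm_sq ip_sqD// sqrrD !nrm_sq.
have := ler_norm (sip Om u v); have := ip_le_nrm hu hv; lra.
Qed.

Lemma ae_eq_on_refl u : ae_eq_on u u.
Proof. exact: aeW. Qed.

Lemma ae_eq_on_sym u v : ae_eq_on u v -> ae_eq_on v u.
Proof. by move=> e; apply: (ae_imp e) => z h Oz; rewrite h. Qed.

Lemma ae_eq_onB u u' v v' : ae_eq_on u u' -> ae_eq_on v v' ->
  ae_eq_on (fun z => u z - v z) (fun z => u' z - v' z).
Proof. by move=> e1 e2; apply: (ae_imp2 e1 e2) => z h1 h2 Oz; rewrite h1// h2. Qed.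

Lemma ip_ae u u' v v' : L2 Om u -> L2 Om u' -> L2 Om v -> L2 Om v' ->
  ae_eq_on u u' -> ae_eq_on v v' -> sip Om u v = sip Om u' v'.
Proof.
move=> [h1 _] [h2 _] [h3 _] [h4 _] e1 e2; rewrite sip.unlock /ip /Rintegral; congr fine.
apply: ae_eq_integral => //.
- by apply/measurable_EFinP; exact: measurable_funM.
- by apply/measurable_EFinP; exact: measurable_funM.
by apply: (ae_imp2 e1 e2) => z h1' h2' Oz /=; rewrite h1'// h2'.
Qed.

Lemma nrm_ae u u' : L2 Om u -> L2 Om u' -> ae_eq_on u u' ->
  nrm Om u = nrm Om u'.
Proof. by move=> hu hu' e; rewrite !nrmE (ip_ae hu hu' hu hu'). Qed.

Lemma integral_sq_ip u : L2 Om u ->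
  (\int[mu2]_(z in Om) (u z ^+ 2)%:E = (sip Om u u)%:E)%E.
Proof.
move=> hu; rewrite sip.unlock /ip /Rintegral fineK.
  by apply: eq_integral => z _; rewrite expr2.
exact: integrable_fin_num (L2_sq_integrable hu).
Qed.

Lemma ip_dominated (f : nat -> R * R -> R) g (C : R) :
  (mu2 Om < +oo)%E -> L2 Om g ->
  (forall n, measurable_fun Om (f n)) ->
  (forall n z, Om z -> `|f n z - g z| <= C) ->
  {ae mu2, forall z, Om z -> f n z @[n --> \oo] --> g z} ->
  sip Om (fun z => f n z - g z) (fun z => f n z - g z) @[n --> \oo] --> (0 : R).
Proof.
move=> fOm [mg ig] mf bf cf.
pose h n z : \bar R := ((f n z - g z) * (f n z - g z))%:E.
have mh n : measurable_fun Om (h n).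
  apply/measurable_EFinP; apply: measurable_funM; exact: measurable_funB.
have [_ _] : [/\ mu2.-integrable Om (fun=> 0%E),
   [sequence (\int[mu2]_(x in Om) (`|h n x - 0|)%E)%E]_n @ \oo --> 0%E &
   [sequence (\int[mu2]_(x in Om) h n x)%E]_n @ \oo -->
      (\int[mu2]_(x in Om) (fun=> 0%E) x)%E].
  apply: (dominated_convergence mOm (g := fun=> (C * C)%:E)) => //.
  - apply: (ae_imp cf) => z cz Oz.
    have c0 : f n z - g z @[n --> \oo] --> (0 : R).
      by rewrite -(subrr (g z)); apply: cvgB; [exact: cz|exact: cvg_cst].
    have := cvgM c0 c0; rewrite mul0r => c1.
    by apply: cvg_EFin; [exact: nearW|exact: c1].
  - apply/integrableP; split; first exact: measurable_cst.
    by rewrite integral_cst//= lte_mul_pinfty.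
  - apply: aeW => z n Oz; rewrite abse_EFin lee_fin normrM.
    by rewrite ler_pM// bf.
rewrite integral0 => c0.
have -> : (fun n => sip Om (fun z => f n z - g z) (fun z => f n z - g z)) =
    (fine \o (fun n => \int[mu2]_(x in Om) h n x)%E) by rewrite sip.unlock.
by apply: fine_cvg; exact: c0.
Qed.

(** The weight forces [|a n| <= sqrt H * 2^-n], a geometric majorant. *)
Lemma ltr_sum_geometric (a : nat -> R) (H : R) :
  (forall n, 4 ^+ n * a n ^+ 2 <= H) -> cvgn (series a).
Proof.
move=> aH; have H0 : 0 <= H.
  by have := aH 0%N; rewrite expr0 mul1r; apply: le_trans; exact: sqr_ge0.
apply: normed_cvg; apply: (@series_le_cvg _ _ (geometric (Num.sqrt H) (2^-1))).
- by move=> n /=.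
- by move=> n /=; rewrite mulr_ge0 ?sqrtr_ge0// exprn_ge0.
- move=> n /=; rewrite -ler_sqr ?nnegrE ?mulr_ge0 ?sqrtr_ge0 ?exprn_ge0//.
  rewrite exprMn sqr_sqrtr// real_normK ?num_real// -exprM mulnC exprM.
  rewrite exprVn exprVn ler_pdivlMr ?exprn_gt0//.
  by rewrite mulrC (_ : 2 ^+ 2 = 4 :> R)//; ring.
- by apply: is_cvg_geometric_series; rewrite ger0_norm//; lra.
Qed.

(** Riesz-Fischer with a rate. The squared increments decay like 8^-n, so their integrals remain
    summable after multiplication by 4^n; hence almost everywhere the increments are O(2^-n) and the
    telescoping series converges. The rate 4 * 4^-m is the square of the tail of the series of 2^-n
    from m on. *)
Lemma L2_complete (f : nat -> R * R -> R) : (forall n, L2 Om (f n)) ->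
  (forall n, sip Om (fun z => f n.+1 z - f n z) (fun z => f n.+1 z - f n z)
     <= 8^-1 ^+ n) ->
  exists2 g, L2 Om g & forall m,
    sip Om (fun z => f m z - g z) (fun z => f m z - g z) <= 4 * 4^-1 ^+ m.
Proof.
move=> hf df.
pose d n z := f n.+1 z - f n z.
have hd n : L2 Om (d n) by exact: L2B.
pose h n z : \bar R := (4 ^+ n * d n z ^+ 2)%:E.
have h0 n z : (0 <= h n z)%E.
  by rewrite /h lee_fin mulr_ge0// ?sqr_ge0// exprn_ge0.
have mh n : measurable_fun Om (h n).
  apply/measurable_EFinP; apply: measurable_funM => //.
  by apply: measurable_funX; exact: L2_measurable.
have ih n : (\int[mu2]_(z in Om) h n z <= (2^-1 ^+ n)%:E)%E.
  rewrite /h; under eq_integral do rewrite EFinM.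
  rewrite ge0_integralZl//; last 2 first.
  - by apply/measurable_EFinP; apply: measurable_funX; exact: L2_measurable.
  - by move=> z _; rewrite lee_fin sqr_ge0.
  rewrite integral_sq_ip// -EFinM lee_fin.
  rewrite (le_trans (ler_wpM2l _ (df n))) ?exprn_ge0// -exprMn.
  by rewrite (_ : 4 * 8^-1 = 2^-1 :> R)//; field.
have ser : {ae mu2, forall z, Om z -> (\sum_(n <oo) h n z)%E \is a fin_num}.
  apply: integrable_ae => //; apply/integrableP; split.
    exact: (@ge0_emeasurable_sum _ _ R Om h xpredT (fun n z _ _ => h0 n z) (fun n _ => mh n)).
  have hs z : (0 <= \sum_(n <oo) h n z)%E by exact: nneseries_ge0.
  under eq_integral do rewrite gee0_abs//.
  rewrite integral_nneseries//.
  apply: (@le_lt_trans _ _ (\sum_(n <oo) (2 / (2 ^ (n + 1))%:R)%:E)%E).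
    apply: lee_nneseries => [n _ _|n _]; first exact: integral_ge0.
    rewrite (le_trans (ih n))// lee_fin addn1 expnS natrM natrX invfM mulrA.
    by rewrite mulfV ?mul1r ?exprVn.
  by rewrite (cvg_lim _ (@cvg_geometric_eseries_half _ 2 0))// ltry.
have cvf : {ae mu2, forall z, Om z -> cvgn (f ^~ z)}.
  apply: (ae_imp ser) => z sz Oz; have {sz}/fineK sz := sz Oz.
  have cs : cvgn (series (d ^~ z)).
    apply: (@ltr_sum_geometric _ (fine (\sum_(n <oo) h n z))) => n.
    rewrite -lee_fin sz; have := @nneseries_lim_ge R (h ^~ z) xpredT 0 n.+1.
    move=> /(_ (fun n _ _ => h0 n z)); apply: le_trans.
    rewrite big_nat_recr//= leeDr//; exact: sume_ge0.
  have -> : f ^~ z = (fun n => f 0%N z + series (d ^~ z) n).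
    apply/funext => n; rewrite (_ : d ^~ z = telescope (f ^~ z))//.
    by rewrite telescopeK /= addrC subrK.
  by apply: is_cvgD => //; exact: is_cvg_cst.
(* A limsup in place of the limit is defined everywhere and measurable. *)
pose g z := fine (limn_esup (fun n => (f n z)%:E)).
have cvg : {ae mu2, forall z, Om z -> f n z @[n --> \oo] --> g z}.
  apply: (ae_imp cvf) => z cz Oz; have {cz} := cz Oz => cz.
  rewrite /g (_ : limn_esup _ = (limn (f ^~ z))%:E)//.
  have : (f n z)%:E @[n --> \oo] --> (limn (f ^~ z))%:E.
    by apply: cvg_EFin; [exact: nearW|exact: cz].
  by move=> /cvg_limn_einf_sup[_ ->].
have mg : measurable_fun Om g.
  apply: measurableT_comp => //; apply: measurable_fun_limn_esup => n.
  by apply/measurable_EFinP; exact: L2_measurable.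
have hfm m n : L2 Om (fun z => f m z - f n z) by exact: L2B.
have nd k : nrm Om (d k) <= 2^-1 ^+ k.
  rewrite -ler_sqr ?nnegrE ?nrm_ge0 ?exprn_ge0// nrm_sq.
  rewrite (le_trans (df k))// -exprM mulnC exprM.
  by apply: lerXn2r; rewrite ?nnegrE; lra.
have tail m j : nrm Om (fun z => f (m + j)%N z - f m z) <=
    2 * 2^-1 ^+ m * (1 - 2^-1 ^+ j).
  elim: j => [|j IH].
    rewrite addn0 expr0 subrr mulr0.
    rewrite (_ : (fun z => _) = cst 0); first by rewrite !nrmE ip0l sqrtr0.
    by apply/funext => z; rewrite subrr.
  have -> : (fun z => f (m + j.+1)%N z - f m z) =
      (fun z => d (m + j)%N z + (f (m + j)%N z - f m z)).
    by apply/funext => z; rewrite /d addnS addrA subrK.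
  rewrite (le_trans (nrmD (hd _) (hfm _ _)))//.
  rewrite (le_trans (lerD (nd _) IH))// exprD exprS; lra.
(* Fatou's lemma for [(f m - f n)^2] as n tends to infinity, with [tail] bounding the integrals for
   n >= m. *)
have fat m : (\int[mu2]_(z in Om) ((f m z - g z) ^+ 2)%:E <=
    (4 * 4^-1 ^+ m)%:E)%E.
  pose w n z : \bar R := ((f m z - f n z) ^+ 2)%:E.
  have mw n : measurable_fun Om (w n).
    apply/measurable_EFinP; apply: measurable_funX.
    by apply: measurable_funB; exact: L2_measurable.
  have -> : (\int[mu2]_(z in Om) ((f m z - g z) ^+ 2)%:E =
      \int[mu2]_(z in Om) limn_einf (w ^~ z))%E.
    apply: ae_eq_integral => //.
    + apply/measurable_EFinP; apply: measurable_funX; apply: measurable_funB => //.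
      exact: L2_measurable.
    + rewrite (_ : (fun z => _) = (fun z => - limn_esup ((fun n => - w n z)))%E).
        apply: (measurableT_comp (@oppe_measurable R setT)).
        apply: measurable_fun_limn_esup => n.
        exact: (measurableT_comp (@oppe_measurable R setT) (mw n)).
      by apply/funext => z; rewrite /limn_einf.
    + apply: (ae_imp cvg) => z cz Oz; have {cz} := cz Oz => cz.
      suff : w n z @[n --> \oo] --> ((f m z - g z) ^+ 2)%:E.
        by move=> /cvg_limn_einf_sup[-> _].
      have c1 : f m z - f n z @[n --> \oo] --> f m z - g z.
        by apply: cvgB => //; exact: cvg_cst.
      by have c2 := cvgM c1 c1; apply: cvg_EFin; [exact: nearW|exact: c2].
  apply: le_trans (fatou _ _ _ _) _ => //.
    by move=> n z _; rewrite lee_fin sqr_ge0.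
  rewrite limn_einf_lim; apply: lime_le; first exact: is_cvg_einfs.
  apply: nearW => n; apply: ge_ereal_inf.
  exists (\int[mu2]_(z in Om) w (m + n)%N z)%E.
    by exists (m + n)%N => //=; rewrite leq_addl.
  rewrite /w integral_sq_ip// lee_fin -nrm_sq.
  rewrite (_ : (fun z => f m z - f (m + n)%N z) =
      (fun z => -1 * (f (m + n)%N z - f m z))); last first.
    by apply/funext => z; ring.
  rewrite nrm_sq ipZl ?ipZr//; last exact: L2Z.
  rewrite mulrA mulrNN mulr1 mul1r -nrm_sq.
  apply: (@le_trans _ _ ((2 * 2^-1 ^+ m) ^+ 2)).
    rewrite ler_sqr ?nnegrE ?nrm_ge0 ?mulr_ge0 ?exprn_ge0//.
    by rewrite (le_trans (tail m n))// ler_piMr ?mulr_ge0 ?exprn_ge0.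
  rewrite exprMn -exprM mulnC exprM (_ : 2^-1 ^+ 2 = 4^-1 :> R); last by field.
  by rewrite (_ : 2 ^+ 2 = 4 :> R)//; ring.
have hfg m : L2 Om (fun z => f m z - g z).
  split; first by apply: measurable_funB => //; exact: L2_measurable.
  apply/integrableP; split.
    apply/measurable_EFinP; apply: measurable_funX.
    by apply: measurable_funB => //; exact: L2_measurable.
  under eq_integral do rewrite gee0_abs ?lee_fin ?sqr_ge0//.
  exact: le_lt_trans (fat m) (ltry _).
exists g.
  have := L2B (hf 0%N) (hfg 0%N).
  by under eq_fun do rewrite opprB addrC subrK.
by move=> m; have := fat m; rewrite integral_sq_ip.
Qed.

End square_integrable.

(** * Smooth functions and test functions *)

Section smooth_line.
Context {R : realType}.
Implicit Types (f g : R -> R) (x t : R).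

Lemma is_derive_add f g x (a b : R) : is_derive x 1 f a -> is_derive x 1 g b ->
  is_derive x 1 (fun t => f t + g t) (a + b).
Proof. by move=> hf hg; exact: (is_deriveD hf hg). Qed.

Lemma is_derive_mul f g x (a b : R) : is_derive x 1 f a -> is_derive x 1 g b ->
  is_derive x 1 (fun t => f t * g t) (a * g x + f x * b).
Proof.
move=> hf hg; have h := is_deriveM hf hg.
by apply: (is_derive_eq h); rewrite /GRing.scale/=; ring.
Qed.

Lemma is_derive_affine f x (a b d : R) : is_derive (a * x + b) 1 f d ->
  is_derive x 1 (fun t => f (a * t + b)) (a * d).
Proof.
move=> hf.
have h1 : is_derive x 1 (fun t : R => a * t + b) a.
  have h := is_derive_add (is_derive_mul (is_derive_cst a x 1) (is_derive_id x 1))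
    (is_derive_cst b x 1).
  by apply: (is_derive_eq h); rewrite mul0r add0r addr0 mulr1.
rewrite mulrC; exact: (@is_derive1_comp _ f (fun t : R => a * t + b) x _ _ hf h1).
Qed.

Lemma derive1_is f x (a : R) : is_derive x 1 f a -> derive1 f x = a.
Proof. by move=> h; rewrite derive1E derive_val. Qed.

Lemma is_derive_derive1 f x : derivable f x 1 -> is_derive x 1 f (derive1 f x).
Proof. by move=> h; rewrite derive1E; exact: derivableP. Qed.

Lemma is_derive_continuous f x (a : R) : is_derive x 1 f a -> {for x, continuous f}.
Proof.
by case=> df _; apply: differentiable_continuous; apply/derivable1_diffP.
Qed.

Fixpoint Ck1 (k : nat) f : Prop :=
  continuous f /\
  if k is k'.+1 then (forall x, derivable f x 1) /\ Ck1 k' (derive1 f) else True.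

Lemma Ck1_continuous k f : Ck1 k f -> continuous f.
Proof. by case: k => [|k] []. Qed.

Lemma Ck1S_is_derive k f df : (forall x, is_derive x 1 f (df x)) -> Ck1 k df ->
  Ck1 k.+1 f.
Proof.
move=> h kdf; split; first by move=> x; exact: is_derive_continuous (h x).
split; first by move=> x; case: (h x).
by have -> : derive1 f = df by apply/funext => x; exact: derive1_is.
Qed.

Lemma Ck1W k f : Ck1 k.+1 f -> Ck1 k f.
Proof.
elim: k f => [|k IH] f [cf [df kf]]; first by split.
by split=> //; split => //; exact: IH.
Qed.

Lemma Ck1_cst k (c : R) : Ck1 k (cst c).
Proof.
elim: k c => [|k IH] c; first by split => // x; exact: cvg_cst.
by apply: (@Ck1S_is_derive _ _ (cst 0)) => // x; exact: is_derive_cst.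
Qed.

Lemma Ck1_add k f g : Ck1 k f -> Ck1 k g -> Ck1 k (fun x => f x + g x).
Proof.
elim: k f g => [|k IH] f g.
  by move=> [cf _] [cg _]; split => // x; apply: cvgD; [exact: cf|exact: cg].
move=> [cf [df kf]] [cg [dg kg]].
apply: (@Ck1S_is_derive _ _ (fun x => derive1 f x + derive1 g x)); last exact: IH.
by move=> x; apply: is_derive_add; exact: is_derive_derive1.
Qed.

Lemma Ck1_mul k f g : Ck1 k f -> Ck1 k g -> Ck1 k (fun x => f x * g x).
Proof.
elim: k f g => [|k IH] f g.
  by move=> [cf _] [cg _]; split => // x; apply: cvgM; [exact: cf|exact: cg].
move=> kf kg; have := kf; have := kg; move=> [cg [dg kg']] [cf [df kf']].
apply: (Ck1S_is_derive (fun x =>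
  is_derive_mul (is_derive_derive1 (df x)) (is_derive_derive1 (dg x)))).
by apply: Ck1_add; apply: IH => //; exact: Ck1W.
Qed.

Lemma Ck1_inv k f : (forall x, f x != 0) -> Ck1 k f -> Ck1 k (fun x => (f x)^-1).
Proof.
move=> f0; elim: k => [|k IH].
  by move=> [cf _]; split => // x; apply: cvgV; [exact: f0|exact: cf].
move=> kf; have := kf; move=> [cf [df kf']]; have {IH} := IH (Ck1W kf) => IH.
apply: (@Ck1S_is_derive _ _
    (fun x => (-1 * ((f x)^-1 * (f x)^-1)) * derive1 f x)).
  move=> x; split; first exact: derivableV.
  by rewrite (deriveV (f0 x) (df x)) derive1E -exprVn expr2 mulN1r.
apply: Ck1_mul => //; apply: Ck1_mul; first exact: Ck1_cst.
exact: Ck1_mul.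
Qed.

Lemma Ck1_affine k f (a b : R) : Ck1 k f -> Ck1 k (fun x => f (a * x + b)).
Proof.
elim: k f => [|k IH] f.
  move=> [cf _]; split => // x.
  apply: (@continuous_comp _ _ _ (fun x : R => a * x + b) f); last exact: cf.
  by apply: cvgD; [apply: cvgM; [exact: cvg_cst|exact: cvg_id]|exact: cvg_cst].
move=> [cf [df kf]].
apply: (@Ck1S_is_derive _ _ (fun x => cst a x * (derive1 f) (a * x + b))).
  by move=> x; apply: is_derive_affine; exact: is_derive_derive1.
by apply: Ck1_mul; [exact: Ck1_cst|exact: IH].
Qed.

(* flat n t = t^(-n) exp(-1/t) for t > 0 and 0 otherwise; the derivative of
   flat n is - n flat (n+1) + flat (n+2). *)
Definition flat (n : nat) (t : R) : R :=
  if 0 < t then t^-1 ^+ n * expR (- t^-1) else 0.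

Lemma flat_ge0 n t : 0 <= flat n t.
Proof.
rewrite /flat; case: ifP => // t0.
by rewrite mulr_ge0 ?expR_ge0// exprn_ge0// invr_ge0 ltW.
Qed.

Lemma flat_gt0 t : 0 < t -> 0 < flat 0 t.
Proof. by move=> t0; rewrite /flat t0 expr0 mul1r expR_gt0. Qed.

Lemma flat_le0 n t : t <= 0 -> flat n t = 0.
Proof. by rewrite /flat leNgt => /negbTE ->. Qed.

(** One term of the exponential series at 1/t beats the power. A quadratic bound is what
    [is_derive_sq_bound] needs in order to differentiate [flat n] at 0. *)
Lemma flat_le_sq n t : `|flat n t| <= (n.+2)`!%:R * t ^+ 2.
Proof.
have [t0|t0] := leP t 0.
  by rewrite flat_le0// normr0 mulr_ge0// sqr_ge0.
rewrite ger0_norm ?flat_ge0// /flat t0.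
set u := t^-1; have u0 : 0 < u by rewrite invr_gt0.
have h : u ^+ n.+2 / n.+2`!%:R <= expR u.
  by apply: le_trans (expR_ge1Dxn n.+1 (ltW u0)); rewrite lerDr.
rewrite expRN ler_pdivrMr ?expR_gt0//.
have -> : t ^+ 2 = (u ^+ 2)^-1 by rewrite /u exprVn invrK.
rewrite mulrAC ler_pdivlMr ?exprn_gt0// -exprD addn2.
by rewrite mulrC -ler_pdivrMr// ltr0n fact_gt0.
Qed.

Lemma is_derive_sq_bound f x (C : R) :
  (\forall t \near x, `|f t - f x| <= C * (t - x) ^+ 2) -> is_derive x 1 f 0.
Proof.
move=> fC.
have lim0 : h^-1 *: (f (h *: 1 + x) - f x) @[h --> 0^'] --> (0 : R).
  apply: norm_cvg0.
  apply: (@squeeze_cvgr _ _ _ _ (cst 0) (fun h : R => C * `|h|)).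
  - near=> h; rewrite normr_ge0/= normrZ normfV.
    rewrite ler_pdivrMl ?normr_gt0; last by near: h; exact: nbhs_dnbhs_neq.
    rewrite mulrCA -expr2 real_normK ?num_real//.
    have -> : C * h ^+ 2 = C * (h *: 1 + x - x) ^+ 2.
      by rewrite addrK /GRing.scale/= mulr1.
    near: h; apply: cvg_within; have : h *: 1 + x @[h --> (0 : R)] --> x.
      rewrite -[X in _ --> X](add0r x); apply: cvgD; last exact: cvg_cst.
      rewrite -[X in _ --> X](scale0r (1 : R)).
      by apply: cvgZ; [exact: cvg_id|exact: cvg_cst].
    by move=> /(_ _ fC).
  - exact: cvg_cst.
  - rewrite -[X in _ --> X](mulr0 C); apply: cvgM; first exact: cvg_cst.
    have c0 : `|h| @[h --> (0 : R)] --> `|0 : R| by exact: norm_continuous.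
    rewrite normr0 in c0; apply: cvg_trans c0; apply: cvg_app; exact: cvg_within.
by split; [apply/cvg_ex; exists 0|apply/cvg_lim].
Unshelve. all: by end_near.
Qed.

Lemma is_derive_flat n t :
  is_derive t 1 (flat n) (- n%:R * flat n.+1 t + flat n.+2 t).
Proof.
have [t0|t0|->] := ltgtP t 0.
- rewrite !flat_le0 ?ltW// mulr0 addr0.
  have h : is_derive t 1 (cst 0 : R -> R) 0 by exact: is_derive_cst.
  apply: (near_eq_is_derive _ h); near=> s; rewrite /= flat_le0// ltW//; near: s.
  by apply: open_nbhs_nbhs; split; [exact: open_lt|].
- have tn0 : t != 0 by rewrite gt_eqF.
  have h1 : is_derive t 1 (fun s : R => s^-1) (- t^-1 ^+ 2).
    split; first by apply: derivableV.
    by rewrite deriveV// derive_id /GRing.scale/= mulr1 exprVn.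
  have h2 : is_derive t 1 (fun s : R => s^-1 ^+ n)
      (n%:R * t^-1 ^+ n.-1 * (- t^-1 ^+ 2)).
    have -> : (fun s : R => s^-1 ^+ n) = (fun s : R => s^-1) ^+ n.
      by apply/funext => s; rewrite exprfctE.
    exact: is_deriveX.
  have h3 := @is_derive1_comp _ expR (fun s : R => - s^-1) t _ _
    (is_derive_expR (- t^-1)) (is_deriveN h1).
  have h4 := is_derive_mul h2 h3.
  have h5 : is_derive t 1 (fun s => s^-1 ^+ n * expR (- s^-1))
     (- n%:R * flat n.+1 t + flat n.+2 t).
    apply: (is_derive_eq h4); rewrite /flat t0 /GRing.scale/=.
    case: n {h2 h4} => [|n]; first by rewrite /=; ring.
    by rewrite /= !exprS; ring.
  apply: (near_eq_is_derive _ h5); near=> s; rewrite /flat ifT//; near: s.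
  by apply: open_nbhs_nbhs; split; [exact: open_gt|].
- rewrite !flat_le0// mulr0 addr0.
  apply: (@is_derive_sq_bound _ _ (n.+2)`!%:R); near=> s.
  by rewrite (flat_le0 n (lexx 0)) !subr0 flat_le_sq.
Unshelve. all: by end_near.
Qed.

Lemma Ck1_flat k n : Ck1 k (flat n).
Proof.
elim: k n => [|k IH] n.
  by split => // x; exact: is_derive_continuous (is_derive_flat n x).
apply: (Ck1S_is_derive (is_derive_flat n)); apply: Ck1_add => //.
by apply: Ck1_mul => //; exact: Ck1_cst.
Qed.

Definition smooth_step (t : R) : R := flat 0 t / (flat 0 t + flat 0 (1 - t)).

Lemma smooth_step_den t : 0 < flat 0 t + flat 0 (1 - t).
Proof.
have [t0|t0] := ltP 0 t; first by rewrite ltr_pwDl ?flat_gt0 ?flat_ge0.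
by rewrite ltr_wpDl ?flat_ge0// flat_gt0// subr_gt0 (le_lt_trans t0).
Qed.

Lemma Ck1_smooth_step k : Ck1 k smooth_step.
Proof.
apply: Ck1_mul; first exact: Ck1_flat.
apply: Ck1_inv; first by move=> x; rewrite gt_eqF ?smooth_step_den.
apply: Ck1_add; first exact: Ck1_flat.
have := Ck1_affine (-1) 1 (Ck1_flat k 0).
by under eq_fun do rewrite mulN1r addrC.
Qed.

Lemma smooth_step_le0 t : t <= 0 -> smooth_step t = 0.
Proof. by move=> t0; rewrite /smooth_step flat_le0// mul0r. Qed.

Lemma smooth_step_ge1 t : 1 <= t -> smooth_step t = 1.
Proof.
move=> t1; have := smooth_step_den t; rewrite /smooth_step.
rewrite [flat 0 (1 - t)]flat_le0 ?subr_le0// addr0 => h.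
by rewrite divff// gt_eqF.
Qed.

Lemma smooth_step_ge0 t : 0 <= smooth_step t.
Proof. by rewrite divr_ge0 ?flat_ge0// ltW// smooth_step_den. Qed.

Lemma smooth_step_le1 t : smooth_step t <= 1.
Proof.
by rewrite ler_pdivrMr ?smooth_step_den// mul1r lerDl flat_ge0.
Qed.

End smooth_line.

Section smooth_plane.
Context {R : realType}.
Implicit Types (u v w phi : R * R -> R) (z p : R * R).

Lemma is_derive_pdx v z : derivable (fun t => v (t, z.2)) z.1 1 ->
  is_derive z.1 1 (fun t => v (t, z.2)) (pdx v z).
Proof. exact: is_derive_derive1. Qed.

Lemma is_derive_pdy v z : derivable (fun t => v (z.1, t)) z.2 1 ->
  is_derive z.2 1 (fun t => v (z.1, t)) (pdy v z).
Proof. exact: is_derive_derive1. Qed.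

Lemma pdx_is v z (a : R) : is_derive z.1 1 (fun t => v (t, z.2)) a -> pdx v z = a.
Proof. exact: derive1_is. Qed.

Lemma pdy_is v z (a : R) : is_derive z.2 1 (fun t => v (z.1, t)) a -> pdy v z = a.
Proof. exact: derive1_is. Qed.

Lemma Ck_continuous k v : Ck k v -> continuous v.
Proof. by case: k => [|k] []. Qed.

Lemma CkS_is_derive k v vx vy : continuous v ->
  (forall z, is_derive z.1 1 (fun t => v (t, z.2)) (vx z)) ->
  (forall z, is_derive z.2 1 (fun t => v (z.1, t)) (vy z)) ->
  Ck k vx -> Ck k vy -> Ck k.+1 v.
Proof.
move=> cv hx hy kx ky; split => //; split.
- by move=> z; case: (hx z).
- by move=> z; case: (hy z).
- by have -> : pdx v = vx by apply/funext => z; exact: pdx_is.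
- by have -> : pdy v = vy by apply/funext => z; exact: pdy_is.
Qed.

Lemma CkSE k v : Ck k.+1 v = (continuous v /\
  [/\ forall z, derivable (fun t => v (t, z.2)) z.1 1,
      forall z, derivable (fun t => v (z.1, t)) z.2 1,
      Ck k (pdx v) & Ck k (pdy v)]).
Proof. by []. Qed.

Lemma CkW k v : Ck k.+1 v -> Ck k v.
Proof.
elim: k v => [|k IH] v; first by case.
rewrite CkSE => -[cv [dx dy kx ky]]; rewrite CkSE; split; first exact: cv.
split; [exact: dx|exact: dy|move: kx; exact: IH|move: ky; exact: IH].
Qed.

Lemma Ck_cst k (c : R) : Ck k (cst c : R * R -> R).
Proof.
have cc (a : R) : continuous (cst a : R * R -> R) by move=> z; exact: cvg_cst.
elim: k c => [|k IH] c; first by split.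
by apply: (@CkS_is_derive _ _ (cst 0) (cst 0)) => // z; exact: is_derive_cst.
Qed.

Lemma Ck_add k u v : Ck k u -> Ck k v -> Ck k (fun z => u z + v z).
Proof.
elim: k u v => [|k IH] u v.
  by move=> [cu _] [cv _]; split => // z; apply: cvgD; [exact: cu|exact: cv].
move=> [cu [ux uy kux kuy]] [cv [vx vy kvx kvy]].
apply: (@CkS_is_derive _ _ (fun z => pdx u z + pdx v z)
  (fun z => pdy u z + pdy v z)).
- by move=> z; apply: cvgD; [exact: cu|exact: cv].
- by move=> z; apply: is_derive_add; exact: is_derive_pdx.
- by move=> z; apply: is_derive_add; exact: is_derive_pdy.
- exact: IH.
- exact: IH.
Qed.

Lemma Ck_mul k u v : Ck k u -> Ck k v -> Ck k (fun z => u z * v z).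
Proof.
elim: k u v => [|k IH] u v.
  by move=> [cu _] [cv _]; split => // z; apply: cvgM; [exact: cu|exact: cv].
move=> ku kv; have := ku; have := kv.
move=> [cv [vx vy kvx kvy]] [cu [ux uy kux kuy]].
apply: (@CkS_is_derive _ _ (fun z => pdx u z * v z + u z * pdx v z)
  (fun z => pdy u z * v z + u z * pdy v z)).
- by move=> z; apply: cvgM; [exact: cu|exact: cv].
- move=> [x y]; apply: is_derive_mul.
    exact: (@is_derive_pdx u (x, y)).
  exact: (@is_derive_pdx v (x, y)).
- move=> [x y]; apply: is_derive_mul.
    exact: (@is_derive_pdy u (x, y)).
  exact: (@is_derive_pdy v (x, y)).
- by apply: Ck_add; apply: IH => //; exact: CkW.
- by apply: Ck_add; apply: IH => //; exact: CkW.
Qed.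

Lemma continuous_fst_comp (f : R -> R) : continuous f ->
  continuous (fun z : R * R => f z.1).
Proof. by move=> cf z; apply: continuous_comp; [exact: cvg_fst|exact: cf]. Qed.

Lemma continuous_snd_comp (f : R -> R) : continuous f ->
  continuous (fun z : R * R => f z.2).
Proof. by move=> cf z; apply: continuous_comp; [exact: cvg_snd|exact: cf]. Qed.

Lemma Ck_fst_comp k (f : R -> R) : Ck1 k f -> Ck k (fun z : R * R => f z.1).
Proof.
elim: k f => [|k IH] f; first by move=> [cf _]; split => //; exact: continuous_fst_comp.
move=> [cf [df kf]].
apply: (@CkS_is_derive _ _ (fun z => derive1 f z.1) (cst 0)).
- exact: continuous_fst_comp.
- by move=> z; exact: is_derive_derive1.
- by move=> z; exact: (is_derive_cst (f z.1) z.2 1).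
- exact: IH.
- exact: Ck_cst.
Qed.

Lemma Ck_snd_comp k (f : R -> R) : Ck1 k f -> Ck k (fun z : R * R => f z.2).
Proof.
elim: k f => [|k IH] f; first by move=> [cf _]; split => //; exact: continuous_snd_comp.
move=> [cf [df kf]].
apply: (@CkS_is_derive _ _ (cst 0) (fun z => derive1 f z.2)).
- exact: continuous_snd_comp.
- by move=> z; exact: (is_derive_cst (f z.2) z.1 1).
- by move=> z; exact: is_derive_derive1.
- exact: Ck_cst.
- exact: IH.
Qed.

Definition smooth v : Prop := forall k, Ck k v.

Lemma smooth_continuous v : smooth v -> continuous v.
Proof. by move=> h; exact: Ck_continuous (h 0%N). Qed.

Lemma smooth_is_derive_x v (x y : R) : smooth v ->
  is_derive x 1 (fun t => v (t, y)) (pdx v (x, y)).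
Proof. by move=> /(_ 1%N)[_ [dx _ _ _]]; exact: (@is_derive_pdx v (x, y)). Qed.

Lemma smooth_is_derive_y v (x y : R) : smooth v ->
  is_derive y 1 (fun t => v (x, t)) (pdy v (x, y)).
Proof. by move=> /(_ 1%N)[_ [_ dy _ _]]; exact: (@is_derive_pdy v (x, y)). Qed.

Lemma smooth_pdx v : smooth v -> smooth (pdx v).
Proof. by move=> h k; have [_ []] := h k.+1. Qed.

Lemma smooth_pdy v : smooth v -> smooth (pdy v).
Proof. by move=> h k; have [_ []] := h k.+1. Qed.

Lemma smooth_cst (c : R) : smooth (cst c).
Proof. by move=> k; exact: Ck_cst. Qed.

Lemma smoothD u v : smooth u -> smooth v -> smooth (fun z => u z + v z).
Proof. by move=> hu hv k; exact: Ck_add. Qed.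

Lemma smoothM u v : smooth u -> smooth v -> smooth (fun z => u z * v z).
Proof. by move=> hu hv k; exact: Ck_mul. Qed.

Lemma smoothZ (a : R) v : smooth v -> smooth (fun z => a * v z).
Proof. by apply: smoothM; exact: smooth_cst. Qed.

Lemma smooth_lincomb (a : R) u v : smooth u -> smooth v -> smooth (lincomb a u v).
Proof. by move=> hu hv; apply: smoothD => //; exact: smoothZ. Qed.

Lemma smooth_sum (I : Type) (s : seq I) (P : pred I) (F : I -> R * R -> R) :
  (forall i, P i -> smooth (F i)) -> smooth (fun z => \sum_(i <- s | P i) F i z).
Proof.
move=> hF; elim: s => [|i s IH].
  by under eq_fun do rewrite big_nil; exact: smooth_cst.
case Pi: (P i); under eq_fun do rewrite big_cons Pi; last exact: IH.
by apply: smoothD => //; exact: hF.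
Qed.

Lemma pdxD u v : smooth u -> smooth v ->
  pdx (fun z => u z + v z) = (fun z => pdx u z + pdx v z).
Proof.
move=> hu hv; apply/funext => -[x y]; apply: pdx_is; apply: is_derive_add;
  exact: smooth_is_derive_x.
Qed.

Lemma pdyD u v : smooth u -> smooth v ->
  pdy (fun z => u z + v z) = (fun z => pdy u z + pdy v z).
Proof.
move=> hu hv; apply/funext => -[x y]; apply: pdy_is; apply: is_derive_add;
  exact: smooth_is_derive_y.
Qed.

Lemma pdxM u v : smooth u -> smooth v ->
  pdx (fun z => u z * v z) = (fun z => pdx u z * v z + u z * pdx v z).
Proof.
move=> hu hv; apply/funext => -[x y]; apply: pdx_is; apply: is_derive_mul;
  exact: smooth_is_derive_x.
Qed.

Lemma pdyM u v : smooth u -> smooth v ->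
  pdy (fun z => u z * v z) = (fun z => pdy u z * v z + u z * pdy v z).
Proof.
move=> hu hv; apply/funext => -[x y]; apply: pdy_is; apply: is_derive_mul;
  exact: smooth_is_derive_y.
Qed.

Lemma pdx_cst (c : R) : pdx (cst c) = cst 0.
Proof. by apply/funext => z; apply: pdx_is; exact: is_derive_cst. Qed.

Lemma pdy_cst (c : R) : pdy (cst c) = cst 0.
Proof. by apply/funext => z; apply: pdy_is; exact: is_derive_cst. Qed.

Lemma pdx_lincomb (a : R) u v : smooth u -> smooth v ->
  pdx (lincomb a u v) = lincomb a (pdx u) (pdx v).
Proof.
move=> hu hv; have ha := smooth_cst a; rewrite /lincomb.
rewrite (pdxD (u := fun z => a * u z)) ?(pdxM (u := cst a)) ?pdx_cst//; last exact: smoothM.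
by apply/funext => z; rewrite mul0r add0r.
Qed.

Lemma pdy_lincomb (a : R) u v : smooth u -> smooth v ->
  pdy (lincomb a u v) = lincomb a (pdy u) (pdy v).
Proof.
move=> hu hv; have ha := smooth_cst a; rewrite /lincomb.
rewrite (pdyD (u := fun z => a * u z)) ?(pdyM (u := cst a)) ?pdy_cst//; last exact: smoothM.
by apply/funext => z; rewrite mul0r add0r.
Qed.

Lemma pdx_sum (I : Type) (s : seq I) (P : pred I) (F : I -> R * R -> R) :
  (forall i, P i -> smooth (F i)) ->
  pdx (fun z => \sum_(i <- s | P i) F i z) =
  (fun z => \sum_(i <- s | P i) pdx (F i) z).
Proof.
move=> hF; elim: s => [|i s IH].
  under eq_fun do rewrite big_nil; under [RHS]eq_fun do rewrite big_nil.
  exact: pdx_cst.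
case Pi: (P i); last first.
  under eq_fun do rewrite big_cons Pi; under [RHS]eq_fun do rewrite big_cons Pi.
  exact: IH.
under eq_fun do rewrite big_cons Pi; under [RHS]eq_fun do rewrite big_cons Pi.
by rewrite pdxD ?IH//; [exact: hF|exact: smooth_sum].
Qed.

Lemma pdy_sum (I : Type) (s : seq I) (P : pred I) (F : I -> R * R -> R) :
  (forall i, P i -> smooth (F i)) ->
  pdy (fun z => \sum_(i <- s | P i) F i z) =
  (fun z => \sum_(i <- s | P i) pdy (F i) z).
Proof.
move=> hF; elim: s => [|i s IH].
  under eq_fun do rewrite big_nil; under [RHS]eq_fun do rewrite big_nil.
  exact: pdy_cst.
case Pi: (P i); last first.
  under eq_fun do rewrite big_cons Pi; under [RHS]eq_fun do rewrite big_cons Pi.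
  exact: IH.
under eq_fun do rewrite big_cons Pi; under [RHS]eq_fun do rewrite big_cons Pi.
by rewrite pdyD ?IH//; [exact: hF|exact: smooth_sum].
Qed.

Lemma continuous_section_x v (y : R) : continuous v ->
  continuous (fun t => v (t, y)).
Proof.
move=> cv t; apply: (@continuous_comp _ _ _ (fun t => (t, y)) v); last exact: cv.
exact: (cvg_pair cvg_id (cvg_cst y)).
Qed.

Lemma continuous_section_y v (x : R) : continuous v ->
  continuous (fun t => v (x, t)).
Proof.
move=> cv t; apply: (@continuous_comp _ _ _ (fun t => (x, t)) v); last exact: cv.
exact: (cvg_pair (cvg_cst x) cvg_id).
Qed.

(** An ultrafilter on the product converges once its two projections, again ultrafilters, do. *)
Lemma compact_setX (A B : set R) : compact A -> compact B -> compact (A `*` B).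
Proof.
rewrite !compact_ultra => cA cB F FF FAB.
have surj1 : fst @` [set: R * R] = setT.
  by rewrite eqEsubset; split => // x _; exists (x, 0).
have surj2 : snd @` [set: R * R] = setT.
  by rewrite eqEsubset; split => // x _; exists (0, x).
have FA : [set fst @` C | C in F] A.
  exists ((fst @^-1` A) : set (R * R)).
    by apply: filterS FAB => z [].
  by rewrite eqEsubset; split => [_ [z ? <-]//|x Ax]; exists (x, 0).
have FB : [set snd @` C | C in F] B.
  exists ((snd @^-1` B) : set (R * R)).
    by apply: filterS FAB => z [].
  by rewrite eqEsubset; split => [_ [z ? <-]//|x Ax]; exists (0, x).
have [a [Aa Fa]] := cA _ (ultra_image FF surj1) FA.
have [b [Bb Fb]] := cB _ (ultra_image FF surj2) FB.
have ca : fst @ F --> a.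
  move=> U /Fa[C FC CU]; suff : F (fst @^-1` U) by [].
  by apply: filterS FC => z Cz; rewrite /= -CU; exists z.
have cb : snd @ F --> b.
  move=> U /Fb[C FC CU]; suff : F (snd @^-1` U) by [].
  by apply: filterS FC => z Cz; rewrite /= -CU; exists z.
exists (a, b); split => //.
have -> : F = (fun z => (z.1, z.2)) @ F.
  by rewrite eqEsubset; split => X /=; apply: filterS => -[].
exact: (cvg_pair ca cb).
Qed.

Lemma compact_cbox (M : R) :
  compact [set z : R * R | `|z.1| <= M /\ `|z.2| <= M].
Proof.
have -> : [set z : R * R | `|z.1| <= M /\ `|z.2| <= M] = `[- M, M] `*` `[- M, M].
  by rewrite eqEsubset; split => z [] /=; rewrite !in_itv/= -!ler_norml.
by apply: compact_setX; exact: segment_compact.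
Qed.

Lemma continuous_bounded_cbox v (M : R) : continuous v ->
  exists2 C : R, 0 <= C & forall z, `|z.1| <= M -> `|z.2| <= M -> `|v z| <= C.
Proof.
move=> cv; have /compact_bounded[C [_ bC]] : compact (v @`
    [set z : R * R | `|z.1| <= M /\ `|z.2| <= M]).
  apply: continuous_compact; last exact: compact_cbox.
  exact: continuous_subspaceT.
exists (`|C| + 1); first by rewrite addr_ge0.
move=> z z1 z2; apply: (bC (`|C| + 1)); last by exists z.
by rewrite ltr_pwDr// ler_norm.
Qed.

End smooth_plane.

(** * Test functions and integration by parts *)

Section test_functions.
Context {R : realType} (Om : set (R * R)).
Local Notation mu := (@lebesgue_measure R).
Local Notation mu2 := (@lebesgue_measure R \x @lebesgue_measure R)%E.
Implicit Types (u v w phi psi : R * R -> R) (z p : R * R).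

Lemma test_smooth phi : test_function Om phi -> smooth phi.
Proof. by case. Qed.

Lemma closed_support (K : set (R * R)) phi : closed K ->
  (forall z, ~ K z -> phi z = 0) -> closure [set z | phi z != 0] `<=` K.
Proof.
move=> cK hK; rewrite [X in _ `<=` X](closure_id K).1//; apply: closureS => z.
by apply: contra_neqP => /hK ->.
Qed.

Lemma test_of_support (K : set (R * R)) phi : smooth phi -> compact K ->
  K `<=` Om -> (forall z, ~ K z -> phi z = 0) -> test_function Om phi.
Proof.
move=> sphi cK KO hK.
have clK : closed K by apply: compact_closed => //; exact: norm_hausdorff.
have sK := closed_support clK hK.
split => //; last exact: subset_trans KO.
by apply: subclosed_compact sK => //; exact: closed_closure.
Qed.

Lemma test_support phi : test_function Om phi -> exists2 K : set (R * R),
  compact K /\ K `<=` Om & forall z, ~ K z -> phi z = 0.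
Proof.
move=> [_ cK KO]; exists (closure [set z | phi z != 0]) => // z.
by move=> nz; apply: contra_notP nz => /eqP nz; exact: subset_closure.
Qed.

Lemma test_out phi z : test_function Om phi -> ~ Om z -> phi z = 0.
Proof. by move=> /test_support[K [_ KO] hK] nz; apply: hK => /KO. Qed.

Lemma near_fst_section (U : set (R * R)) z : open U -> U z ->
  \forall t \near z.1, U (t, z.2).
Proof.
move=> oU Uz; have [e e0 eU] := open_boxP oU Uz.
by exists e => //= t zt; apply: eU => //=; rewrite subrr normr0.
Qed.

Lemma near_snd_section (U : set (R * R)) z : open U -> U z ->
  \forall t \near z.2, U (z.1, t).
Proof.
move=> oU Uz; have [e e0 eU] := open_boxP oU Uz.
by exists e => //= t zt; apply: eU => //=; rewrite subrr normr0.
Qed.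

Lemma pdx_near (U : set (R * R)) u v z : open U -> U z ->
  (forall p, U p -> u p = v p) -> pdx u z = pdx v z.
Proof.
move=> oU Uz uv; rewrite /pdx !derive1E; apply: near_eq_derive.
by apply: filterS (near_fst_section oU Uz) => t; exact: uv.
Qed.

Lemma pdy_near (U : set (R * R)) u v z : open U -> U z ->
  (forall p, U p -> u p = v p) -> pdy u z = pdy v z.
Proof.
move=> oU Uz uv; rewrite /pdy !derive1E; apply: near_eq_derive.
by apply: filterS (near_snd_section oU Uz) => t; exact: uv.
Qed.

Lemma test_pdx phi : test_function Om phi -> test_function Om (pdx phi).
Proof.
move=> tphi; have [K [cK KO] hK] := test_support tphi.
apply: (test_of_support (K := K)) => // [|z nKz].
  exact/smooth_pdx/test_smooth.
have -> : 0 = pdx (cst 0) z :> R by rewrite pdx_cst.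
apply: (@pdx_near (~` K)) => //; rewrite openC.
by apply: compact_closed => //; exact: norm_hausdorff.
Qed.

Lemma test_pdy phi : test_function Om phi -> test_function Om (pdy phi).
Proof.
move=> tphi; have [K [cK KO] hK] := test_support tphi.
apply: (test_of_support (K := K)) => // [|z nKz].
  exact/smooth_pdy/test_smooth.
have -> : 0 = pdy (cst 0) z :> R by rewrite pdy_cst.
apply: (@pdy_near (~` K)) => //; rewrite openC.
by apply: compact_closed => //; exact: norm_hausdorff.
Qed.

Lemma test_mul phi u : test_function Om phi -> smooth u ->
  test_function Om (fun z => phi z * u z).
Proof.
move=> tphi su; have [K [cK KO] hK] := test_support tphi.
apply: (test_of_support (K := K)) => // [|z nKz].
  by apply: smoothM => //; exact: test_smooth.
by rewrite hK// mul0r.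
Qed.

Lemma test_lincomb (a : R) phi psi : test_function Om phi ->
  test_function Om psi -> test_function Om (lincomb a phi psi).
Proof.
move=> tphi tpsi; have [K [cK KO] hK] := test_support tphi.
have [L [cL LO] hL] := test_support tpsi.
apply: (test_of_support (K := K `|` L)) => [||z|z].
- by apply: smooth_lincomb; exact: test_smooth.
- exact: compactU.
- by move=> [/KO|/LO].
- by move=> /not_orP[Kz Lz]; rewrite /lincomb hK// hL// mulr0 addr0.
Qed.

Lemma test_cst0 : test_function Om (cst 0).
Proof.
apply: (test_of_support (K := set0)) => //; first exact: smooth_cst.
exact: compact0.
Qed.

Lemma continuous_on_measurable u : continuous u -> measurable Om ->
  measurable_fun Om u.
Proof.
move=> cu mOm; apply: (@measurable_funS _ _ _ _ setT) => //.
exact: continuous_measurable2.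
Qed.

Hypothesis oOm : open Om.
Hypothesis bOm : bounded_set Om.

Let mOm : measurable (Om : set (measurableTypeR R * measurableTypeR R)).
Proof. exact: open_measurable2. Qed.

Let fOm : (mu2 Om < +oo)%E.
Proof. exact: bounded_measure_lty. Qed.

Lemma L2_continuous_bounded u (C : R) : continuous u ->
  (forall z, Om z -> `|u z| <= C) -> L2 Om u.
Proof.
move=> cu; apply: L2_bounded => //; exact: continuous_on_measurable.
Qed.

Lemma L2_smooth u : smooth u -> L2 Om u.
Proof.
move=> su; have [M M0 OM] := bounded_cbox bOm.
have [C C0 hC] := continuous_bounded_cbox M (smooth_continuous su).
apply: (@L2_continuous_bounded _ C); first exact: smooth_continuous.
by move=> z /OM[/ltW z1 /ltW z2]; exact: hC.
Qed.

Lemma L2_test phi : test_function Om phi -> L2 Om phi.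
Proof. by move=> tphi; apply: L2_smooth; exact: test_smooth. Qed.

(** Passing to the whole plane lets Fubini slice along full lines, where the fundamental theorem of
    calculus leaves no boundary terms. *)
Lemma test_integral_setT phi : test_function Om phi ->
  mu2.-integrable setT (fun z => (phi z)%:E) /\
  \int[mu2]_(z in Om) phi z = fine (\int[mu2]_z (phi z)%:E)%E.
Proof.
move=> tphi.
have E : (fun z => (phi z)%:E) = (fun z => (phi z)%:E) \_ Om.
  apply/funext => z; rewrite patchE; case: ifPn => // /negP nz.
  by rewrite (test_out tphi)// => Oz; apply: nz; rewrite inE.
split; last by rewrite /Rintegral integral_mkcond -E.
rewrite E; apply/(integrable_mkcond _ mOm).
by apply: L2_integrable => //; exact: L2_test.
Qed.

Lemma section_integral0 (f : R -> R) (M : R) : 0 < M -> (forall x, derivable f x 1) ->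
  continuous (derive1 f) -> (forall x, M <= `|x| -> f x = 0) ->
  (forall x, M <= `|x| -> derive1 f x = 0) ->
  (\int[mu]_x (derive1 f x)%:E = 0)%E.
Proof.
move=> M0 df cf hf hdf.
have -> : (\int[mu]_x (derive1 f x)%:E =
    \int[mu]_(x in `[(- M)%R, M]) (derive1 f x)%:E)%E.
  rewrite [RHS]integral_mkcond; apply: eq_integral => x _; rewrite patchE.
  case: ifPn => //; rewrite mem_setE in_itv/= -ler_norml -ltNge => /ltW h.
  by rewrite hdf.
rewrite (@continuous_FTC2 _ _ f).
- by rewrite !hf ?normrN ?ger0_norm ?subee// ltW.
- by rewrite gtrN.
- exact: continuous_subspaceT.
- split; first by move=> x _; exact: df.
    by apply: cvg_at_right_filter; exact: is_derive_continuous (is_derive_derive1 (df _)).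
  by apply: cvg_at_left_filter; exact: is_derive_continuous (is_derive_derive1 (df _)).
- by [].
Qed.

Lemma test_out_box phi (M : R) : test_function Om phi ->
  (forall z, Om z -> `|z.1| < M /\ `|z.2| < M) ->
  forall z, M <= `|z.1| \/ M <= `|z.2| -> phi z = 0.
Proof.
move=> tphi OM z Mz; apply: (test_out tphi) => /OM[z1 z2].
by case: Mz => h; [move: z1|move: z2]; rewrite ltNge h.
Qed.

Lemma test_integral_pdx phi : test_function Om phi ->
  \int[mu2]_(z in Om) pdx phi z = 0.
Proof.
move=> tphi; have [i E] := test_integral_setT (test_pdx tphi).
have [M M0 OM] := bounded_cbox bOm.
rewrite E -integral21_prod_meas1// integral0_eq// => y _.
rewrite /fubini_G /=.
apply: (@section_integral0 (fun t => phi (t, y)) M) => //.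
- by move=> x; case: (smooth_is_derive_x x y (test_smooth tphi)).
- apply: (@continuous_section_x _ (pdx phi) y).
  exact/smooth_continuous/smooth_pdx/test_smooth.
- by move=> x Mx; apply: (test_out_box tphi OM); left.
- by move=> x Mx; apply: (test_out_box (test_pdx tphi) OM (z := (x, y))); left.
Qed.

Lemma test_integral_pdy phi : test_function Om phi ->
  \int[mu2]_(z in Om) pdy phi z = 0.
Proof.
move=> tphi; have [i E] := test_integral_setT (test_pdy tphi).
have [M M0 OM] := bounded_cbox bOm.
rewrite E -integral12_prod_meas1// integral0_eq// => x _.
rewrite /fubini_F /=.
apply: (@section_integral0 (fun t => phi (x, t)) M) => //.
- by move=> y; case: (smooth_is_derive_y x y (test_smooth tphi)).
- apply: (@continuous_section_y _ (pdy phi) x).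
  exact/smooth_continuous/smooth_pdy/test_smooth.
- by move=> y My; apply: (test_out_box tphi OM); right.
- by move=> y My; apply: (test_out_box (test_pdy tphi) OM (z := (x, y))); right.
Qed.

(** The x-derivative of the compactly supported product [phi * u] integrates to 0. *)
Lemma ibp_x phi u : test_function Om phi -> smooth u ->
  sip Om u (pdx phi) = - sip Om (pdx u) phi.
Proof.
move=> tphi su; have sphi := test_smooth tphi.
have := test_integral_pdx (test_mul tphi su); rewrite pdxM// => h.
have i1 : mu2.-integrable Om (EFin \o (fun z => pdx phi z * u z)).
  by apply: L2M_integrable => //; apply: L2_smooth => //; exact: smooth_pdx.
have i2 : mu2.-integrable Om (EFin \o (fun z => phi z * pdx u z)).
  by apply: L2M_integrable => //; apply: L2_smooth => //; exact: smooth_pdx.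
rewrite (RintegralD mOm i1 i2) in h.
by rewrite (ipC _ u) (ipC _ (pdx u)); apply/eqP; rewrite -addr_eq0 sip.unlock; exact/eqP.
Qed.

Lemma ibp_y phi u : test_function Om phi -> smooth u ->
  sip Om u (pdy phi) = - sip Om (pdy u) phi.
Proof.
move=> tphi su; have sphi := test_smooth tphi.
have := test_integral_pdy (test_mul tphi su); rewrite pdyM// => h.
have i1 : mu2.-integrable Om (EFin \o (fun z => pdy phi z * u z)).
  by apply: L2M_integrable => //; apply: L2_smooth => //; exact: smooth_pdy.
have i2 : mu2.-integrable Om (EFin \o (fun z => phi z * pdy u z)).
  by apply: L2M_integrable => //; apply: L2_smooth => //; exact: smooth_pdy.
rewrite (RintegralD mOm i1 i2) in h.
by rewrite (ipC _ u) (ipC _ (pdy u)); apply/eqP; rewrite -addr_eq0 sip.unlock; exact/eqP.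
Qed.

End test_functions.

(** * The fundamental lemma of the calculus of variations *)

Section fundamental_lemma.
Context {R : realType} (Om : set (R * R)).
Local Notation mu := (@lebesgue_measure R).
Local Notation mu2 := (@lebesgue_measure R \x @lebesgue_measure R)%E.
Implicit Types (u v w phi psi : R * R -> R) (z p : R * R).

(** Approximates the indicator of []a, b[] from inside: it vanishes off the interval, and at each
    point of the interval it equals 1 from some n on. *)
Definition plateau (a b : R) (n : nat) (t : R) : R :=
  smooth_step (n%:R * t + - (n%:R * a)) * smooth_step (- n%:R * t + n%:R * b).

Lemma Ck1_plateau a b n k : Ck1 k (plateau a b n).
Proof. by apply: Ck1_mul; apply: Ck1_affine; exact: Ck1_smooth_step. Qed.

Lemma plateau_out a b n t : ~~ (a < t < b) -> plateau a b n t = 0.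
Proof.
rewrite negb_and -!leNgt /plateau => /orP[ta|bt].
  rewrite smooth_step_le0 ?mul0r// -mulrN -mulrDr mulr_ge0_le0//.
  by rewrite subr_le0.
rewrite [X in _ * X]smooth_step_le0 ?mulr0// mulNr addrC -mulrBr mulr_ge0_le0//.
by rewrite subr_le0.
Qed.

Lemma plateau_ge0_le1 a b n t : 0 <= plateau a b n t <= 1.
Proof.
rewrite mulr_ge0 ?smooth_step_ge0//=.
by rewrite mulr_ile1 ?smooth_step_ge0 ?smooth_step_le1.
Qed.

Lemma plateau_in a b t : a < t < b -> \forall n \near \oo, plateau a b n t = 1.
Proof.
move=> /andP[at_ tb].
have h (c : R) : 0 < c -> \forall n \near \oo, smooth_step (n%:R * c) = 1.
  move=> c0; near=> n; apply: smooth_step_ge1.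
  rewrite -ler_pdivrMr// div1r; apply: ltW.
  by near: n; exact: nbhs_infty_gtr.
have ha := h (t - a) (etrans (subr_gt0 _ _) at_).
have hb := h (b - t) (etrans (subr_gt0 _ _) tb).
near=> n; rewrite /plateau -mulrN -mulrDr mulNr [X in _ * smooth_step X]addrC -mulrBr.
by rewrite (near ha n)// (near hb n)// mulr1.
Unshelve. all: by end_near.
Qed.

Definition obox (a b c d : R) : set (R * R) :=
  `]a, b[%classic `*` `]c, d[%classic.
Definition cbox (a b c d : R) : set (R * R) :=
  `[a, b]%classic `*` `[c, d]%classic.

Lemma oboxP a b c d z : obox a b c d z <-> a < z.1 < b /\ c < z.2 < d.
Proof. by rewrite /obox; split => -[] /=; rewrite !in_itv. Qed.

Lemma obox_sub_cbox a b c d : obox a b c d `<=` cbox a b c d.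
Proof. by move=> z [z1 z2]; split; apply: subset_itv_oo_cc. Qed.

Lemma measurable_obox a b c d :
  measurable (obox a b c d : set (measurableTypeR R * measurableTypeR R)).
Proof. by apply: measurableX; exact: measurable_itv. Qed.

Lemma plateau_test a b c d n : cbox a b c d `<=` Om ->
  test_function Om (fun z => plateau a b n z.1 * plateau c d n z.2).
Proof.
move=> bO; apply: (@test_of_support _ Om (cbox a b c d)) => //.
- apply: smoothM => k; first by apply: Ck_fst_comp; exact: Ck1_plateau.
  by apply: Ck_snd_comp; exact: Ck1_plateau.
- by apply: compact_setX; exact: segment_compact.
- move=> z nz; have : ~ obox a b c d z by move=> /obox_sub_cbox.
  move=> /oboxP/not_andP[/negP h|/negP h].
    by rewrite plateau_out ?mul0r.
  by rewrite [X in _ * X]plateau_out ?mulr0.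
Qed.

Hypothesis oOm : open Om.
Hypothesis bOm : bounded_set Om.

Let mOm : measurable (Om : set (measurableTypeR R * measurableTypeR R)).
Proof. exact: open_measurable2. Qed.

Let fOm : (mu2 Om < +oo)%E.
Proof. exact: bounded_measure_lty. Qed.

Variable g : R * R -> R.
Hypothesis hg : L2 Om g.
Hypothesis g_orth : forall phi, test_function Om phi -> sip Om g phi = 0.

Let ig : mu2.-integrable Om (EFin \o g).
Proof. exact: L2_integrable. Qed.

(** Products of plateaus are test functions that converge pointwise to the indicator of the open
    box, and [|g|] dominates. *)
Lemma orth_obox_integral a b c d : cbox a b c d `<=` Om ->
  (\int[mu2]_(z in obox a b c d) (g z)%:E = 0)%E.
Proof.
move=> bO; set B := obox a b c d.
have BO : B `<=` Om by exact: subset_trans (@obox_sub_cbox _ _ _ _) bO.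
pose chi n z := plateau a b n z.1 * plateau c d n z.2.
have chi01 n z : 0 <= chi n z <= 1.
  have /andP[p0 p1] := plateau_ge0_le1 a b n z.1.
  have /andP[q0 q1] := plateau_ge0_le1 c d n z.2.
  by rewrite mulr_ge0//= mulr_ile1.
have I0 n : (\int[mu2]_(z in Om) (g z * chi n z)%:E = 0)%E.
  have := g_orth (plateau_test n bO); rewrite sip.unlock /ip /Rintegral => h.
  rewrite -[LHS]fineK ?h//; apply: integrable_fin_num => //.
  apply: L2M_integrable => //; apply: L2_test => //.
  exact: (plateau_test n bO).
have [_ _] : [/\ mu2.-integrable Om ((EFin \o g) \_ B),
   [sequence (\int[mu2]_(x in Om) (`|(g x * chi n x)%:E - ((EFin \o g) \_ B) x|)%E)%E]_n
       @ \oo --> 0%E &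
   [sequence (\int[mu2]_(x in Om) (g x * chi n x)%:E)%E]_n @ \oo -->
      (\int[mu2]_(x in Om) ((EFin \o g) \_ B) x)%E].
  apply: (dominated_convergence mOm (g := fun z => `|(g z)%:E|%E)) => //.
  - move=> n; apply/measurable_EFinP; apply: measurable_funM.
      exact: L2_measurable.
    apply: (@L2_measurable _ Om); apply: L2_test => //; exact: (plateau_test n bO).
  - apply: (@measurable_funS _ _ _ _ setT) => //.
    apply/(measurable_restrictT _ (measurable_obox _ _ _ _)).
    apply: (@measurable_funS _ _ _ _ Om) => //.
    by case/integrableP : ig.
  - apply: aeW => z Oz; rewrite patchE; case: ifPn => [|/negP nB].
      rewrite inE => /oboxP[z1 z2].
      apply: cvg_near_cst; near=> n; rewrite /= /chi.
      rewrite (near (plateau_in z1) n)// (near (plateau_in z2) n)//.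
      by rewrite !mulr1.
    rewrite (_ : (fun n => _) = cst 0%E); first exact: cvg_cst.
    apply/funext => n /=; rewrite /chi.
    have : ~ B z by move=> Bz; apply: nB; rewrite inE.
    move=> /oboxP/not_andP[/negP h|/negP h].
      by rewrite plateau_out ?mul0r ?mulr0.
    by rewrite [plateau c d n z.2]plateau_out ?mulr0.
  - exact: integrable_abse.
  - apply: aeW => z n Oz; rewrite lee_fin normrM.
    have /andP[c0 c1] := chi01 n z.
    by rewrite [X in _ * X]ger0_norm// ler_piMr.
rewrite -integral_mkcondr setIidr// => h.
move: h; rewrite (_ : [sequence _]_n = cst 0%E); last first.
  by apply/funext => n; exact: I0.
by move=> /(cvg_lim (@ereal_hausdorff R)) <-; rewrite lim_cst.
Unshelve. all: by end_near.
Qed.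

(** A quadrant cuts the box in a box, over which g integrates to 0. Dynkin induction carries this to
    every measurable subset of the box, and then g vanishes almost everywhere on it. *)
Lemma orth_obox_ae a b c d : cbox a b c d `<=` Om ->
  {ae mu2, forall z, obox a b c d z -> g z = 0}.
Proof.
move=> bO; set B := obox a b c d.
have BO : B `<=` Om by exact: subset_trans (@obox_sub_cbox _ _ _ _) bO.
have mB : measurable (B : set (measurableTypeR R * measurableTypeR R)).
  exact: measurable_obox.
have iB : mu2.-integrable B (EFin \o g) by exact: integrableS ig.
have key (A : set (R * R)) : measurable A ->
    (\int[mu2]_(z in A `&` B) (g z)%:E = 0)%E.
  move=> mA; have := mA; rewrite {1}plane_measurable_rays.
  move: A {mA}; apply: dynkin_induction.
  - exact: plane_measurable_rays.
  - move=> _ _ [x [y ->]] [x' [y' ->]]; exists (Num.max x x'), (Num.max y y').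
    rewrite eqEsubset; split => z; rewrite /= !in_itv/= !andbT !gt_max.
      by move=> [[-> ->] [-> ->]].
    by move=> [/andP[-> ->] /andP[-> ->]].
  - by rewrite setTI; exact: orth_obox_integral.
  - move=> _ [x [y ->]].
    have -> : `]x, +oo[%classic `*` `]y, +oo[%classic `&` B =
        obox (Num.max x a) b (Num.max y c) d.
      rewrite /B /obox eqEsubset; split => z; rewrite /= !in_itv/= !andbT !gt_max.
        by move=> [[-> ->] [/andP[-> ->] /andP[-> ->]]].
      by move=> [/andP[/andP[-> ->] ->] /andP[/andP[-> ->] ->]].
    apply: orth_obox_integral; apply: subset_trans bO => z.
    rewrite /cbox /= !in_itv/= !ge_max.
    by move=> [/andP[/andP[_ ->] ->] /andP[/andP[_ ->] ->]].
  - move=> S mS IS.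
    have h : (\int[mu2]_(z in (S `&` B) `|` (~` S `&` B)) (g z)%:E = 0)%E.
      by rewrite -setIUl setUv setTI; exact: orth_obox_integral.
    rewrite integral_setU in h; last 4 first.
    + exact: measurableI.
    + by apply: measurableI => //; exact: measurableC.
    + by rewrite -setIUl setUv setTI; case/integrableP : iB.
    + by apply/disj_setPS => z [[Sz _] [nSz _]].
    by rewrite IS add0e in h.
  - move=> F mF tF IF.
    have mFB k : measurable (F k `&` B : set (measurableTypeR R * measurableTypeR R)).
      by apply: measurableI => //; exact: mF.
    rewrite setI_bigcupl integral_bigcup.
    + by rewrite eseries0.
    + by apply: trivIset_setIr.
    + exact: mFB.
    + apply: integrableS iB => //.
        by apply: bigcup_measurable => k _; exact: mFB.
      by move=> z [k _ []].
have := @integral_ae_eq _ _ R mu2 B mB (cst 0%E) (EFin \o g) iB.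
move=> /(_ (measurable_cst _))[].
  move=> E EB mE; rewrite integral0 -[RHS](key E)//; congr (integral _ _ _).
  by rewrite setIidl.
move=> N [mN N0 sN]; exists N; split => // z nz; apply: sN => /= h.
by apply: nz => Bz; have [] := h Bz.
Qed.

Lemma orth_test_ae0 : ae_eq_on Om g (cst 0).
Proof.
(* Boxes are numbered through [pickle], so that a countable intersection over [nat] handles all of
   them at once. *)
pose P n z := forall q : rat * rat * rat * rat, unpickle n = Some q ->
  rat_cbox q `<=` Om -> rat_box q z -> g z = 0.
have aeP : {ae mu2, forall z, forall n, P n z}.
  apply: ae_foralln => n; rewrite /P; case: (unpickle n) => [q|]; last exact: aeW.
  have [qO|nqO] := pselect (rat_cbox (R := R) q `<=` Om); last first.
    by apply: aeW => z q' [<-].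
  by apply: (ae_imp (orth_obox_ae qO)) => z hz q' [<-] _; exact: hz.
apply: (ae_imp aeP) => z Pz; rewrite {1}(open_rat_boxes oOm) => -[q qO qz].
by apply: (Pz (pickle q) q) => //; rewrite pickleK.
Qed.

End fundamental_lemma.

(* Sealed for the same reason as sip. *)
HB.lock Definition sdx (R : realType) (Om : set (R * R)) (u : R * R -> R) :=
  dx Om u.
HB.lock Definition sdy (R : realType) (Om : set (R * R)) (u : R * R -> R) :=
  dy Om u.

HB.lock Definition h1n (R : realType) (Om : set (R * R)) (u : R * R -> R) : R :=
  H1norm Om u.

(** * Weak derivatives *)

Section weak_derivative.
Context {R : realType} (Om : set (R * R)).
Local Notation mu2 := (@lebesgue_measure R \x @lebesgue_measure R)%E.
Implicit Types (u v w g phi psi : R * R -> R) (z p : R * R).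

Definition weak_pd (pd : (R * R -> R) -> (R * R -> R)) u : set (R * R -> R) :=
  [set g | L2 Om g /\
    forall phi, test_function Om phi -> sip Om u (pd phi) = - sip Om g phi].

(* The properties of pdx and pdy on which the theory of weak derivatives rests. *)
Definition partial_op (pd : (R * R -> R) -> (R * R -> R)) : Prop :=
  [/\ forall phi, test_function Om phi -> test_function Om (pd phi),
      forall u, smooth u -> smooth (pd u) &
      forall phi u, test_function Om phi -> smooth u ->
        sip Om u (pd phi) = - sip Om (pd u) phi].

Hypothesis oOm : open Om.
Hypothesis bOm : bounded_set Om.

Let mOm : measurable (Om : set (measurableTypeR R * measurableTypeR R)).
Proof. exact: open_measurable2. Qed.

Lemma partial_op_x : partial_op pdx.
Proof.
split; [exact: test_pdx|exact: smooth_pdx|].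
by move=> phi u; exact: ibp_x.
Qed.

Lemma partial_op_y : partial_op pdy.
Proof.
split; [exact: test_pdy|exact: smooth_pdy|].
by move=> phi u; exact: ibp_y.
Qed.

Section one_direction.
Variable pd : (R * R -> R) -> (R * R -> R).
Hypothesis hpd : partial_op pd.

Let test_pd phi : test_function Om phi -> test_function Om (pd phi).
Proof. by case: hpd => h _ _; exact: h. Qed.
Let smooth_pd u : smooth u -> smooth (pd u).
Proof. by case: hpd => _ h _; exact: h. Qed.
Let ibp phi u : test_function Om phi -> smooth u ->
  sip Om u (pd phi) = - sip Om (pd u) phi.
Proof. by case: hpd => _ _ h; exact: h. Qed.

Lemma weak_pd_uniq u g g' : weak_pd pd u g -> weak_pd pd u g' ->
  ae_eq_on Om g g'.
Proof.
move=> [hg ug] [hg' ug'].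
have h : ae_eq_on Om (fun z => g z - g' z) (cst 0).
  apply: orth_test_ae0 => //; first exact: L2B.
  move=> phi tphi; rewrite ipBl//; last exact: L2_test.
  by rewrite -[sip Om g phi]opprK -ug// ug'// opprK subrr.
by apply: (ae_imp h) => z hz Oz; apply/eqP; rewrite -subr_eq0 hz.
Qed.

Lemma weak_pd_congr u u' : L2 Om u -> L2 Om u' -> ae_eq_on Om u u' ->
  weak_pd pd u = weak_pd pd u'.
Proof.
move=> hu hu' e; rewrite eqEsubset; split=> g [hg h]; split=> // phi tphi.
  rewrite -h//; apply: ip_ae => //; do ?exact: L2_test (test_pd tphi).
    exact: ae_eq_on_sym.
  exact: ae_eq_on_refl.
rewrite -h//; apply: ip_ae => //; do ?exact: L2_test (test_pd tphi).
exact: ae_eq_on_refl.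
Qed.

Lemma weak_pd_smooth u : smooth u -> weak_pd pd u (pd u).
Proof.
move=> su; split; first by apply: L2_smooth => //; exact: smooth_pd.
by move=> phi tphi; exact: ibp.
Qed.

Lemma weak_pd_lincomb (a : R) u v g g' : L2 Om u -> L2 Om v ->
  weak_pd pd u g -> weak_pd pd v g' ->
  weak_pd pd (lincomb a u v) (lincomb a g g').
Proof.
move=> hu hv [hg ug] [hg' vg']; split; first exact: L2_lincomb.
move=> phi tphi; have tp := test_pd tphi.
rewrite !ip_lincombl//; do ?exact: L2_test.
by rewrite ug// vg'//; ring.
Qed.

Lemma weak_pdB u v g g' : L2 Om u -> L2 Om v ->
  weak_pd pd u g -> weak_pd pd v g' ->
  weak_pd pd (fun z => u z - v z) (fun z => g z - g' z).
Proof.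
move=> hu hv ug vg'; have := weak_pd_lincomb (-1) hv hu vg' ug.
have E (f1 f2 : R * R -> R) : lincomb (-1) f1 f2 = (fun z => f2 z - f1 z).
  by apply/funext => z; rewrite /lincomb mulN1r addrC.
by rewrite !E.
Qed.

(** Both sides of the integration by parts formula are L^2-continuous, and each smooth [phi]
    satisfies it. *)
Lemma weak_pd_limit u g : L2 Om u -> L2 Om g ->
  (forall e : R, 0 < e -> exists phi, [/\ smooth phi,
     nrm Om (fun z => u z - phi z) < e &
     nrm Om (fun z => g z - pd phi z) < e]) ->
  weak_pd pd u g.
Proof.
move=> hu hg h; split => // psi tpsi; have tp := test_pd tpsi.
apply/eqP; rewrite -addr_eq0 -normr_le0; apply/ler_addgt0Pr => e e0.
rewrite add0r; set C := nrm Om (pd psi) + nrm Om psi + 1.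
have C0 : 0 < C by rewrite ltr_wpDl// addr_ge0// nrm_ge0.
have [phi [sphi h1 h2]] := h (e / C) (divr_gt0 e0 C0).
have L1 := L2_smooth oOm bOm sphi.
have L2' := L2_smooth oOm bOm (smooth_pd sphi).
have L3 := L2_test oOm bOm tpsi; have L4 := L2_test oOm bOm tp.
have -> : sip Om u (pd psi) + sip Om g psi =
    sip Om (fun z => u z - phi z) (pd psi) + sip Om (fun z => g z - pd phi z) psi.
  by rewrite !ipBl// (ibp tpsi sphi); ring.
apply: le_trans (ler_normD _ _) _.
have := ip_le_nrm mOm (L2B mOm hu L1) L4.
have := ip_le_nrm mOm (L2B mOm hg L2') L3.
move: h1 h2; set n1 := nrm Om _; set n2 := nrm Om (fun z => g z - _).
move=> h1 h2 k1 k2.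
have a1 := ltW h1; have a2 := ltW h2.
have b1 : n1 * nrm Om (pd psi) <= e / C * nrm Om (pd psi).
  by rewrite ler_wpM2r ?nrm_ge0.
have b2 : n2 * nrm Om psi <= e / C * nrm Om psi.
  by rewrite ler_wpM2r ?nrm_ge0.
have -> : e = e / C * C by rewrite divfK ?gt_eqF.
have c0 : 0 < e / C by exact: divr_gt0.
move: b1 b2 c0; move: (e / C) => k b1 b2 c0; rewrite /C; lra.
Qed.

Lemma weak_pd_xget u : weak_pd pd u !=set0 ->
  weak_pd pd u (xget (cst 0) (weak_pd pd u)).
Proof. by move=> [g ug]; apply: xgetPex; exists g. Qed.

End one_direction.

Lemma weak_dxE u : weak_dx Om u = weak_pd pdx u.
Proof. by rewrite /weak_pd sip.unlock. Qed.

Lemma weak_dyE u : weak_dy Om u = weak_pd pdy u.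
Proof. by rewrite /weak_pd sip.unlock. Qed.

Lemma dx_spec u : weak_dx Om u !=set0 -> weak_dx Om u (sdx Om u).
Proof. by rewrite sdx.unlock /dx weak_dxE; exact: weak_pd_xget. Qed.

Lemma dy_spec u : weak_dy Om u !=set0 -> weak_dy Om u (sdy Om u).
Proof. by rewrite sdy.unlock /dy weak_dyE; exact: weak_pd_xget. Qed.

Lemma dx_ae u g : weak_dx Om u g -> ae_eq_on Om (sdx Om u) g.
Proof.
move=> ug; have := dx_spec (ex_intro _ g ug); move: ug.
by rewrite weak_dxE => ug h; exact: (weak_pd_uniq h ug).
Qed.

Lemma dy_ae u g : weak_dy Om u g -> ae_eq_on Om (sdy Om u) g.
Proof.
move=> ug; have := dy_spec (ex_intro _ g ug); move: ug.
by rewrite weak_dyE => ug h; exact: (weak_pd_uniq h ug).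
Qed.

Lemma L2_dx u : weak_dx Om u !=set0 -> L2 Om (sdx Om u).
Proof. by move=> /dx_spec[]. Qed.

Lemma L2_dy u : weak_dy Om u !=set0 -> L2 Om (sdy Om u).
Proof. by move=> /dy_spec[]. Qed.

(** Functions equal almost everywhere have the same set of weak derivatives, hence the same choice
    from it: the conclusion is an equality of functions. *)
Lemma dx_congr u u' : L2 Om u -> L2 Om u' -> ae_eq_on Om u u' ->
  sdx Om u = sdx Om u'.
Proof.
move=> hu hu' e; rewrite sdx.unlock /dx !weak_dxE; congr xget.
exact: (weak_pd_congr partial_op_x hu hu' e).
Qed.

Lemma dy_congr u u' : L2 Om u -> L2 Om u' -> ae_eq_on Om u u' ->
  sdy Om u = sdy Om u'.
Proof.
move=> hu hu' e; rewrite sdy.unlock /dy !weak_dyE; congr xget.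
exact: (weak_pd_congr partial_op_y hu hu' e).
Qed.

Lemma weak_dx_smooth u : smooth u -> weak_dx Om u (pdx u).
Proof. by rewrite weak_dxE; exact: (weak_pd_smooth partial_op_x). Qed.

Lemma weak_dy_smooth u : smooth u -> weak_dy Om u (pdy u).
Proof. by rewrite weak_dyE; exact: (weak_pd_smooth partial_op_y). Qed.

Lemma weak_dx_smoothB u gx phi : L2 Om u -> weak_dx Om u gx -> smooth phi ->
  weak_dx Om (u \- phi) (fun z => gx z - pdx phi z).
Proof.
move=> hu; rewrite !weak_dxE => ux sphi.
apply: (weak_pdB partial_op_x) => //; first exact: L2_smooth.
exact: (weak_pd_smooth partial_op_x).
Qed.

(** The chosen derivative of a difference is determined only up to a null set, which norms do not
    see. *)
Lemma dx_smoothB u gx phi : L2 Om u -> weak_dx Om u gx -> smooth phi ->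
  ae_eq_on Om (sdx Om (u \- phi)) (fun z => gx z - pdx phi z).
Proof.
by move=> hu ux sphi; apply: dx_ae; exact: weak_dx_smoothB.
Qed.

Lemma weak_dy_smoothB u gy phi : L2 Om u -> weak_dy Om u gy -> smooth phi ->
  weak_dy Om (u \- phi) (fun z => gy z - pdy phi z).
Proof.
move=> hu; rewrite !weak_dyE => uy sphi.
apply: (weak_pdB partial_op_y) => //; first exact: L2_smooth.
exact: (weak_pd_smooth partial_op_y).
Qed.

Lemma dy_smoothB u gy phi : L2 Om u -> weak_dy Om u gy -> smooth phi ->
  ae_eq_on Om (sdy Om (u \- phi)) (fun z => gy z - pdy phi z).
Proof.
by move=> hu uy sphi; apply: dy_ae; exact: weak_dy_smoothB.
Qed.

Lemma h1nE u : h1n Om u =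
  Num.sqrt (nrm Om u ^+ 2 + nrm Om (sdx Om u) ^+ 2 + nrm Om (sdy Om u) ^+ 2).
Proof. by rewrite !nrm_sq h1n.unlock sip.unlock sdx.unlock sdy.unlock. Qed.

Lemma h1n_smoothB u gx gy phi : L2 Om u -> weak_dx Om u gx ->
  weak_dy Om u gy -> smooth phi ->
  h1n Om (u \- phi) = Num.sqrt (nrm Om (fun z => u z - phi z) ^+ 2 +
    nrm Om (fun z => gx z - pdx phi z) ^+ 2 +
    nrm Om (fun z => gy z - pdy phi z) ^+ 2).
Proof.
move=> hu ux uy sphi.
have [hgx _] := ux; have [hgy _] := uy.
have L1 := L2_smooth oOm bOm sphi.
have L3 := L2_smooth oOm bOm (smooth_pdx sphi).
have L4 := L2_smooth oOm bOm (smooth_pdy sphi).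
have ex := dx_smoothB hu ux sphi; have ey := dy_smoothB hu uy sphi.
have hx : L2 Om (sdx Om (u \- phi)).
  apply: L2_dx; exists (fun z => gx z - pdx phi z).
  exact: weak_dx_smoothB.
have hy : L2 Om (sdy Om (u \- phi)).
  apply: L2_dy; exists (fun z => gy z - pdy phi z).
  exact: weak_dy_smoothB.
rewrite h1nE; congr (Num.sqrt (_ + _ + _)); congr (_ ^+ 2).
  by apply: nrm_ae => //; exact: L2B.
by apply: nrm_ae => //; exact: L2B.
Qed.

Lemma lt_of_sqr_lt (a e : R) : 0 <= a -> 0 < e -> a ^+ 2 < e ^+ 2 -> a < e.
Proof. by move=> a0 /ltW e0; rewrite ltr_sqr. Qed.

Lemma sqrt_sum3_lt (a b c e : R) : 0 <= a -> 0 <= b -> 0 <= c -> 0 < e ->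
  a < e / 2 -> b < e / 2 -> c < e / 2 ->
  Num.sqrt (a ^+ 2 + b ^+ 2 + c ^+ 2) < e.
Proof.
move=> a0 b0 c0 e0 ha hb hc.
apply: lt_of_sqr_lt => //.
rewrite sqr_sqrtr ?addr_ge0 ?sqr_ge0//.
have sq (x : R) : 0 <= x -> x < e / 2 -> x ^+ 2 <= e ^+ 2 / 4.
  by move=> x0 hx; nra.
have := sq a a0 ha; have := sq b b0 hb; have := sq c c0 hc.
have : 0 < e ^+ 2 by rewrite exprn_gt0.
lra.
Qed.

Lemma sqrt_sum3_lt_inv (a b c e : R) : 0 <= a -> 0 <= b -> 0 <= c -> 0 < e ->
  Num.sqrt (a ^+ 2 + b ^+ 2 + c ^+ 2) < e -> [/\ a < e, b < e & c < e].
Proof.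
move=> a0 b0 c0 e0 h.
have sa := sqr_ge0 a; have sb := sqr_ge0 b; have sc := sqr_ge0 c.
have s0 : 0 <= a ^+ 2 + b ^+ 2 + c ^+ 2 by rewrite !addr_ge0.
have : a ^+ 2 + b ^+ 2 + c ^+ 2 < e ^+ 2.
  by rewrite -[X in X < _](sqr_sqrtr s0) ltr_sqr ?nnegrE ?sqrtr_ge0 ?ltW.
move=> h2; split; apply: lt_of_sqr_lt => //; lra.
Qed.

Lemma H10_of_approx u gx gy : L2 Om u -> L2 Om gx -> L2 Om gy ->
  (forall e : R, 0 < e -> exists phi, [/\ test_function Om phi,
     nrm Om (fun z => u z - phi z) < e,
     nrm Om (fun z => gx z - pdx phi z) < e &
     nrm Om (fun z => gy z - pdy phi z) < e]) ->
  [/\ H10 Om u, weak_dx Om u gx & weak_dy Om u gy].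
Proof.
move=> hu hgx hgy happ.
have wx : weak_dx Om u gx.
  rewrite weak_dxE; apply: (weak_pd_limit partial_op_x) => // e e0.
  by have [phi [tphi h1 h2 h3]] := happ e e0; exists phi; split => //; case: tphi.
have wy : weak_dy Om u gy.
  rewrite weak_dyE; apply: (weak_pd_limit partial_op_y) => // e e0.
  by have [phi [tphi h1 h2 h3]] := happ e e0; exists phi; split => //; case: tphi.
split => //; split; first by split => //; [exists gx|exists gy].
move=> e e0; have [|phi [tphi h1 h2 h3]] := happ (e / 2); first lra.
exists phi => //.
rewrite -(congr1 (fun f => f R Om (u \- phi)) h1n.unlock) (h1n_smoothB hu wx wy);
    last exact: test_smooth tphi.
by apply: sqrt_sum3_lt => //; exact: nrm_ge0.
Qed.

Lemma H10_approx u : H10 Om u ->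
  forall e : R, 0 < e -> exists phi, [/\ test_function Om phi,
     nrm Om (fun z => u z - phi z) < e,
     nrm Om (fun z => sdx Om u z - pdx phi z) < e &
     nrm Om (fun z => sdy Om u z - pdy phi z) < e].
Proof.
move=> [[hu /dx_spec wx /dy_spec wy] happ] e e0.
have [phi tphi he] := happ e e0; exists phi.
move: he; rewrite -(congr1 (fun f => f R Om (u \- phi)) h1n.unlock)
  (h1n_smoothB hu wx wy (test_smooth tphi)).
by case/(sqrt_sum3_lt_inv (nrm_ge0 _ _) (nrm_ge0 _ _) (nrm_ge0 _ _) e0).
Qed.

Lemma L2_sdx u g : weak_dx Om u g -> L2 Om (sdx Om u).
Proof. by move=> ug; apply: L2_dx; exists g. Qed.

Lemma L2_sdy u g : weak_dy Om u g -> L2 Om (sdy Om u).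
Proof. by move=> ug; apply: L2_dy; exists g. Qed.

Lemma h1n_congr u u' : L2 Om u -> L2 Om u' -> ae_eq_on Om u u' ->
  h1n Om u = h1n Om u'.
Proof.
move=> hu hu' e; rewrite (h1nE u) (h1nE u') (dx_congr hu hu' e) (dy_congr hu hu' e).
by rewrite (nrm_ae mOm hu hu' e).
Qed.

Lemma H2normE u : H2norm Om u =
  Num.sqrt (nrm Om u ^+ 2 + h1n Om (sdx Om u) ^+ 2 + h1n Om (sdy Om u) ^+ 2).
Proof. by rewrite nrm_sq h1n.unlock sip.unlock sdx.unlock sdy.unlock. Qed.

Lemma H2norm_smoothB u gx gy gxx gxy gyx gyy phi : L2 Om u ->
  weak_dx Om u gx -> weak_dy Om u gy ->
  weak_dx Om gx gxx -> weak_dy Om gx gxy -> weak_dx Om gy gyx ->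
  weak_dy Om gy gyy -> smooth phi ->
  H2norm Om (u \- phi) = Num.sqrt (nrm Om (fun z => u z - phi z) ^+ 2 +
    Num.sqrt (nrm Om (fun z => gx z - pdx phi z) ^+ 2 +
      nrm Om (fun z => gxx z - pdx (pdx phi) z) ^+ 2 +
      nrm Om (fun z => gxy z - pdy (pdx phi) z) ^+ 2) ^+ 2 +
    Num.sqrt (nrm Om (fun z => gy z - pdy phi z) ^+ 2 +
      nrm Om (fun z => gyx z - pdx (pdy phi) z) ^+ 2 +
      nrm Om (fun z => gyy z - pdy (pdy phi) z) ^+ 2) ^+ 2).
Proof.
move=> hu ux uy uxx uxy uyx uyy sphi.
have [hgx _] := ux; have [hgy _] := uy.
have L1 := L2_smooth oOm bOm sphi.
have sx := smooth_pdx sphi; have sy := smooth_pdy sphi.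
have L3 := L2_smooth oOm bOm sx; have L4 := L2_smooth oOm bOm sy.
have hx := L2_sdx (weak_dx_smoothB hu ux sphi).
have hy := L2_sdy (weak_dy_smoothB hu uy sphi).
rewrite H2normE; congr (Num.sqrt (_ + _ + _)); congr (_ ^+ 2).
  rewrite (h1n_congr hx (L2B mOm hgx L3) (dx_smoothB hu ux sphi)).
  exact: (h1n_smoothB hgx uxx uxy sx).
rewrite (h1n_congr hy (L2B mOm hgy L4) (dy_smoothB hu uy sphi)).
exact: (h1n_smoothB hgy uyx uyy sy).
Qed.

Lemma H1_of_weak u gx gy : L2 Om u -> weak_dx Om u gx -> weak_dy Om u gy -> H1 Om u.
Proof. by move=> hu ux uy; split => //; [exists gx|exists gy]. Qed.

(** One family of test functions does everything: by [weak_pd_limit] it identifies the six fields as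
    weak derivatives, and then it approximates u in the H^2 norm. *)
Lemma H20_of_approx u gx gy gxx gxy gyx gyy : L2 Om u -> L2 Om gx -> L2 Om gy ->
  L2 Om gxx -> L2 Om gxy -> L2 Om gyx -> L2 Om gyy ->
  (forall e : R, 0 < e -> exists phi, [/\ test_function Om phi,
     nrm Om (fun z => u z - phi z) < e,
     [/\ nrm Om (fun z => gx z - pdx phi z) < e,
         nrm Om (fun z => gxx z - pdx (pdx phi) z) < e &
         nrm Om (fun z => gxy z - pdy (pdx phi) z) < e] &
     [/\ nrm Om (fun z => gy z - pdy phi z) < e,
         nrm Om (fun z => gyx z - pdx (pdy phi) z) < e &
         nrm Om (fun z => gyy z - pdy (pdy phi) z) < e]]) ->
  H20 Om u.
Proof.
move=> hu hgx hgy hgxx hgxy hgyx hgyy happ.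
have hlf (x : R) : 0 < x -> x / 2 < x by lra.
have lim pd v g (f : (R * R -> R) -> (R * R -> R)) : partial_op pd -> L2 Om v ->
    L2 Om g -> (forall phi, smooth phi -> smooth (f phi)) ->
    (forall e : R, 0 < e -> exists phi, [/\ test_function Om phi,
      nrm Om (fun z => v z - f phi z) < e &
      nrm Om (fun z => g z - pd (f phi) z) < e]) -> weak_pd pd v g.
  move=> hpd hv hg sf h; apply: (weak_pd_limit hpd) => // e e0.
  have [phi [tphi h1 h2]] := h e e0; exists (f phi); split => //.
  exact/sf/test_smooth/tphi.
have ux : weak_dx Om u gx.
  rewrite weak_dxE; apply: (lim _ _ _ id partial_op_x) => // e /happ[phi [t a []]].
  by exists phi.
have uy : weak_dy Om u gy.
  rewrite weak_dyE; apply: (lim _ _ _ id partial_op_y) => // e /happ[phi [t a _ []]].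
  by exists phi.
have uxx : weak_dx Om gx gxx.
  rewrite weak_dxE; apply: (lim _ _ _ pdx partial_op_x) => //.
    exact: smooth_pdx.
  by move=> e /happ[phi [t a [b c d] _]]; exists phi.
have uxy : weak_dy Om gx gxy.
  rewrite weak_dyE; apply: (lim _ _ _ pdx partial_op_y) => //.
    exact: smooth_pdx.
  by move=> e /happ[phi [t a [b c d] _]]; exists phi.
have uyx : weak_dx Om gy gyx.
  rewrite weak_dxE; apply: (lim _ _ _ pdy partial_op_x) => //.
    exact: smooth_pdy.
  by move=> e /happ[phi [t a _ [b c d]]]; exists phi.
have uyy : weak_dy Om gy gyy.
  rewrite weak_dyE; apply: (lim _ _ _ pdy partial_op_y) => //.
    exact: smooth_pdy.
  by move=> e /happ[phi [t a _ [b c d]]]; exists phi.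
have ex := dx_ae ux; have ey := dy_ae uy.
have hx := L2_sdx ux; have hy := L2_sdy uy.
split.
  have Hx : H1 Om (sdx Om u).
    apply: (@H1_of_weak _ gxx gxy) => //.
      by rewrite weak_dxE (weak_pd_congr partial_op_x hx hgx ex) -weak_dxE.
    by rewrite weak_dyE (weak_pd_congr partial_op_y hx hgx ex) -weak_dyE.
  have Hy : H1 Om (sdy Om u).
    apply: (@H1_of_weak _ gyx gyy) => //.
      by rewrite weak_dxE (weak_pd_congr partial_op_x hy hgy ey) -weak_dxE.
    by rewrite weak_dyE (weak_pd_congr partial_op_y hy hgy ey) -weak_dyE.
  split; first exact: (H1_of_weak hu ux uy).
    by move: Hx; rewrite sdx.unlock.
  by move: Hy; rewrite sdy.unlock.
(* [H2norm] nests two square roots of three squares, and [sqrt_sum3_lt] costs a factor 2 at each. *)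
move=> e e0; have [|phi [tphi h1 [h2 h3 h4] [h5 h6 h7]]] := happ (e / 2 / 2);
  first by rewrite !divr_gt0.
exists phi => //; rewrite (H2norm_smoothB hu ux uy uxx uxy uyx uyy (test_smooth tphi)).
have e2 : 0 < e / 2 by rewrite divr_gt0.
apply: sqrt_sum3_lt => //; do ?[exact: nrm_ge0|exact: sqrtr_ge0].
- by apply: lt_trans h1 _; exact: hlf.
- by apply: sqrt_sum3_lt => //; exact: nrm_ge0.
- by apply: sqrt_sum3_lt => //; exact: nrm_ge0.
Qed.

Lemma H20_spec u : H20 Om u -> [/\ L2 Om u, weak_dx Om u (sdx Om u),
  weak_dy Om u (sdy Om u) & [/\ weak_dx Om (sdx Om u) (sdx Om (sdx Om u)),
   weak_dy Om (sdx Om u) (sdy Om (sdx Om u)),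
   weak_dx Om (sdy Om u) (sdx Om (sdy Om u)) &
   weak_dy Om (sdy Om u) (sdy Om (sdy Om u))]].
Proof.
move=> [[[hu /dx_spec ux /dy_spec uy]]].
have -> : dx Om u = sdx Om u by rewrite sdx.unlock.
have -> : dy Om u = sdy Om u by rewrite sdy.unlock.
by move=> [_ /dx_spec ? /dy_spec ?] [_ /dx_spec ? /dy_spec ?] _.
Qed.

Lemma H20_approx u : H20 Om u ->
  forall e : R, 0 < e -> exists phi, [/\ test_function Om phi,
     nrm Om (fun z => u z - phi z) < e,
     nrm Om (fun z => sdx Om u z - pdx phi z) < e /\
     nrm Om (fun z => sdy Om u z - pdy phi z) < e &
     nrm Om (fun z => sdx Om (sdx Om u) z - pdx (pdx phi) z) < e /\
     nrm Om (fun z => sdy Om (sdy Om u) z - pdy (pdy phi) z) < e].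
Proof.
move=> h20 e e0; have [hu ux uy [uxx uxy uyx uyy]] := H20_spec h20.
have [_ /(_ e e0)[phi tphi]] := h20.
rewrite (H2norm_smoothB hu ux uy uxx uxy uyx uyy (test_smooth tphi)) => h.
have [h1 h2 h3] := sqrt_sum3_lt_inv (nrm_ge0 _ _) (sqrtr_ge0 _) (sqrtr_ge0 _) e0 h.
have [h4 h5 h6] := sqrt_sum3_lt_inv (nrm_ge0 _ _) (nrm_ge0 _ _) (nrm_ge0 _ _) e0 h2.
have [h7 h8 h9] := sqrt_sum3_lt_inv (nrm_ge0 _ _) (nrm_ge0 _ _) (nrm_ge0 _ _) e0 h3.
by exists phi.
Qed.

End weak_derivative.

(** * Compactness and the Poincaré inequality *)

Section rellich.
Context {R : realType} (Om : set (R * R)).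
Local Notation mu := (@lebesgue_measure R).
Local Notation mu2 := (@lebesgue_measure R \x @lebesgue_measure R)%E.
Implicit Types (u v w g phi psi : R * R -> R) (z p : R * R).

Lemma continuous_compact_integrableT (f : R -> R) (M : R) : continuous f ->
  (forall x, M <= `|x| -> f x = 0) -> mu.-integrable setT (fun x => (f x)%:E).
Proof.
move=> cf hf.
have -> : (fun x => (f x)%:E) = (fun x => (f x)%:E) \_ `[- M, M].
  apply/funext => x; rewrite patchE; case: ifPn => //.
  by rewrite mem_setE in_itv/= -ler_norml -ltNge => /ltW /hf ->.
have mI : measurable (`[- M, M]%classic : set (measurableTypeR R)).
  exact: measurable_itv.
apply/(integrable_mkcond _ mI).
apply: (@continuous_compact_integrable _ f); first exact: segment_compact.
exact: continuous_subspaceT.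
Qed.

Lemma primitive_integral (f : R -> R) (M : R) : (forall x, derivable f x 1) ->
  continuous (derive1 f) -> (forall x, M <= `|x| -> f x = 0) ->
  (forall x, M <= `|x| -> derive1 f x = 0) -> forall y,
  (\int[mu]_(t in `]-oo, y]) (derive1 f t)%:E = (f y)%:E)%E.
Proof.
move=> df cf hf hdf y; pose a := Num.min (- M) y - 1.
have ay : a < y by rewrite ltrBlDr ltr_pwDr// ge_min lexx orbT.
have out x : x <= a -> M <= `|x|.
  move=> xa; rewrite -normrN (le_trans _ (ler_norm _))// lerNr.
  by rewrite (le_trans xa)// lerBlDr ler_wpDr// ge_min lexx.
have -> : (\int[mu]_(t in `]-oo, y]) (derive1 f t)%:E =
    \int[mu]_(x in `[a, y]) (derive1 f x)%:E)%E.
  rewrite integral_mkcond [RHS]integral_mkcond; apply: eq_integral => x _.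
  rewrite !patchE !mem_setE !in_itv/=; case: (leP a x) => //= /ltW/out/hdf ->.
  by case: ifP.
have c1 : {within `[a, y], continuous (derive1 f)} by exact: continuous_subspaceT.
have c2 : derivable_oo_LRcontinuous f a y.
  split; first by move=> x _; exact: df.
    by apply: cvg_at_right_filter; exact: is_derive_continuous (is_derive_derive1 (df _)).
  by apply: cvg_at_left_filter; exact: is_derive_continuous (is_derive_derive1 (df _)).
rewrite (continuous_FTC2 ay c1 c2 (fun x _ => erefl)).
by rewrite (hf a (out _ (lexx _))) sube0.
Qed.

(** With U the primitive of f from -oo, the product f U has compact support, since f has; so the
    integral of (f U)' = f' U + f^2 is 0, and f^2 integrates to the same value as - f' U. *)
Lemma slice_inequality (f : R -> R) (M eta : R) : 0 < M -> 0 <= eta ->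
  (forall x, derivable f x 1) -> continuous (derive1 f) ->
  (forall x, M <= `|x| -> f x = 0) -> (forall x, M <= `|x| -> derive1 f x = 0) ->
  (forall x, `|x| < M -> `|\int[mu]_(t in `]-oo, x]) f t| <= eta) ->
  (\int[mu]_x (f x * f x)%:E <= \int[mu]_x (eta * `|derive1 f x|)%:E)%E.
Proof.
move=> M0 eta0 df cdf hf hdf hU.
pose U x := \int[mu]_(t in `]-oo, x]) f t.
have cf : continuous f.
  by move=> x; exact: is_derive_continuous (is_derive_derive1 (df x)).
have dU (x : R) : is_derive x 1 U (f x).
  have iu : mu.-integrable `]-oo, x + 1]%classic (EFin \o f).
    apply: (integrableS _ _ (@subsetT _ _) (continuous_compact_integrableT cf hf)) => //.
  have xu : x < x + 1 by rewrite ltrDl.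
  have [|d e] := @continuous_FTC1 R f -oo%O x (x + 1) xu iu _ (cf x).
    by rewrite /= ltNyr.
  apply: DeriveDef; first exact: d.
  by rewrite -derive1E; exact: e.
have cU : continuous U by move=> x; exact: is_derive_continuous (dU x).
pose g x := f x * U x.
have dg (x : R) : is_derive x 1 g (derive1 f x * U x + f x * f x).
  exact: (is_derive_mul (is_derive_derive1 (df x)) (dU x)).
have dgE : derive1 g = (fun x => derive1 f x * U x + f x * f x).
  by apply/funext => x; exact: derive1_is.
have cdg : continuous (derive1 g).
  rewrite dgE => x; apply: cvgD; apply: cvgM; do ?[exact: cf|exact: cU|exact: cdf].
have g0 : (\int[mu]_x (derive1 f x * U x + f x * f x)%:E = 0)%E.
  have := @section_integral0 R g M M0; rewrite dgE; apply.
  - by move=> x; case: (dg x).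
  - by rewrite -dgE.
  - by move=> x /hf; rewrite /g => ->; rewrite mul0r.
  - by move=> x Mx; rewrite hf// hdf// !mul0r addr0.
have i1 : mu.-integrable setT (fun x => (derive1 f x * U x + f x * f x)%:E).
  apply: (@continuous_compact_integrableT _ M); first by rewrite -dgE.
  by move=> x Mx; rewrite hf// hdf// !mul0r addr0.
have i2 : mu.-integrable setT (fun x => (eta * `|derive1 f x|)%:E).
  apply: (@continuous_compact_integrableT (fun x => eta * `|derive1 f x|) M).
    move=> x; apply: cvgM; first exact: cvg_cst.
    by apply: cvg_norm; exact: cdf.
  by move=> x Mx; rewrite hdf// normr0 mulr0.
rewrite -[leRHS]add0e -g0 -integralD//.
apply: ge0_le_integral => //.
- by move=> x _; rewrite lee_fin -expr2 sqr_ge0.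
- by apply/measurable_EFinP; apply: continuous_measurable_fun => x; apply: cvgM; exact: cf.
- by case/integrableP : (integrableD measurableT i1 i2).
move=> x _; rewrite -EFinD lee_fin.
have [Mx|xM] := leP M `|x|; first by rewrite hf// hdf// normr0; lra.
have h1 : - (derive1 f x * U x) <= `|derive1 f x| * eta.
  rewrite (le_trans (ler_norm _))// normrN normrM ler_wpM2l//; exact: hU.
lra.
Qed.

(* For a test function phi, pairing pdy phi with the indicator of a corner gives the
   primitive of phi in the first variable; as these functionals are Hölder
   continuous in the corner, finitely many of them control phi in L2. *)
Definition corner z : set (R * R) := `]-oo, z.1]%classic `*` `]-oo, z.2]%classic.

Lemma measurable_corner z :
  measurable (corner z : set (measurableTypeR R * measurableTypeR R)).
Proof. by apply: measurableX; exact: measurable_itv. Qed.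

Hypothesis oOm : open Om.
Hypothesis bOm : bounded_set Om.

Let mOm : measurable (Om : set (measurableTypeR R * measurableTypeR R)).
Proof. exact: open_measurable2. Qed.

Let fOm : (mu2 Om < +oo)%E.
Proof. exact: bounded_measure_lty. Qed.

Lemma L2_indic (A : set (R * R)) :
  measurable (A : set (measurableTypeR R * measurableTypeR R)) -> L2 Om \1_A.
Proof.
move=> mA; apply: (@L2_bounded _ _ mOm _ 1) => //.
by move=> z _; rewrite indicE; case: (_ \in _); rewrite ?normr1 ?normr0.
Qed.

Lemma L2_abs u : L2 Om u -> L2 Om (fun z => `|u z|).
Proof.
move=> hu; apply: L2_of_sq_integrable => //.
  by apply: measurableT_comp => //; exact: L2_measurable.
apply: eq_integrable (L2_sq_integrable mOm hu) => // z _ /=.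
by rewrite -normrM ger0_norm// -expr2 sqr_ge0.
Qed.

(** By Fubini, the inner integral of [pdy phi (s, .)] up to z.2 is [phi (s, z.2)]. *)
Lemma corner_ip phi z : test_function Om phi ->
  sip Om (pdy phi) \1_(corner z) = \int[mu]_(s in `]-oo, z.1]) phi (s, z.2).
Proof.
move=> tphi; have tp := test_pdy tphi.
have [M M0 OM] := bounded_cbox bOm.
pose f (p : R * R) : \bar R := (pdy phi p * \1_(corner z) p)%:E.
have E : f = f \_ Om.
  apply/funext => p; rewrite patchE; case: ifPn => // /negP np.
  by rewrite /f (test_out tp) ?mul0r// => Op; apply: np; rewrite inE.
have iO : mu2.-integrable Om f.
  by apply: L2M_integrable => //; [exact: L2_test|exact: L2_indic (measurable_corner _)].
have iT : mu2.-integrable setT f by rewrite E; apply/(integrable_mkcond _ mOm).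
rewrite sip.unlock /ip /Rintegral; congr fine.
have -> : (\int[mu2]_(x in Om) (pdy phi x * \1_(corner z) x)%:E = \int[mu2]_x f x)%E.
  by rewrite [RHS](congr1 (fun h => integral mu2 setT h) E) -integral_mkcond.
rewrite -integral12_prod_meas1// [RHS]integral_mkcond.
apply: eq_integral => s _; rewrite /fubini_F patchE mem_setE in_itv/=.
case: ifPn => [sz|/negbTE sz]; last first.
  rewrite integral0_eq// => t _; rewrite /f indicE /corner.
  by rewrite memNset ?mulr0// => -[] /=; rewrite in_itv/= sz.
transitivity (\int[mu]_(t in `]-oo, z.2]) (derive1 (fun t => phi (s, t)) t)%:E)%E.
  rewrite [RHS]integral_mkcond; apply: eq_integral => t _.
  rewrite /f indicE patchE mem_setE in_itv/=; case: ifPn => [tz|/negbTE tz].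
    by rewrite mem_set ?mulr1// /corner; split; rewrite /= in_itv.
  by rewrite memNset ?mulr0// => -[] /= _; rewrite in_itv/= tz.
apply: (@primitive_integral (fun t => phi (s, t)) M).
- by move=> t; case: (smooth_is_derive_y s t (test_smooth tphi)).
- apply: (@continuous_section_y _ (pdy phi) s).
  exact: smooth_continuous (smooth_pdy (test_smooth tphi)).
- by move=> t Mt; apply: (test_out_box tphi OM); right.
- by move=> t Mt; apply: (test_out_box tp OM (z := (s, t))); right.
Qed.

(** This is [slice_inequality] on every horizontal line, where the primitive of phi is a corner
    functional, integrated over the lines by Tonelli. *)
Lemma ip_le_corner phi (M eta : R) : 0 < M ->
  (forall z, Om z -> `|z.1| < M /\ `|z.2| < M) ->
  test_function Om phi -> 0 <= eta ->
  (forall z, `|z.1| < M -> `|z.2| < M ->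
    `|sip Om (pdy phi) \1_(corner z)| <= eta) ->
  sip Om phi phi <= eta * \int[mu2]_(z in Om) `|pdx phi z|.
Proof.
move=> M0 OM tphi eta0 hc; have tp := test_pdx tphi.
have sphi := test_smooth tphi.
have cphi := smooth_continuous sphi.
have cdx := smooth_continuous (smooth_pdx sphi).
have h : (\int[mu2]_z (phi z * phi z)%:E <= \int[mu2]_z (eta * `|pdx phi z|)%:E)%E.
  rewrite fubini_tonelli2; last 2 first.
  - apply/measurable_EFinP; apply: continuous_measurable2 => z.
    by apply: cvgM; exact: cphi.
  - by move=> z; rewrite lee_fin -expr2 sqr_ge0.
  rewrite fubini_tonelli2; last 2 first.
  - apply/measurable_EFinP; apply: continuous_measurable2 => z.
    by apply: cvgM; [exact: cvg_cst|apply: cvg_norm; exact: cdx].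
  - by move=> z; rewrite lee_fin mulr_ge0.
  apply: ge0_le_integral => //.
  - by move=> y _; apply: integral_ge0 => x _; rewrite lee_fin -expr2 sqr_ge0.
  - apply: (measurable_fun_fubini_tonelli_G (m1 := mu) (fun z => (phi z * phi z)%:E)).
      apply/measurable_EFinP; apply: continuous_measurable2 => z.
      by apply: cvgM; exact: cphi.
    by move=> z; rewrite lee_fin -expr2 sqr_ge0.
  - apply: (measurable_fun_fubini_tonelli_G (m1 := mu) (fun z => (eta * `|pdx phi z|)%:E)).
      apply/measurable_EFinP; apply: continuous_measurable2 => z.
      by apply: cvgM; [exact: cvg_cst|apply: cvg_norm; exact: cdx].
    by move=> z; rewrite lee_fin mulr_ge0.
  move=> y _; rewrite /fubini_G.
  apply: (@slice_inequality (fun x => phi (x, y)) M eta) => //.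
  - by move=> x; case: (smooth_is_derive_x x y sphi).
  - exact: (@continuous_section_x _ (pdx phi) y).
  - by move=> x Mx; apply: (test_out_box tphi OM); left.
  - by move=> x Mx; apply: (test_out_box tp OM (z := (x, y))); left.
  - move=> x xM; have [yM|My] := ltP `|y| M.
      by rewrite -(corner_ip (x, y) tphi); exact: hc.
    rewrite (_ : (fun t => phi (t, y)) = cst 0) ?Rintegral_cst ?mul0r ?normr0//.
    by apply/funext => t; apply: (test_out_box tphi OM); right.
have outT (f : R * R -> R) : (forall z, ~ Om z -> f z = 0) ->
    (\int[mu2]_(z in Om) (f z)%:E = \int[mu2]_z (f z)%:E)%E.
  move=> hf; rewrite integral_mkcond; apply: eq_integral => z _.
  by rewrite patchE; case: ifPn => // /negP nz; rewrite hf// => Oz; apply: nz; rewrite inE.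
rewrite sip.unlock /ip.
have iabs : mu2.-integrable Om (EFin \o (fun z => `|pdx phi z|)).
  by apply: L2_integrable => //; apply: L2_abs; exact: L2_test.
rewrite -RintegralZl// /Rintegral; apply: fine_le.
- by apply: integrable_fin_num => //; apply: L2M_integrable => //; exact: L2_test.
- apply: integrable_fin_num => //.
  exact: (integrableZl mOm eta iabs).
rewrite outT; last by move=> z /(test_out tphi) ->; rewrite mul0r.
by rewrite outT// => z /(test_out tp) ->; rewrite normr0 mulr0.
Qed.

Lemma testB phi psi : test_function Om phi -> test_function Om psi ->
  test_function Om (fun z => phi z - psi z).
Proof.
move=> tphi tpsi; have := test_lincomb (-1) tpsi tphi; rewrite /lincomb.
by under eq_fun do rewrite mulN1r addrC.
Qed.

Lemma pdxB u v : smooth u -> smooth v ->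
  pdx (fun z => u z - v z) = (fun z => pdx u z - pdx v z).
Proof.
move=> su sv; have E (f1 f2 : R * R -> R) : (fun z => f1 z - f2 z) = lincomb (-1) f2 f1.
  by apply/funext => z; rewrite /lincomb mulN1r addrC.
by rewrite !E pdx_lincomb.
Qed.

Lemma pdyB u v : smooth u -> smooth v ->
  pdy (fun z => u z - v z) = (fun z => pdy u z - pdy v z).
Proof.
move=> su sv; have E (f1 f2 : R * R -> R) : (fun z => f1 z - f2 z) = lincomb (-1) f2 f1.
  by apply/funext => z; rewrite /lincomb mulN1r addrC.
by rewrite !E pdy_lincomb.
Qed.

(** Inside the square of half-side M the two corners differ only within one vertical and one
    horizontal strip, each of width h and length 2 M. *)
Lemma corner_diff (M h : R) z p : 0 < M ->
  (forall q, Om q -> `|q.1| < M /\ `|q.2| < M) -> 0 <= h ->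
  p.1 <= z.1 <= p.1 + h -> p.2 <= z.2 <= p.2 + h ->
  nrm Om (fun q => \1_(corner z) q - \1_(corner p) q) ^+ 2 <= 4 * M * h.
Proof.
move=> M0 OM h0 /andP[p1 z1] /andP[p2 z2].
have L1 := L2_indic (measurable_corner z).
have L2' := L2_indic (measurable_corner p).
pose S1 : set (R * R) := `]p.1, p.1 + h]%classic `*` `[- M, M]%classic.
pose S2 : set (R * R) := `[- M, M]%classic `*` `]p.2, p.2 + h]%classic.
have mS1 : measurable (S1 : set (measurableTypeR R * measurableTypeR R)).
  by apply: measurableX; exact: measurable_itv.
have mS2 : measurable (S2 : set (measurableTypeR R * measurableTypeR R)).
  by apply: measurableX; exact: measurable_itv.
have mS := measurableU _ _ mS1 mS2.
rewrite nrm_sq -lee_fin -integral_sq_ip//; last exact: L2B.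
apply: (@le_trans _ _ (\int[mu2]_(q in Om) (\1_(S1 `|` S2) q)%:E)%E).
  apply: ge0_le_integral => //.
  - by move=> q _; rewrite lee_fin sqr_ge0.
  - apply/measurable_EFinP; apply: measurable_funX; apply: measurable_funB.
      exact: L2_measurable L1.
    exact: L2_measurable L2'.
  - apply/measurable_EFinP; exact: (L2_measurable (L2_indic mS)).
  move=> q /OM[q1 q2]; rewrite lee_fin.
  have M1 : `[- M, M]%classic q.1 by rewrite /= in_itv/= -ler_norml ltW.
  have M2 : `[- M, M]%classic q.2 by rewrite /= in_itv/= -ler_norml ltW.
  have [cp|ncp] := pselect (corner p q).
    have cz : corner z q.
      case: cp => /=; rewrite !in_itv/= => a b; split; rewrite /= in_itv/=.
        exact: le_trans a _.
      exact: le_trans b _.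
    by rewrite [\1_(corner z) q]indicE [\1_(corner p) q]indicE !mem_set// subrr expr0n.
  have [cz|ncz] := pselect (corner z q); last first.
    by rewrite [\1_(corner z) q]indicE [\1_(corner p) q]indicE !memNset// subrr expr0n.
  rewrite [\1_(corner z) q]indicE [\1_(corner p) q]indicE mem_set// memNset//.
  rewrite subr0 expr1n indicE mem_set//.
  case: cz => /=; rewrite !in_itv/= => a b.
  have [c|c] := leP q.1 p.1; last first.
    by left; split => //=; rewrite in_itv/= c (le_trans a).
  have [d|d] := leP q.2 p.2; last first.
    by right; split => //=; rewrite in_itv/= d (le_trans b).
  by exfalso; apply: ncp; split; rewrite /= in_itv.
rewrite integral_indic//.
apply: (@le_trans _ _ (mu2 (S1 `|` S2))).
  by apply: le_measure; rewrite ?inE//; exact: measurableI.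
apply: le_trans (measureU2 _ mS1 mS2) _.
have l1 (x : R) : lebesgue_measure `]x, x + h]%classic = h%:E.
  rewrite lebesgue_measure_itv/= lte_fin ltrDl; case: ltP => [_|hn].
    by rewrite -EFinD; congr EFin; ring.
  by congr EFin; apply/eqP; rewrite eq_le hn h0.
have l2 : lebesgue_measure `[- M, M]%classic = (2 * M)%:E.
  rewrite lebesgue_measure_itv/= lte_fin gtrN// -EFinD; congr EFin; ring.
have e1 : mu2 S1 = (h * (2 * M))%:E.
  rewrite [LHS]product_measure1E; [|exact: measurable_itv..].
  by rewrite [X in (X * _)%E]l1 [X in (_ * X)%E]l2.
have e2 : mu2 S2 = (2 * M * h)%:E.
  rewrite [LHS]product_measure1E; [|exact: measurable_itv..].
  by rewrite [X in (X * _)%E]l2 [X in (_ * X)%E]l1.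
rewrite [X in (X + _)%E]e1 [X in (_ + X)%E]e2 -EFinD lee_fin; lra.
Qed.

End rellich.

(** A bounded function converges along an ultrafilter, by compactness of the segment; this stands in
    for the choice of a subsequence. *)
Lemma ultra_bounded_cvg {R : realType} (T : Type) (U : set_system T) (S : set T)
  (l : T -> R) (C : R) : UltraFilter U -> U S -> (forall x, S x -> `|l x| <= C) ->
  exists c, forall e, 0 < e -> U [set x | `|l x - c| <= e].
Proof.
move=> UU US hS.
have [|c [_ cc]] := @segment_compact R (- C) C (l @ U) (fmap_proper_filter _ _).
  rewrite /fmap/=; apply: filterS US => x /hS hx.
  by rewrite /= in_itv/= -ler_norml.
exists c => e e0; have [//|nU] := in_ultra_setVsetC [set x | `|l x - c| <= e] UU.
have UN : (l @ U) [set y | e < `|y - c|].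
  by rewrite /fmap/=; apply: filterS nU => x /= /negP; rewrite -ltNge.
have [y [/= y1 y2]] := cc _ _ UN (nbhsx_ballx c e e0).
move: y2; rewrite -ball_normE/= distrC => y2.
by have := lt_trans y1 y2; rewrite ltxx.
Qed.

Section rellich_compactness.
Context {R : realType} (Om : set (R * R)).
Local Notation mu := (@lebesgue_measure R).
Local Notation mu2 := (@lebesgue_measure R \x @lebesgue_measure R)%E.
Implicit Types (u v w g phi psi : R * R -> R) (z p : R * R).
Hypothesis oOm : open Om.
Hypothesis bOm : bounded_set Om.

Let mOm : measurable (Om : set (measurableTypeR R * measurableTypeR R)).
Proof. exact: open_measurable2. Qed.

Let fOm : (mu2 Om < +oo)%E.
Proof. exact: bounded_measure_lty. Qed.

Lemma L2_pdx phi : test_function Om phi -> L2 Om (pdx phi).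
Proof. by move=> t; apply: L2_test => //; exact: test_pdx. Qed.

Lemma L2_pdy phi : test_function Om phi -> L2 Om (pdy phi).
Proof. by move=> t; apply: L2_test => //; exact: test_pdy. Qed.

Lemma grid_point (M z : R) (n : nat) : 0 < M -> `|z| < M ->
  exists i : 'I_n.+1, - M + i%:R * (2 * M / n.+1%:R) <= z <=
    - M + i%:R * (2 * M / n.+1%:R) + 2 * M / n.+1%:R.
Proof.
move=> M0; rewrite ltr_norml => /andP[z1 z2].
have n0 : (0 : R) < n.+1%:R by rewrite ltr0n.
set h := 2 * M / n.+1%:R; have h0 : 0 < h by rewrite divr_gt0// mulr_gt0.
have t0 : 0 <= (z + M) / h by rewrite divr_ge0 ?(ltW h0)//; lra.
have /andP[t1 t2] := Num.Theory.truncn_itv t0.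
have tn : (Num.truncn ((z + M) / h) < n.+1)%N.
  rewrite -(ltr_nat R); apply: (le_lt_trans t1).
  by rewrite ltr_pdivrMr// /h mulrCA divff ?gt_eqF// mulr1; lra.
exists (Ordinal tn) => /=; move: (Num.truncn _) t1 t2 {tn} => q.
 rewrite ler_pdivlMr// ltr_pdivrMr// -natr1 mulrDl mul1r => t1 t2;
apply/andP; split; lra.
Qed.

Lemma dist_center (a b c e : R) :
  `|a - c| <= e / 4 -> `|b - c| <= e / 4 -> `|a - b| <= e / 2.
Proof. by rewrite !ler_norml => /andP[? ?] /andP[? ?]; apply/andP; split; lra. Qed.

Lemma norm_of_half (a b e : R) : `|b| <= e / 2 -> `|a - b| <= e / 2 -> `|a| <= e.
Proof. by rewrite !ler_norml => /andP[? ?] /andP[? ?]; apply/andP; split; lra. Qed.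

(** The set A consists of the functions whose functionals at finitely many grid corners are close to
    their limits along U. For a difference of two of them the functional is then small at the grid
    corners, by Hölder continuity at every corner, and [ip_le_corner] applies. *)
Lemma rellich (U : set_system (R * R -> R)) (S : set (R * R -> R)) (B : R) :
  UltraFilter U -> U S -> 0 <= B ->
  (forall phi, S phi ->
    [/\ test_function Om phi, nrm Om (pdx phi) <= B & nrm Om (pdy phi) <= B]) ->
  forall d, 0 < d -> exists A, [/\ U A, A `<=` S & forall phi psi, A phi -> A psi ->
    sip Om (fun z => phi z - psi z) (fun z => phi z - psi z) <= d].
Proof.
move=> UU US B0 hS d d0.
have [M M0 OM] := bounded_cbox bOm.
(* Bounds the L^1 norm of the x-derivative of a difference, so that [eta * K <= d]. *)
pose K := 2 * B * nrm Om (cst 1).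
have K0 : 0 <= K by rewrite /K !mulr_ge0// nrm_ge0.
pose eta := d / (K + 1).
have eta0 : 0 < eta by rewrite divr_gt0// ltr_wpDl.
(* Admissible squared distance from a corner to a grid corner: against a y-derivative of norm at
   most 2 B it costs at most eta / 2. The grid is refined until [4 * M * h <= tau]; the other eta /
   2 comes from the grid corners. *)
pose tau := (eta / (4 * (B + 1))) ^+ 2.
have tau0 : 0 < tau by rewrite exprn_gt0// divr_gt0// mulr_gt0// ltr_wpDl.
pose n := Num.truncn (8 * M * M / tau).
pose h := 2 * M / n.+1%:R.
have h0 : 0 < h by rewrite divr_gt0 ?mulr_gt0// ltr0n.
have htau : 4 * M * h <= tau.
  have : 8 * M * M / tau < n.+1%:R by rewrite Num.Theory.truncnS_gt.
  rewrite ltr_pdivrMr// => /ltW hn.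
  have -> : 4 * M * h = 8 * M * M / n.+1%:R by rewrite /h; ring.
  by rewrite ler_pdivrMr ?ltr0n// (mulrC tau).
pose P (ij : 'I_n.+1 * 'I_n.+1) : R * R := (- M + ij.1%:R * h, - M + ij.2%:R * h).
pose l p phi := sip Om (pdy phi) \1_(corner p).
have L1 p : L2 Om \1_(corner p) by apply: L2_indic => //; exact: measurable_corner.
have hl p : exists c, forall e, 0 < e -> U [set phi | `|l p phi - c| <= e].
  apply: (ultra_bounded_cvg (C := B * nrm Om \1_(corner p)) UU US) => phi /hS[t _ b].
  apply: (le_trans (ip_le_nrm mOm (L2_pdy t) (L1 p))).
  by rewrite ler_wpM2r ?nrm_ge0.
pose c ij := projT1 (cid (hl (P ij))).
have hc ij : U [set phi | `|l (P ij) phi - c ij| <= eta / 4].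
  by apply: (projT2 (cid (hl (P ij)))); rewrite divr_gt0.
pose A := S `&` [set phi | forall ij, `|l (P ij) phi - c ij| <= eta / 4].
exists A; split; [by apply: filterI => //; exact: filter_forall|by move=> ? []|].
move=> phi psi [/hS[t1 x1 y1] a1] [/hS[t2 x2 y2] a2].
have tD := testB t1 t2.
have LB u v : L2 Om u -> L2 Om v -> nrm Om u <= B -> nrm Om v <= B ->
    nrm Om (fun z => u z - v z) <= 2 * B.
  move=> Lu Lv bu bv.
  have E : (fun z => u z - v z) = (fun z => u z + (-1) * v z).
    by apply/funext => z; rewrite mulN1r.
  rewrite E; apply: (le_trans (nrmD mOm Lu (L2Z mOm _ Lv))).
  have -> : nrm Om (fun z => -1 * v z) = nrm Om v.
    rewrite !nrmE ipZl ?ipZr//; last exact: L2Z.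
    by rewrite mulN1r mulN1r opprK.
  by rewrite mulr2n mulrDl mul1r lerD.
have nx : nrm Om (pdx (fun z => phi z - psi z)) <= 2 * B.
  rewrite pdxB; [|exact: (test_smooth t1)|exact: (test_smooth t2)]; apply: LB => //; exact: L2_pdx.
have ny : nrm Om (pdy (fun z => phi z - psi z)) <= 2 * B.
  rewrite pdyB; [|exact: (test_smooth t1)|exact: (test_smooth t2)]; apply: LB => //; exact: L2_pdy.
have lD p : l p (fun z => phi z - psi z) = l p phi - l p psi.
  rewrite /l pdyB; [|exact: (test_smooth t1)|exact: (test_smooth t2)].
  by rewrite ipBl//; exact: L2_pdy.
have key z : `|z.1| < M -> `|z.2| < M ->
    `|sip Om (pdy (fun z => phi z - psi z)) \1_(corner z)| <= eta.
  move=> z1 z2.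
  have [i hi] := grid_point n M0 z1; have [j hj] := grid_point n M0 z2.
  have cd := corner_diff oOm bOm (z := z) (p := P (i, j)) M0 OM (ltW h0) hi hj.
  have b1 : `|l (P (i, j)) (fun z => phi z - psi z)| <= eta / 2.
    by rewrite lD; exact: dist_center (a1 (i, j)) (a2 (i, j)).
  have b2 : `|l z (fun z => phi z - psi z) - l (P (i, j)) (fun z => phi z - psi z)|
      <= eta / 2.
    rewrite /l -ipBr//; last exact: L2_pdy.
    apply: (le_trans (ip_le_nrm mOm (L2_pdy tD) (L2B mOm (L1 _) (L1 _)))).
    have nc : nrm Om (fun q => \1_(corner z) q - \1_(corner (P (i, j))) q)
        <= eta / (4 * (B + 1)).
      rewrite -ler_sqr ?nnegrE ?nrm_ge0//.
        exact: le_trans cd htau.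
      by rewrite divr_ge0 ?(ltW eta0)// mulr_ge0// addr_ge0.
    apply: (le_trans (ler_pM (nrm_ge0 _ _) (nrm_ge0 _ _) ny nc)).
    rewrite mulrA ler_pdivrMr; last by rewrite mulr_gt0// ltr_wpDl.
    have := mulr_ge0 (ltW eta0) B0; move: (ltW eta0); clear; lra.
  exact: norm_of_half b1 b2.
apply: (le_trans (ip_le_corner oOm bOm M0 OM tD (ltW eta0) key)).
have i1 : \int[mu2]_(z in Om) `|pdx (fun z => phi z - psi z) z| <= K.
  have LA := L2_abs oOm (L2_pdx tD).
  have L1' : L2 Om (cst 1).
    by apply: (@L2_bounded _ _ mOm _ 1) => // z _ /=; rewrite normr1.
  have := ip_le_nrm mOm LA L1'.
  have -> : nrm Om (fun z => `|pdx (fun z => phi z - psi z) z|) =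
      nrm Om (pdx (fun z => phi z - psi z)).
    rewrite !nrmE sip.unlock /ip; congr Num.sqrt; apply: eq_Rintegral => z _.
    by rewrite -normrM ger0_norm// -expr2 sqr_ge0.
  have -> : sip Om (fun z => `|pdx (fun z => phi z - psi z) z|) (cst 1) =
      \int[mu2]_(z in Om) `|pdx (fun z => phi z - psi z) z|.
    by rewrite sip.unlock /ip; apply: eq_Rintegral => z _; rewrite mulr1.
  move=> hh; apply: (le_trans (ler_norm _)); apply: (le_trans hh).
  by rewrite ler_wpM2r ?nrm_ge0.
apply: (@le_trans _ _ (eta * K)); first by rewrite ler_wpM2l// ltW.
rewrite /eta -mulrA ler_piMr ?(ltW d0)// mulrC ler_pdivrMr; last by rewrite ltr_wpDl.
by rewrite mul1r lerDl.
Qed.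

End rellich_compactness.

(** * Minimization of the Rayleigh quotient *)

Section poincare.
Context {R : realType} (Om : set (R * R)).
Local Notation mu2 := (@lebesgue_measure R \x @lebesgue_measure R)%E.
Implicit Types (u v w g phi psi : R * R -> R) (z p : R * R) (lam e : R).
Hypothesis oOm : open Om.
Hypothesis bOm : bounded_set Om.

Let mOm : measurable (Om : set (measurableTypeR R * measurableTypeR R)).
Proof. exact: open_measurable2. Qed.

(** The form of - Laplace - lam, with derivatives as separate arguments so that it applies alike to
    test functions, to L^2 limits and to chosen weak derivatives. *)
Definition qform lam u ux uy w wx wy : R :=
  sip Om ux wx + sip Om uy wy - lam * sip Om u w.

Definition qtest lam phi psi : R :=
  qform lam phi (pdx phi) (pdy phi) psi (pdx psi) (pdy psi).

Lemma qtest_lincomb lam (t : R) w phi : test_function Om w -> test_function Om phi ->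
  qtest lam (lincomb t w phi) (lincomb t w phi) =
  t ^+ 2 * qtest lam w w + 2 * t * qtest lam phi w + qtest lam phi phi.
Proof.
move=> tw tp; have sw := test_smooth tw; have sp := test_smooth tp.
have E u v : L2 Om u -> L2 Om v -> sip Om (lincomb t u v) (lincomb t u v) =
    t ^+ 2 * sip Om u u + 2 * t * sip Om v u + sip Om v v.
  move=> Lu Lv; rewrite ip_lincombl ?ip_lincombr//; last exact: L2_lincomb.
  by rewrite (ipC _ u v); ring.
rewrite /qtest /qform pdx_lincomb// pdy_lincomb//.
have L1 := L2_test oOm bOm tw; have L2' := L2_test oOm bOm tp.
have L3 := L2_pdx oOm bOm tw; have L4 := L2_pdx oOm bOm tp.
have L5 := L2_pdy oOm bOm tw; have L6 := L2_pdy oOm bOm tp.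
by rewrite (E _ _ L1 L2') (E _ _ L3 L4) (E _ _ L5 L6); ring.
Qed.

Lemma qtest_scale lam (t : R) w : test_function Om w ->
  qtest lam (fun z => t * w z) (fun z => t * w z) = t ^+ 2 * qtest lam w w.
Proof.
move=> tw; have t0 := test_cst0 Om.
have -> : (fun z => t * w z) = lincomb t w (cst 0).
  by apply/funext => z; rewrite /lincomb addr0.
rewrite qtest_lincomb//.
have dx0 : pdx (cst 0 : R * R -> R) = cst 0 by rewrite pdx_cst.
have dy0 : pdy (cst 0 : R * R -> R) = cst 0 by rewrite pdy_cst.
by rewrite /qtest /qform dx0 dy0 !ip0l//; ring.
Qed.

(** Along a minimizing sequence [qtest lam phi phi] tends to 0, and this inequality makes
    [qtest lam phi w] follow: the eigenvalue equation without differentiating the functional. *)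
Lemma qtest_cauchy_schwarz lam w phi :
  (forall psi, test_function Om psi -> 0 <= qtest lam psi psi) ->
  test_function Om w -> test_function Om phi ->
  qtest lam phi w ^+ 2 <= qtest lam w w * qtest lam phi phi.
Proof.
move=> pos tw tp; apply: quadratic_discr; try exact: pos.
by move=> t; rewrite -qtest_lincomb//; apply: pos; exact: test_lincomb.
Qed.

(** The parallelogram law, the square of the sum being dropped by positivity. *)
Lemma qtest_diff lam phi psi :
  (forall psi, test_function Om psi -> 0 <= qtest lam psi psi) ->
  test_function Om phi -> test_function Om psi ->
  qtest lam (fun z => phi z - psi z) (fun z => phi z - psi z) <=
  2 * (qtest lam phi phi + qtest lam psi psi).
Proof.
move=> pos t1 t2.
have -> : (fun z => phi z - psi z) = lincomb (-1) psi phi.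
  by apply/funext => z; rewrite /lincomb mulN1r addrC.
have := pos _ (test_lincomb 1 t2 t1).
rewrite !qtest_lincomb// expr1n sqrrN expr1n; lra.
Qed.

Lemma test_scale (t : R) w : test_function Om w -> test_function Om (fun z => t * w z).
Proof.
move=> tw; have := test_lincomb t tw (test_cst0 Om); rewrite /lincomb.
by under eq_fun do rewrite addr0.
Qed.

Lemma nrm_distC u v : nrm Om (fun z => u z - v z) = nrm Om (fun z => v z - u z).
Proof.
by rewrite !nrmE sip.unlock /ip; congr Num.sqrt; apply: eq_Rintegral => z _; ring.
Qed.

Lemma eq0_of_small (a K : R) : (forall e : R, 0 < e -> `|a| <= K * e) -> a = 0.
Proof.
move=> h; apply/eqP; rewrite -normr_eq0 eq_le normr_ge0 andbT.
have K0 : 0 <= K by have := h 1 ltr01; rewrite mulr1; apply: le_trans.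
apply/ler_addgt0Pl => e e0; rewrite addr0.
apply: (le_trans (h (e / (K + 1)) _)); first by rewrite divr_gt0// ltr_wpDl.
rewrite mulrA ler_pdivrMr; last by rewrite ltr_wpDl.
by rewrite mulrC ler_pM2l// lerDl.
Qed.

Lemma qform_eq0 lam u ux uy w wx wy :
  L2 Om u -> L2 Om ux -> L2 Om uy -> L2 Om w -> L2 Om wx -> L2 Om wy ->
  (forall e : R, 0 < e -> exists v vx vy, [/\ L2 Om v, L2 Om vx & L2 Om vy] /\
    [/\ nrm Om (fun z => u z - v z) <= e,
        nrm Om (fun z => ux z - vx z) <= e,
        nrm Om (fun z => uy z - vy z) <= e &
        `|qform lam v vx vy w wx wy| <= e]) ->
  qform lam u ux uy w wx wy = 0.
Proof.
move=> Lu Lux Luy Lw Lwx Lwy h.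
apply: (@eq0_of_small _ (nrm Om wx + nrm Om wy + `|lam| * nrm Om w + 1)) => e e0.
have [v [vx [vy [[Lv Lvx Lvy] [h1 h2 h3 h4]]]]] := h e e0.
have B a b c : L2 Om a -> L2 Om b -> L2 Om c -> nrm Om (fun z => a z - b z) <= e ->
    `|sip Om a c - sip Om b c| <= e * nrm Om c.
  move=> La Lb Lc ab; rewrite -ipBl//.
  apply: (le_trans (ip_le_nrm mOm (L2B mOm La Lb) Lc)).
  by rewrite ler_wpM2r ?nrm_ge0.
have b1 := B _ _ _ Lux Lvx Lwx h2; have b2 := B _ _ _ Luy Lvy Lwy h3.
have b3 := B _ _ _ Lu Lv Lw h1.
have -> : qform lam u ux uy w wx wy = (sip Om ux wx - sip Om vx wx) +
    (sip Om uy wy - sip Om vy wy) - lam * (sip Om u w - sip Om v w) +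
    qform lam v vx vy w wx wy by rewrite /qform; ring.
apply: (le_trans (ler_normD _ _)).
apply: (@le_trans _ _ (e * nrm Om wx + e * nrm Om wy + `|lam| * (e * nrm Om w) + e)).
  apply: lerD h4; apply: (le_trans (ler_normB _ _)); apply: lerD.
    by apply: (le_trans (ler_normD _ _)); apply: lerD.
  by rewrite normrM ler_wpM2l.
by rewrite le_eqVlt; apply/orP; left; apply/eqP; ring.
Qed.

Lemma qtest_energy lam phi : qtest lam phi phi =
  sip Om (pdx phi) (pdx phi) + sip Om (pdy phi) (pdy phi) - lam * sip Om phi phi.
Proof. by []. Qed.

Lemma expr2_le_sqrt (a b : R) : 0 <= a -> 0 <= b -> a ^+ 2 <= b -> a <= Num.sqrt b.
Proof. by move=> a0 b0 ab; rewrite -(ger0_norm a0) -sqrtr_sqr ler_sqrt. Qed.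

(** Compactness makes differences small in L^2 only; their energy is [qtest] plus lam times the
    squared L^2 norm, and [qtest_diff] controls the first part for near-minimizers. The rate 8^-n is
    the one [L2_complete] asks for. *)
Lemma minimizing_sequence lam : 0 <= lam ->
  (forall psi, test_function Om psi -> 0 <= qtest lam psi psi) ->
  (forall e, 0 < e -> exists2 phi, test_function Om phi /\ sip Om phi phi = 1 &
    qtest lam phi phi < e) ->
  exists phi_ : nat -> R * R -> R,
    [/\ forall n, test_function Om (phi_ n) /\ sip Om (phi_ n) (phi_ n) = 1,
        forall n, qtest lam (phi_ n) (phi_ n) <= 8^-1 ^+ n &
        forall n, let D := fun z => phi_ n.+1 z - phi_ n z in
          sip Om D D + (sip Om (pdx D) (pdx D) + sip Om (pdy D) (pdy D)) <= 8^-1 ^+ n].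
Proof.
move=> lam0 pos hmin.
pose Sp e := [set phi | (test_function Om phi /\ sip Om phi phi = 1) /\
  qtest lam phi phi < e].
(* The sets [Sp e] of near-minimizers are nested and nonempty; an ultrafilter finer than the filter
   they generate contains them all. *)
have FF : ProperFilter (filter_from [set e : R | 0 < e] Sp).
  apply: filter_from_proper.
    apply: filter_from_filter; first by exists 1 => /=.
    move=> a b /= a0 b0; exists (Num.min a b); first by rewrite /= lt_min a0.
    by move=> phi [h]; rewrite lt_min => /andP[? ?]; split.
  by move=> e /= e0; have [phi h1 h2] := hmin e e0; exists phi.
have [U [UU FU]] := ultraFilterLemma FF.
have USp e : 0 < e -> U (Sp e) by move=> e0; apply: FU; exists e.
pose B := Num.sqrt (lam + 1).
have hS phi : Sp 1 phi ->
    [/\ test_function Om phi, nrm Om (pdx phi) <= B & nrm Om (pdy phi) <= B].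
  move=> [[tp n1]]; rewrite qtest_energy n1 mulr1 => q1; split => //.
    apply: expr2_le_sqrt; [exact: nrm_ge0|lra|rewrite nrm_sq].
    have := ip_ge0 Om (pdy phi); lra.
  apply: expr2_le_sqrt; [exact: nrm_ge0|lra|rewrite nrm_sq].
  have := ip_ge0 Om (pdx phi); lra.
pose q n : R := 8^-1 ^+ n.
have q0 n : 0 < q n by rewrite exprn_gt0.
(* Gives [(1 + lam) * d n = q n / 4]; with q n / 2 from [qtest_diff] on [Sp (q n / 8)], the total
   stays below q n. *)
pose d n := q n / (4 * (lam + 1)).
have d0 n : 0 < d n by rewrite divr_gt0// mulr_gt0// ltr_wpDl.
have hA n : exists A, [/\ U A, A `<=` Sp (q n / 8) & forall phi psi, A phi -> A psi ->
    sip Om (fun z => phi z - psi z) (fun z => phi z - psi z) <= d n].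
  have [A [UA _ hA]] := rellich oOm bOm UU (USp 1 ltr01) (sqrtr_ge0 _) hS (d0 n).
  exists (A `&` Sp (q n / 8)); split.
  - by apply: filterI => //; apply: USp; rewrite divr_gt0.
  - by move=> phi [].
  - by move=> phi psi [a _] [b _]; exact: hA.
pose A n := projT1 (cid (hA n)).
have UA n : U (A n) by case: (projT2 (cid (hA n))).
have AS n : A n `<=` Sp (q n / 8) by case: (projT2 (cid (hA n))).
have Ad n phi psi : A n phi -> A n psi ->
    sip Om (fun z => phi z - psi z) (fun z => phi z - psi z) <= d n.
  by case: (projT2 (cid (hA n))) => _ _; apply.
(* The sets A n are not nested. Choosing [phi_ n] in two consecutive ones puts [phi_ n] and
   [phi_ n.+1] both in A n, and only consecutive differences matter. *)
have hphi n : A n `&` A n.-1 !=set0.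
  exact: (filter_ex (filterI (UA n) (UA n.-1))).
pose phi_ n := projT1 (cid (hphi n)).
have An n : A n (phi_ n) by case: (projT2 (cid (hphi n))).
have An1 n : A n (phi_ n.+1) by case: (projT2 (cid (hphi n.+1))).
exists phi_; split.
- by move=> n; case: (AS _ _ (An n)).
- move=> n; case: (AS _ _ (An n)) => _ /ltW; rewrite -/(q n); have := q0 n; lra.
move=> n /=; set D := (fun z => phi_ n.+1 z - phi_ n z).
have [[t1 _] e1] := AS _ _ (An n); have [[t2 _] e2] := AS _ _ (An1 n).
have := qtest_diff pos t2 t1; rewrite -/D qtest_energy => h1.
have := Ad _ _ _ (An1 n) (An n); rewrite -/D => h2.
have h3 : (1 + lam) * sip Om D D <= q n / 4.
  rewrite mulrC -ler_pdivlMr; last by rewrite ltr_wpDr.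
  by rewrite -mulrA -invfM (addrC 1); exact: h2.
rewrite -/(q n); move: (q0 n) => q1; lra.
Qed.

Lemma pow4_small (e : R) : 0 < e -> exists m : nat, 4 * 4^-1 ^+ m <= e ^+ 2 /\
  8^-1 ^+ m <= e ^+ 2.
Proof.
move=> e0; have e2 : 0 < e ^+ 2 by rewrite exprn_gt0.
pose m := Num.truncn (4 / e ^+ 2).
have hm : 4 / e ^+ 2 < m.+1%:R by rewrite Num.Theory.truncnS_gt.
have h4 (n : nat) : n.+1%:R <= (4 ^+ n : R).
  elim: n => [|n ih]; first by rewrite expr0.
  rewrite exprS -natr1; have : (1 : R) <= n.+1%:R by rewrite ler1n.
  lra.
have h : 4 * 4^-1 ^+ m <= e ^+ 2.
  rewrite exprVn ler_pdivrMr ?exprn_gt0// mulrC -ler_pdivrMr//.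
  by apply: (le_trans (ltW hm)).
exists m; split => //; apply: le_trans h.
have : 8^-1 ^+ m <= 4^-1 ^+ m :> R
    by rewrite lerXn2r// ?nnegrE ?invr_ge0// lef_pV2 ?posrE// ler_nat.
have : 0 <= 4^-1 ^+ m :> R by rewrite exprn_ge0// invr_ge0.
lra.
Qed.

(** The sequence and its two derivatives converge separately in L^2; closedness of weak derivatives
    puts the limit in H^1_0. The equation is first obtained against test functions, then by density
    against H^1_0. *)
Lemma minimizer_eigenvalue lam : 0 <= lam ->
  (forall psi, test_function Om psi -> 0 <= qtest lam psi psi) ->
  (forall e, 0 < e -> exists2 phi, test_function Om phi /\ sip Om phi phi = 1 &
    qtest lam phi phi < e) ->
  dirichlet_eigenvalue Om lam.
Proof.
move=> lam0 pos hmin.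
have [phi_ [hphi hq hD]] := minimizing_sequence lam0 pos hmin.
have t n : test_function Om (phi_ n) by case: (hphi n).
have s n : smooth (phi_ n) := test_smooth (t n).
have L n : L2 Om (phi_ n) := L2_test oOm bOm (t n).
have Lx n : L2 Om (pdx (phi_ n)) := L2_pdx oOm bOm (t n).
have Ly n : L2 Om (pdy (phi_ n)) := L2_pdy oOm bOm (t n).
have [u Lu hu] : exists2 g, L2 Om g & forall m,
    sip Om (fun z => phi_ m z - g z) (fun z => phi_ m z - g z) <= 4 * 4^-1 ^+ m.
  apply: (L2_complete mOm) => // n; have /= := hD n.
  set D := (fun z => _); have := ip_ge0 Om (pdx D); have := ip_ge0 Om (pdy D).
  move: (sip Om D D) => a; move: (sip Om _ _) => b; move: (sip Om _ _) => c; lra.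
have [ux Lux hux] : exists2 g, L2 Om g & forall m,
    sip Om (fun z => pdx (phi_ m) z - g z) (fun z => pdx (phi_ m) z - g z) <= 4 * 4^-1 ^+ m.
  apply: (L2_complete mOm) => // n; have /= := hD n.
  rewrite -pdxB//.
  set D := (fun z => _); have := ip_ge0 Om D; have := ip_ge0 Om (pdy D).
  move: (sip Om D D) => a; move: (sip Om (pdy D) _) => b; move: (sip Om _ _) => c; lra.
have [uy Luy huy] : exists2 g, L2 Om g & forall m,
    sip Om (fun z => pdy (phi_ m) z - g z) (fun z => pdy (phi_ m) z - g z) <= 4 * 4^-1 ^+ m.
  apply: (L2_complete mOm) => // n; have /= := hD n.
  rewrite -pdyB//.
  set D := (fun z => _); have := ip_ge0 Om D; have := ip_ge0 Om (pdx D).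
  move: (sip Om D D) => a; move: (sip Om (pdx D) _) => b; move: (sip Om _ _) => c; lra.
have small f g e m : 0 <= e -> sip Om (fun z => f z - g z) (fun z => f z - g z) <= 4 * 4^-1 ^+ m ->
    4 * 4^-1 ^+ m <= e ^+ 2 -> nrm Om (fun z => g z - f z) <= e.
  move=> e0 h1 h2; rewrite nrm_distC -ler_sqr ?nnegrE ?nrm_ge0// nrm_sq.
  exact: le_trans h1 h2.
have [Hu wux wuy] : [/\ H10 Om u, weak_dx Om u ux & weak_dy Om u uy].
  apply: (H10_of_approx oOm bOm) => // e e0.
  have e2 : 0 < e / 2 by rewrite divr_gt0.
  have [m [m1 _]] := pow4_small e2; exists (phi_ m).
  have ee : e / 2 < e by lra.
  split => //; apply: le_lt_trans ee.
  - exact: small (ltW e2) (hu m) m1.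
  - exact: small (ltW e2) (hux m) m1.
  - exact: small (ltW e2) (huy m) m1.
have eqt w : test_function Om w -> qform lam u ux uy w (pdx w) (pdy w) = 0.
  move=> tw; have Lw := L2_test oOm bOm tw; have Lwx := L2_pdx oOm bOm tw.
  have Lwy := L2_pdy oOm bOm tw.
  apply: qform_eq0 => // e e0.
  pose c := qtest lam w w; have c0 : 0 <= c by exact: pos.
  (* For [qtest] of [phi_ m] at most d^2, Cauchy-Schwarz gives [c * d ^+ 2 <= e ^+ 2]. *)
  pose d := e / (c + 1).
  have d0 : 0 < d by rewrite divr_gt0// ltr_wpDl.
  have de : d <= e.
    by rewrite ler_pdivrMr ?ltr_wpDl// ler_peMr ?(ltW e0)// lerDr.
  have [m [m1 m2]] := pow4_small d0.
  exists (phi_ m), (pdx (phi_ m)), (pdy (phi_ m)); split; first by split.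
  split.
  - exact: le_trans (small _ _ _ _ (ltW d0) (hu m) m1) de.
  - exact: le_trans (small _ _ _ _ (ltW d0) (hux m) m1) de.
  - exact: le_trans (small _ _ _ _ (ltW d0) (huy m) m1) de.
  have := qtest_cauchy_schwarz pos tw (t m); rewrite -/c => hcs.
  rewrite -ler_sqr ?nnegrE ?(ltW e0)// real_normK ?num_real//.
  apply: (le_trans hcs).
  apply: (@le_trans _ _ (c * d ^+ 2)).
    by rewrite ler_wpM2l//; exact: le_trans (hq m) m2.
  rewrite /d expr_div_n mulrA ler_pdivrMr ?exprn_gt0 ?ltr_wpDl// mulrC.
  by rewrite ler_wpM2l ?sqr_ge0//; nra.
exists u; split => //.
  (* The limit is not 0: it is within 1/2 of a function of norm 1. *)
  have [m [m1 _]] := pow4_small (e := 1 / 2) ltac:(lra).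
  apply/negP => /eqP n0.
  have n0' : nrm Om u = 0 by rewrite nrm.unlock.
  have h1 : nrm Om (fun z => u z - phi_ m z) <= 1 / 2.
    by apply: (small _ _ _ _ _ (hu m) m1); lra.
  rewrite nrm_distC in h1.
  have := nrmD mOm (L2B mOm (L m) Lu) Lu.
  have -> : (fun z => phi_ m z - u z + u z) = phi_ m.
    by apply/funext => z; rewrite subrK.
  have -> : nrm Om (phi_ m) = 1 by rewrite nrmE (hphi m).2 sqrtr1.
  rewrite n0'; move: h1; move: (nrm Om _) => a; lra.
move=> w Hw; have [[Lw /dx_spec wx /dy_spec wy] _] := Hw.
have Lwx := wx.1; have Lwy := wy.1.
have key : qform lam u ux uy w (sdx Om w) (sdy Om w) = 0.
  have qC a ax ay b bx by' : qform lam a ax ay b bx by' = qform lam b bx by' a ax ay.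
    by rewrite /qform (ipC _ a b) (ipC _ ax bx) (ipC _ ay by').
  rewrite qC; apply: qform_eq0 => // e e0.
  have [phi [tp h1 h2 h3]] := H10_approx oOm bOm Hw e0.
  exists phi, (pdx phi), (pdy phi); split.
    by split; [exact: L2_test|exact: L2_pdx|exact: L2_pdy].
  split; [exact: ltW|exact: ltW|exact: ltW|].
  by rewrite qC eqt// normr0 ltW.
have e1 := ip_ae mOm (L2_sdx wux) Lux Lwx Lwx (dx_ae oOm bOm wux) (ae_eq_on_refl _ _).
have e2 := ip_ae mOm (L2_sdy wuy) Luy Lwy Lwy (dy_ae oOm bOm wuy) (ae_eq_on_refl _ _).
have : sip Om (sdx Om u) (sdx Om w) + sip Om (sdy Om u) (sdy Om w) = lam * sip Om u w.
  by rewrite e1 e2; apply/eqP; rewrite -subr_eq0; apply/eqP; exact: key.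
by rewrite sip.unlock sdx.unlock sdy.unlock.
Qed.

Theorem poincare_test lam1 : min_dirichlet_eigenvalue Om lam1 ->
  forall w, test_function Om w -> lam1 * sip Om w w <=
    sip Om (pdx w) (pdx w) + sip Om (pdy w) (pdy w).
Proof.
move=> [_ hmin] w tw; rewrite leNgt; apply/negP => hlt.
pose E phi := sip Om (pdx phi) (pdx phi) + sip Om (pdy phi) (pdy phi).
have E0 phi : 0 <= E phi by rewrite addr_ge0// ip_ge0.
pose V := [set phi | test_function Om phi /\ sip Om phi phi = 1].
have normalize phi : test_function Om phi -> 0 < sip Om phi phi -> exists2 psi, V psi &
    E psi = E phi / sip Om phi phi.
  move=> tp p0; pose c := (Num.sqrt (sip Om phi phi))^-1.
  have c2 : c ^+ 2 = (sip Om phi phi)^-1 by rewrite exprVn sqr_sqrtr// ltW.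
  exists (fun z => c * phi z).
    split; first exact: test_scale.
    have Lp := L2_test oOm bOm tp.
    by rewrite ipZl ?ipZr//; [rewrite mulrA -expr2 c2 mulVf ?gt_eqF|exact: L2Z].
  have := qtest_scale 0 c tp; rewrite !qtest_energy !mul0r !subr0 => h.
  by rewrite /E h c2 mulrC.
have w0 : 0 < sip Om w w.
  rewrite lt_neqAle ip_ge0 andbT; apply/negP => /eqP w0.
  by have := E0 w; rewrite leNgt -w0 mulr0 in hlt *; rewrite hlt.
have [psi Vpsi Epsi] := normalize w tw w0.
have hinf : has_inf (E @` V) by split; [exists (E psi), psi|exists 0 => _ [? _ <-]].
pose lam := inf (E @` V).
have lam0 : 0 <= lam by apply: lb_le_inf; [case: hinf|move=> _ [? _ <-]].
have lamE phi : V phi -> lam <= E phi.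
  by move=> h; apply: ge_inf; [case: hinf|exists phi].
have pos phi : test_function Om phi -> 0 <= qtest lam phi phi.
  move=> tp; rewrite qtest_energy -/(E phi) subr_ge0.
  have [p0|p0] := leP (sip Om phi phi) 0.
    have -> : sip Om phi phi = 0 by apply/eqP; rewrite eq_le p0 ip_ge0.
    by rewrite mulr0.
  by have [chi /lamE h1 h2] := normalize _ tp p0; rewrite -ler_pdivlMr// -h2.
suff : lam1 <= lam.
  apply/negP; rewrite -ltNge; apply: (le_lt_trans (lamE _ Vpsi)).
  by rewrite Epsi ltr_pdivrMr.
apply: hmin; apply: minimizer_eigenvalue => // e e0.
have [_ [phi Vp <-] hp] := inf_adherent e0 hinf.
exists phi => //; rewrite qtest_energy Vp.2 mulr1 -/(E phi) ltrBlDl.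
exact: hp.
Qed.

End poincare.

(** * Energy estimate *)

Section energy.
Context {R : realType} (Om : set (R * R)).
Implicit Types (u v w g phi psi : R * R -> R) (z p : R * R) (e : R).
Hypothesis oOm : open Om.
Hypothesis bOm : bounded_set Om.

Let mOm : measurable (Om : set (measurableTypeR R * measurableTypeR R)).
Proof. exact: open_measurable2. Qed.

Definition slap u : R * R -> R :=
  fun z => sdx Om (sdx Om u) z + sdy Om (sdy Om u) z.

Lemma slapE u : slap u = lap Om u.
Proof. by rewrite /slap sdx.unlock sdy.unlock. Qed.

Definition energy u : R :=
  sip Om (sdx Om u) (sdx Om u) + sip Om (sdy Om u) (sdy Om u).

Lemma grad_ipE u v : grad_ip Om u v =
  sip Om (sdx Om u) (sdx Om v) + sip Om (sdy Om u) (sdy Om v).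
Proof. by rewrite sdx.unlock sdy.unlock sip.unlock. Qed.

Lemma energyE u : energy u = grad_ip Om u u.
Proof. by rewrite /energy sdx.unlock sdy.unlock sip.unlock. Qed.

Lemma energy_ge0 u : 0 <= energy u.
Proof. by rewrite addr_ge0// ip_ge0. Qed.

Lemma le_of_small (a b K : R) : 0 <= K ->
  (forall e, 0 < e -> e <= 1 -> a <= b + K * e) -> a <= b.
Proof.
move=> K0 h; apply/ler_addgt0Pl => e e0.
pose d := Num.min 1 (e / (K + 1)).
have d0 : 0 < d by rewrite lt_min ltr01 divr_gt0// ltr_wpDl.
have d1 : d <= 1 by rewrite ge_min lexx.
apply: (le_trans (h d d0 d1)); rewrite addrC lerD2r.
apply: (@le_trans _ _ (K * (e / (K + 1)))).
  by rewrite ler_wpM2l// ge_min lexx orbT.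
rewrite mulrA ler_pdivrMr; last by rewrite ltr_wpDl.
by rewrite mulrC ler_pM2l// lerDl.
Qed.

(** For the norms x and y, |x^2 - y^2| <= e (2 x + e), and e <= 1 makes the constant depend on the
    fixed function [a] alone. *)
Lemma nrm_sq_close a b e : L2 Om a -> L2 Om b -> 0 < e -> e <= 1 ->
  nrm Om (fun z => a z - b z) <= e ->
  `|sip Om a a - sip Om b b| <= (2 * nrm Om a + 1) * e.
Proof.
move=> La Lb e0 e1 ab; rewrite -!nrm_sq.
have h1 := nrmD mOm (L2B mOm La Lb) Lb.
have E1 : (fun z => a z - b z + b z) = a by apply/funext => z; rewrite subrK.
rewrite E1 in h1.
have ba : nrm Om (fun z => b z - a z) <= e by rewrite nrm_distC.
have h2 := nrmD mOm (L2B mOm Lb La) La.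
have E2 : (fun z => b z - a z + a z) = b by apply/funext => z; rewrite subrK.
rewrite E2 in h2.
have := nrm_ge0 Om a; have := nrm_ge0 Om b.
move: (nrm Om a) (nrm Om b) (nrm Om _) (nrm Om _) ab ba h1 h2 => x y s t *.
rewrite ler_norml; apply/andP; split; nra.
Qed.

(** Let N, E, D be the squared norms of phi, its gradient and its Laplacian. Integration by parts
    and Cauchy-Schwarz give E^2 <= D N, and lam1 N <= E turns this into lam1 E^2 <= D E. *)
Lemma test_energy_le (lam1 : R) phi : 0 < lam1 -> test_function Om phi ->
  lam1 * sip Om phi phi <= sip Om (pdx phi) (pdx phi) + sip Om (pdy phi) (pdy phi) ->
  lam1 * (sip Om (pdx phi) (pdx phi) + sip Om (pdy phi) (pdy phi)) <=
  sip Om (fun z => pdx (pdx phi) z + pdy (pdy phi) z)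
         (fun z => pdx (pdx phi) z + pdy (pdy phi) z).
Proof.
move=> l0 tp hp; have sp := test_smooth tp.
have tx := test_pdx tp; have ty := test_pdy tp.
have L0 := L2_test oOm bOm tp.
have Lxx := L2_pdx oOm bOm tx; have Lyy := L2_pdy oOm bOm ty.
have hE : sip Om (pdx phi) (pdx phi) + sip Om (pdy phi) (pdy phi) =
    - sip Om (fun z => pdx (pdx phi) z + pdy (pdy phi) z) phi.
  rewrite (ipDl mOm Lxx Lyy L0) (ibp_x oOm bOm tp (smooth_pdx sp)).
  by rewrite (ibp_y oOm bOm tp (smooth_pdy sp)) opprD.
have := cauchy_schwarz mOm (L2D mOm Lxx Lyy) L0.
rewrite -sqrrN -hE.
have := ip_ge0 Om (fun z => pdx (pdx phi) z + pdy (pdy phi) z).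
have := addr_ge0 (ip_ge0 Om (pdx phi)) (ip_ge0 Om (pdy phi)).
move: hp (ip_ge0 Om phi) => {hE}.
move: (sip Om _ _ + sip Om _ _) (sip Om phi phi) (sip Om _ _) => E N D hp N0 E0 D0 h.
have [E1|E1] := ltP 0 E; last by nra.
rewrite -(ler_pM2r E1); nra.
Qed.

Let perturbed_le (l e x1 x2 x3 a1 a2 a3 b1 b2 b3 : R) : 0 < l ->
  `|a1 - b1| <= x1 * e -> `|a2 - b2| <= x2 * e -> `|a3 - b3| <= x3 * e ->
  l * (b1 + b2) <= b3 -> l * (a1 + a2) <= a3 + (l * (x1 + x2) + x3) * e.
Proof.
move=> l0; rewrite !ler_norml => /andP[_ h1] /andP[_ h2] /andP[h3 _] h.
have : l * (a1 + a2 - (b1 + b2)) <= l * ((x1 + x2) * e).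
  by rewrite ler_pM2l//; lra.
lra.
Qed.

Lemma energy_le_lap (lam1 : R) u : 0 < lam1 -> min_dirichlet_eigenvalue Om lam1 ->
  H20 Om u -> lam1 * energy u <= sip Om (slap u) (slap u).
Proof.
move=> l0 hl hu; have [Lu wx wy [wxx wxy wyx wyy]] := H20_spec hu.
have Lx := L2_sdx wx; have Ly := L2_sdy wy.
have Lxx := L2_sdx wxx; have Lyy := L2_sdy wyy.
have LD := L2D mOm Lxx Lyy.
pose K := lam1 * (2 * nrm Om (sdx Om u) + 1 + (2 * nrm Om (sdy Om u) + 1))
  + (2 * nrm Om (slap u) + 1).
have p x : 0 <= 2 * nrm Om x + 1 by rewrite addr_ge0// mulr_ge0// nrm_ge0.
apply: (@le_of_small _ _ K); first by rewrite addr_ge0// mulr_ge0 ?(ltW l0)// addr_ge0.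
(* Each of the two second derivatives in the Laplacian receives half of e. *)
move=> e e0 e1; have e2 : 0 < e / 2 by rewrite divr_gt0.
have e3 : e / 2 + e / 2 <= e by rewrite -splitr.
have ee : e / 2 <= e by rewrite ler_pdivrMr// ler_peMr ?(ltW e0)// ler1n.
have [phi [tp _ [h1 h2] [h3 h4]]] := H20_approx oOm bOm hu e2.
have tx := test_pdx tp; have ty := test_pdy tp.
have Ltxx := L2_pdx oOm bOm tx; have Ltyy := L2_pdy oOm bOm ty.
have c1 := nrm_sq_close Lx (L2_pdx oOm bOm tp) e0 e1 (le_trans (ltW h1) ee).
have c2 := nrm_sq_close Ly (L2_pdy oOm bOm tp) e0 e1 (le_trans (ltW h2) ee).
have h5 : nrm Om (fun z => slap u z - (pdx (pdx phi) z + pdy (pdy phi) z)) <= e.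
  have -> : (fun z => slap u z - (pdx (pdx phi) z + pdy (pdy phi) z)) =
      (fun z => (sdx Om (sdx Om u) z - pdx (pdx phi) z) +
                (sdy Om (sdy Om u) z - pdy (pdy phi) z)).
    by apply/funext => z; rewrite /slap; ring.
  apply: (le_trans (nrmD mOm (L2B mOm Lxx Ltxx) (L2B mOm Lyy Ltyy))).
  exact: (le_trans (lerD (ltW h3) (ltW h4)) e3).
have c3 := nrm_sq_close LD (L2D mOm Ltxx Ltyy) e0 e1 h5.
have := test_energy_le l0 tp (poincare_test oOm bOm hl tp).
exact: (perturbed_le l0 c1 c2 c3).
Qed.

Lemma Hm2norm_ub F : Hm2 Om F -> forall u, H20 Om u ->
  `|F u| <= Hm2norm Om F * nrm Om (slap u).
Proof.
move=> [_ [C hC]] u hu; rewrite slapE nrm.unlock.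
(* The supremum leaves out such u; there the bound in [Hm2] forces [F u = 0]. *)
have [n0|n0] := eqVneq (L2norm Om (lap Om u)) 0.
  by have := hC u hu; rewrite n0 !mulr0.
have npos : 0 < L2norm Om (lap Om u) by rewrite lt_neqAle eq_sym n0 sqrtr_ge0.
rewrite -ler_pdivrMr//; apply: ub_le_sup; last by exists u.
exists C => _ [v [hv v0] <-]; rewrite ler_pdivrMr; first exact: hC.
by rewrite lt_neqAle eq_sym v0 sqrtr_ge0.
Qed.

(** Makes the limiting energy strictly smaller than the squared radius, which leaves room for the
    transient. *)
Lemma Hm2norm_gt0 F : Hm2 Om F -> Hm2_nonzero Om F -> 0 < Hm2norm Om F.
Proof.
move=> hF [u hu Fu]; have := Hm2norm_ub hF hu.
have : 0 < `|F u| by rewrite normr_gt0.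
have := nrm_ge0 Om (slap u).
move: (nrm Om _) (Hm2norm _ _) `|F u| => a b c a0 c0 h.
rewrite ltNge; apply/negP => b0; nra.
Qed.

Lemma weak_diff u0 u1 (dt : R) : H20 Om u0 -> H20 Om u1 ->
  weak_dx Om (fun z => (u1 z - u0 z) / dt)
    (fun z => dt^-1 * (sdx Om u1 z - sdx Om u0 z)) /\
  weak_dy Om (fun z => (u1 z - u0 z) / dt)
    (fun z => dt^-1 * (sdy Om u1 z - sdy Om u0 z)).
Proof.
move=> h0 h1; have [L0 x0 y0 _] := H20_spec h0; have [L1 x1 y1 _] := H20_spec h1.
have px := partial_op_x oOm bOm; have py := partial_op_y oOm bOm.
have E (f g : R * R -> R) : (fun z => (f z - g z) / dt) =
    lincomb dt^-1 (fun z => f z - g z) (cst 0).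
  by apply/funext => z; rewrite /lincomb addr0 mulrC.
have E' (f g : R * R -> R) : (fun z => dt^-1 * (f z - g z)) =
    lincomb dt^-1 (fun z => f z - g z) (cst 0).
  by apply/funext => z; rewrite /lincomb addr0.
rewrite E !E'; move: x0 x1 y0 y1; rewrite !weak_dxE !weak_dyE => x0 x1 y0 y1.
have s0 : smooth (cst (0 : R) : R * R -> R) by exact: smooth_cst.
have := weak_dx_smooth oOm bOm s0; have := weak_dy_smooth oOm bOm s0.
rewrite pdx_cst pdy_cst weak_dxE weak_dyE => zy zx.
have LB := L2B mOm L1 L0; have LZ := L2_cst0 Om.
have Bx := weak_pdB oOm bOm px L1 L0 x1 x0; have By := weak_pdB oOm bOm py L1 L0 y1 y0.
split; first exact: (weak_pd_lincomb oOm bOm px dt^-1 LB LZ Bx zx).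
exact: (weak_pd_lincomb oOm bOm py dt^-1 LB LZ By zy).
Qed.

(** Here c is the product of the two gradients, and n is the norm of the new Laplacian. After
    doubling the tested equation, Young's inequality 2 |mu| Fn n <= nu n^2 + mu^2 Fn^2 / nu absorbs
    one of the two copies of nu n^2. *)
Let energy_arith (nu mu dt Fn Fu n D E0 E1 c : R) : 0 < nu -> 0 < dt ->
  n ^+ 2 = D -> `|Fu| <= Fn * n -> 2 * c <= E0 + E1 ->
  dt^-1 * (E1 - c) + nu * D = mu * Fu ->
  E1 + nu * dt * D <= E0 + dt * (mu ^+ 2 * Fn ^+ 2 / nu).
Proof.
move=> nu0 dt0 <- hF hc h.
have h1 : E1 - c + nu * dt * n ^+ 2 = dt * (mu * Fu).
  by rewrite -h mulrDr mulVKf ?gt_eqF//; ring.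
have h2 : mu * Fu <= `|mu| * (Fn * n).
  by apply: (le_trans (ler_norm _)); rewrite normrM ler_wpM2l.
have h3 : 2 * (mu * Fu) <= nu * n ^+ 2 + mu ^+ 2 * Fn ^+ 2 / nu.
  apply: (@le_trans _ _ (2 * (`|mu| * (Fn * n)))); first by lra.
  rewrite -lerBlDl ler_pdivlMr//.
  have -> : mu ^+ 2 = `|mu| ^+ 2 by rewrite real_normK// num_real.
  have := sqr_ge0 (nu * n - `|mu| * Fn); nra.
have h4 : 2 * (dt * (mu * Fu)) <= dt * (nu * n ^+ 2 + mu ^+ 2 * Fn ^+ 2 / nu).
  by rewrite mulrCA ler_pM2l.
lra.
Qed.

Let cross0 (a b : R * R -> R) : (fun z => a z * b z - b z * a z) = cst 0.
Proof. by apply/funext => z; rewrite mulrC subrr. Qed.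

Lemma energy_step (nu mu dt Fn Fu : R) u0 u1 : 0 < nu -> 0 < dt ->
  H20 Om u0 -> H20 Om u1 -> `|Fu| <= Fn * nrm Om (slap u1) ->
  grad_ip Om (fun z => (u1 z - u0 z) / dt) u1 + nu * form_a Om u1 u1
    + form_b Om u1 u1 u1 + mu * form_b0 Om u1 u1 = mu * Fu ->
  energy u1 + nu * dt * sip Om (slap u1) (slap u1) <=
  energy u0 + dt * (mu ^+ 2 * Fn ^+ 2 / nu).
Proof.
move=> nu0 dt0 h0 h1 hFu.
have [L0 x0 y0 _] := H20_spec h0; have [L1 x1 y1 _] := H20_spec h1.
have Lx0 := L2_sdx x0; have Ly0 := L2_sdy y0.
have Lx1 := L2_sdx x1; have Ly1 := L2_sdy y1.
have -> : form_b Om u1 u1 u1 = 0.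
  by rewrite /form_b cross0 -sipE ipC ip0l.
have -> : form_b0 Om u1 u1 = 0 by rewrite /form_b0 -!sipE (ipC _ u1) subrr mulr0.
have -> : form_a Om u1 u1 = sip Om (slap u1) (slap u1) by rewrite /form_a -sipE slapE.
have [wx wy] := weak_diff dt h0 h1.
have -> : grad_ip Om (fun z => (u1 z - u0 z) / dt) u1 =
    dt^-1 * (energy u1 - (sip Om (sdx Om u0) (sdx Om u1) + sip Om (sdy Om u0) (sdy Om u1))).
  have LX := L2B mOm Lx1 Lx0; have LY := L2B mOm Ly1 Ly0.
  have ex := ip_ae mOm (L2_sdx wx) wx.1 Lx1 Lx1 (dx_ae oOm bOm wx) (ae_eq_on_refl _ _).
  have ey := ip_ae mOm (L2_sdy wy) wy.1 Ly1 Ly1 (dy_ae oOm bOm wy) (ae_eq_on_refl _ _).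
  rewrite grad_ipE ex ey (ipZl mOm _ LX Lx1) (ipZl mOm _ LY Ly1).
  rewrite (ipBl mOm Lx1 Lx0 Lx1) (ipBl mOm Ly1 Ly0 Ly1) /energy; ring.
have hx := ip_ge0 Om (fun z => sdx Om u1 z - sdx Om u0 z).
have hy := ip_ge0 Om (fun z => sdy Om u1 z - sdy Om u0 z).
rewrite ip_sqB// (ipC _ (sdx Om u1)) in hx; rewrite ip_sqB// (ipC _ (sdy Om u1)) in hy.
rewrite mulr0 !addr0 /energy => h.
apply: (energy_arith nu0 dt0 (nrm_sq Om (slap u1)) hFu _ h).
move: hx hy; move: (sip Om (sdx Om u1) (sdx Om u1)) (sip Om (sdy Om u1) (sdy Om u1)).
move: (sip Om (sdx Om u0) _) (sip Om (sdx Om u0) _) (sip Om (sdy Om u0) _) (sip Om (sdy Om u0) _).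
clear; move=> a b c d e1 e2; lra.
Qed.

(** The value d / (c - 1) is the fixed point of x -> (x + d) / c, and each step divides the excess
    over it by c. *)
Lemma geometric_decay (c K d : R) (E : nat -> R) : 1 < c ->
  (forall n, c * E n.+1 <= E n + d) -> E 0%N <= K -> 0 <= d ->
  forall n, E n <= K / c ^+ n + d / (c - 1).
Proof.
move=> c1 hE E0 d0; have c0 : 0 < c by lra.
have c10 : 0 < c - 1 by lra.
elim=> [|n ih]; first by rewrite expr0 divr1 ler_wpDr// divr_ge0// ltW.
rewrite -(ler_pM2l c0); apply: (le_trans (hE n)).
apply: (le_trans (lerD ih (lexx d))).
rewrite exprS mulrDr invfM (mulrCA K) mulVKf ?gt_eqF// -addrA lerD2l.
rewrite le_eqVlt; apply/orP; left; apply/eqP.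
by rewrite -{2}(mulfVK (lt0r_neq0 c10) d); ring.
Qed.

Lemma expr_unbounded (c K d : R) : 1 < c -> 0 < d -> exists n0 : nat,
  forall n, (n0 <= n)%N -> K / c ^+ n <= d.
Proof.
move=> c1 d0; have c0 : 0 < c by lra.
pose n0 := Num.truncn (K / d / (c - 1)); exists n0.+1 => n n0n.
(* Bernoulli's inequality. *)
have bern k : 1 + k%:R * (c - 1) <= c ^+ k.
  elim: k => [|k ih]; first by rewrite mul0r addr0 expr0.
  rewrite exprS -natr1; apply: (@le_trans _ _ (c * (1 + k%:R * (c - 1)))).
    have : 0 <= k%:R * (c - 1) ^+ 2 by rewrite mulr_ge0 ?sqr_ge0.
    lra.
  by rewrite ler_pM2l.
rewrite ler_pdivrMr ?exprn_gt0// mulrC -ler_pdivrMr//.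
apply: (le_trans _ (bern n)); apply: (@le_trans _ _ (n%:R * (c - 1))); last by lra.
rewrite -ler_pdivrMr; last by lra.
apply: (@le_trans _ _ n0.+1%:R); last by rewrite ler_nat.
by rewrite ltW// Num.Theory.truncnS_gt.
Qed.

Lemma absorbing_ball (S0 : set (R * R -> R)) (nu mu lam1 alpha dt : R)
    (F : (R * R -> R) -> R) (SN : nat -> (R * R -> R) -> (R * R -> R)) :
  S0 `<=` H20 Om -> 0 < nu -> 0 < mu -> min_dirichlet_eigenvalue Om lam1 ->
  Hm2 Om F -> Hm2_nonzero Om F -> 0 < alpha -> alpha < nu * lam1 / 4 -> 0 < dt ->
  solution_operator Om S0 nu mu dt F SN ->
  exists rho0 : R, [/\ 0 <= rho0,
    rho0 ^+ 2 = mu ^+ 2 * expR (2 * alpha * dt) / (alpha * nu) * Hm2norm Om F ^+ 2 &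
    bounded_absorbing_set Om S0 dt SN (fe_ball Om S0 rho0)].
Proof.
move=> S0H nu0 mu0 hl hF hF0 a0 al dt0 hSN.
have l0 : 0 < lam1 by rewrite -(pmulr_rgt0 _ nu0); lra.
pose r2 := mu ^+ 2 * expR (2 * alpha * dt) / (alpha * nu) * Hm2norm Om F ^+ 2.
have N0 := Hm2norm_gt0 hF hF0.
have r20 : 0 <= r2.
  by rewrite /r2 mulr_ge0 ?sqr_ge0// divr_ge0 ?mulr_ge0 ?sqr_ge0 ?expR_ge0// ltW.
exists (Num.sqrt r2); split; [exact: sqrtr_ge0|exact: sqr_sqrtr|].
split; first by move=> v [].
  by exists (Num.sqrt r2) => v [].
(* The dissipation [nu * dt * |lap u|^2] left by [energy_step] is at least [nu * dt * lam1] times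
   the energy, whence the growth factor c on the left. *)
move=> rho rho0; pose c := 1 + nu * dt * lam1.
have c1 : 1 < c by rewrite ltrDl !mulr_gt0.
pose d := dt * (mu ^+ 2 * Hm2norm Om F ^+ 2 / nu).
have d0 : 0 <= d.
  by rewrite mulr_ge0 ?(ltW dt0)// divr_ge0 ?(ltW nu0)// mulr_ge0 ?sqr_ge0.
have gap : d / (c - 1) < r2.
  have -> : d / (c - 1) = mu ^+ 2 * Hm2norm Om F ^+ 2 / (nu * (nu * lam1)).
    rewrite /d /c; field; rewrite !gt_eqF//.
    by have := mulr_gt0 (mulr_gt0 nu0 dt0) l0; lra.
  apply: (@lt_le_trans _ _ (mu ^+ 2 * Hm2norm Om F ^+ 2 / (nu * alpha))).
    rewrite ltr_pM2l; last by rewrite mulr_gt0// exprn_gt0.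
    rewrite ltf_pV2 ?posrE ?mulr_gt0// ltr_pM2l//.
    have := mulr_gt0 nu0 l0; lra.
  have -> : r2 = mu ^+ 2 * Hm2norm Om F ^+ 2 / (nu * alpha) * expR (2 * alpha * dt).
    by rewrite /r2; field; rewrite !gt_eqF.
  rewrite ler_peMr ?divr_ge0 ?mulr_ge0 ?sqr_ge0 ?(ltW nu0) ?(ltW a0) ?(ltW mu0) ?(ltW N0)//.
  by rewrite -expR0 ler_expR !mulr_ge0// ltW.
(* From n0 on the transient [rho ^+ 2 / c ^+ n] fits into the gap. The successor taken next makes
   the absorbing time positive. *)
have [n0 hn0] := expr_unbounded (rho ^+ 2) c1 (d := r2 - d / (c - 1)) ltac:(lra).
exists n0.+1; split; first by rewrite /time mulr_gt0.
move=> N hN _ [Psi [SPsi PsiR] <-].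
have [E0 step] := hSN Psi SPsi.
have nN : (n0 <= N)%N.
  by move: hN; rewrite /time ler_pM2r// ler_nat => /ltnW.
have SS n : S0 (SN n Psi) by case: n => [|n]; [rewrite E0|case: (step n)].
split; first exact: SS.
rewrite /grad_norm -energyE ler_sqrt//.
have hE n : c * energy (SN n.+1 Psi) <= energy (SN n Psi) + d.
  have [S1 hc] := step n.
  have := energy_step nu0 dt0 (S0H _ (SS n)) (S0H _ S1) (Hm2norm_ub hF (S0H _ S1)) (hc _ S1).
  have := energy_le_lap l0 hl (S0H _ S1).
  rewrite -(ler_pM2l (mulr_gt0 nu0 dt0)) -/d /c.
  move: (energy _) (energy _) (sip Om _ _) => e1 e0 D h1 h2; lra.
have := @geometric_decay c (rho ^+ 2) d (fun n => energy (SN n Psi)) c1 hE _ d0 N.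
move=> /(_ _)/le_trans; apply; last by have := hn0 N nN; lra.
rewrite E0 energyE; move: PsiR; rewrite /grad_norm => h.
by rewrite -[leLHS]sqr_sqrtr -?energyE ?energy_ge0//
  ler_sqr ?nnegrE ?sqrtr_ge0 ?(ltW rho0)// energyE.
Qed.

End energy.

(** * Piecewise smooth functions in H^2_0 *)

(** Neither continuity of f nor connectedness of the sets is assumed. From [a], in C k, one jumps to
    the last point of C k in [a, b], which belongs to C k by closedness; beyond it C k is absent, so
    induction on the number of sets covers the rest. *)
Lemma cover_lipschitz {R : realType} (I : finType) (C : I -> set R) (f : R -> R)
    (L a b : R) (D : {set I}) : 0 <= L -> (forall i, closed (C i)) -> a <= b ->
  (forall t, a <= t <= b -> exists2 i, i \in D & C i t) ->
  (forall i t t', C i t -> C i t' -> a <= t -> t <= t' -> t' <= b ->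
     `|f t' - f t| <= L * (t' - t)) ->
  `|f b - f a| <= L * (b - a).
Proof.
move=> L0 cC; have [n] := ubnP #|D|; elim: n => // n ih in D a *.
rewrite ltnS => Dn ab cov hf.
have [|k kD Ca] := cov a; first by rewrite lexx.
pose E := C k `&` `[a, b]%classic.
have Ea : E a by split => //=; rewrite in_itv/= lexx.
have hE : has_sup E by split; [exists a|exists b => t [_]; rewrite /= in_itv/= => /andP[]].
have cE : closed E by apply: closedI => //; exact: interval_closed.
have Eq : E (sup E).
  by apply: cE; apply: closure_sup; [exists a|case: hE].
move: (Eq) => [Cq]; rewrite /= in_itv/= => /andP[aq qb].
have h1 := hf k a (sup E) Ca Cq (lexx a) aq qb.
have [q_b|q_b] := eqVneq (sup E) b; first by rewrite q_b in h1.
have qb' : sup E < b by rewrite lt_neqAle q_b.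
have out t : sup E < t -> t <= b -> ~ C k t.
  move=> qt tb Ct; suff : t <= sup E by rewrite leNgt qt.
  apply: ub_le_sup; first by case: hE.
  by split => //=; rewrite in_itv/= tb andbT (le_trans aq (ltW qt)).
(* At sup E itself: if no other set contained it, these finitely many closed sets would all miss a
   neighbourhood, whose points to the right of sup E are not in C k either. *)
have cov' t : sup E <= t <= b -> exists2 i, i \in D :\ k & C i t.
  move=> /andP[]; rewrite le_eqVlt => /orP[/eqP <- _|qt tb]; last first.
    have [|i iD Ci] := cov t; first by rewrite tb (le_trans aq (ltW qt)).
    exists i => //; rewrite !inE iD andbT; apply/eqP => ik.
    by apply: (out _ qt tb); rewrite -ik.
  apply: contrapT => no.
  have nb : \forall t \near sup E, forall i, i \in D :\ k -> ~ C i t.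
    apply: (@filter_forall _ _ (fun i t => i \in D :\ k -> ~ C i t)
      (nbhs (sup E))) => i; case: (boolP (i \in D :\ k)) => iD; last first.
      by apply: nearW.
    have : nbhs (sup E) (~` C i).
      apply: open_nbhs_nbhs; split; first exact: closed_openC.
      by move=> Ci; apply: no; exists i.
    by apply: filterS => s ns _.
  have [e /= e0 he] := nb.
  pose s := sup E + Num.min (e / 2) (b - sup E).
  have m0 : 0 < Num.min (e / 2) (b - sup E) by rewrite lt_min divr_gt0// subr_gt0.
  have qs : sup E < s by rewrite ltrDl.
  have sb : s <= b.
    by rewrite /s -lerBrDl ge_min lexx orbT.
  have [|i iD Ci] := cov s; first by rewrite sb (le_trans aq (ltW qs)).
  apply: (he s _ i _ Ci) => /=.
    rewrite /s opprD addNKr normrN gtr0_norm// gt_min; apply/orP; left.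
    by rewrite ltr_pdivrMr// ltr_pMr// ltr1n.
  rewrite !inE iD andbT; apply/eqP => ik.
  by apply: (out _ qs sb); rewrite -ik.
have h2 : `|f b - f (sup E)| <= L * (b - sup E).
  apply: (ih (D :\ k)) => //.
    by move: Dn; rewrite (cardsD1 k D) kD.
  by move=> i t t' h h' qt; exact: (hf i t t' h h' (le_trans aq qt)).
have -> : f b - f a = (f b - f (sup E)) + (f (sup E) - f a) by ring.
apply: (le_trans (ler_normD _ _)); apply: (le_trans (lerD h2 h1)).
by rewrite -mulrDr; apply: ler_wpM2l => //; lra.
Qed.

(** * Lipschitz and Taylor estimates across cells *)

Section piecewise_smooth.
Context {R : realType} (I : finType).
Implicit Types (z p : R * R).

(** The intermediate point stays in C, where g is known, but C need not be an interval: off the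
    domain both f and g are 0. *)
Definition mean_value (C : R -> Prop) (f g : R -> R) := forall t t', C t -> C t' ->
  t <= t' -> exists x, [/\ C x, t <= x, x <= t' & f t' - f t = g x * (t' - t)].

(** Subtracting the slope g c leaves a function which is Lipschitz on each set with constant L (b -
    a), since g varies by at most that much. A free c in [a, b] yields the expansion at either
    end. *)
Lemma cover_taylor (C : I -> set R) (f g : R -> R) (L a b c : R) :
  0 <= L -> (forall i, closed (C i)) -> a <= b -> a <= c <= b ->
  (forall t, a <= t <= b -> exists i, C i t) ->
  (forall i t t', C i t -> C i t' -> a <= t -> t <= t' -> t' <= b ->
     `|g t' - g t| <= L * (t' - t)) ->
  (forall i, mean_value (C i) f g) ->
  `|f b - f a - g c * (b - a)| <= L * (b - a) ^+ 2.
Proof.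
move=> L0 cC ab /andP[ac cb] cov hg hf.
have lip s t : a <= s -> s <= t -> t <= b -> `|g t - g s| <= L * (t - s).
  move=> as' st tb; apply: (@cover_lipschitz _ _ C _ _ _ _ [set: I]%SET) => //.
    move=> x /andP[sx xt]; have [|i Ci] := cov x; last by exists i.
    by rewrite (le_trans as' sx) (le_trans xt tb).
  move=> i x x' Cx Cx' sx xx xt; apply: (hg i) => //; first exact: le_trans as' sx.
  exact: le_trans xt tb.
pose F t := f t - g c * t.
have -> : f b - f a - g c * (b - a) = F b - F a by rewrite /F; ring.
rewrite expr2 mulrA; apply: (@cover_lipschitz _ _ C _ _ _ _ [set: I]%SET) => //.
- by rewrite mulr_ge0// subr_ge0.
- by move=> x /cov[i Ci]; exists i.
move=> i t t' Ct Ct' at' tt tb.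
have [x [Cx tx xt e]] := hf i t t' Ct Ct' tt.
have -> : F t' - F t = (g x - g c) * (t' - t) by rewrite /F mulrBl -e; ring.
rewrite normrM (ger0_norm (x := t' - t)) ?subr_ge0// ler_wpM2r ?subr_ge0//.
have [xc|/ltW xc] := leP x c.
  rewrite distrC; apply: (le_trans (lip _ _ (le_trans at' tx) xc cb)).
  by rewrite ler_wpM2l//; have := le_trans at' tx; lra.
apply: (le_trans (lip _ _ ac xc (le_trans xt tb))).
by rewrite ler_wpM2l//; have := le_trans xt tb; lra.
Qed.

Lemma cover_lipschitz_abs (C : I -> set R) (g : R -> R) (L M : R) :
  0 <= L -> (forall i, closed (C i)) -> (forall t, exists i, C i t) ->
  (forall i t t', C i t -> C i t' -> - M <= t -> t <= t' -> t' <= M ->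
     `|g t' - g t| <= L * (t' - t)) ->
  forall a b, `|a| <= M -> `|b| <= M -> `|g b - g a| <= L * `|b - a|.
Proof.
move=> L0 cC cov hg a b; rewrite (ler_norml a) (ler_norml b).
wlog ab : a b / a <= b => [w|/andP[Ma _] /andP[_ bM]].
  have [/w//|/ltW/w h ha hb] := leP a b.
  by rewrite distrC (distrC b); exact: h.
rewrite (ger0_norm (x := b - a)) ?subr_ge0//.
apply: (@cover_lipschitz _ _ C _ _ _ _ [set: I]%SET) => //.
  by move=> t _; have [i Ci] := cov t; exists i.
move=> i t t' Ct Ct' at' tt tb; apply: (hg i) => //; first exact: le_trans Ma at'.
exact: le_trans tb bM.
Qed.

Lemma cover_taylor_abs (C : I -> set R) (f g : R -> R) (L M : R) :
  0 <= L -> (forall i, closed (C i)) -> (forall t, exists i, C i t) ->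
  (forall i t t', C i t -> C i t' -> - M <= t -> t <= t' -> t' <= M ->
     `|g t' - g t| <= L * (t' - t)) ->
  (forall i, mean_value (C i) f g) ->
  forall a b, `|a| <= M -> `|b| <= M ->
    `|f b - f a - g a * (b - a)| <= L * `|b - a| ^+ 2.
Proof.
move=> L0 cC cov hg hf a b; rewrite (ler_norml a) (ler_norml b) => /andP[Ma aM] /andP[Mb bM].
rewrite real_normK ?num_real//.
have T x y c : - M <= x -> y <= M -> x <= y -> x <= c <= y ->
    `|f y - f x - g c * (y - x)| <= L * (y - x) ^+ 2.
  move=> Mx yM xy xcy; apply: (@cover_taylor C) => //.
  move=> i t t' Ct Ct' xt tt ty; apply: (hg i) => //; first exact: le_trans Mx xt.
  exact: le_trans ty yM.
have [ab|/ltW ba] := leP a b; first by apply: T; rewrite ?lexx.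
have -> : f b - f a - g a * (b - a) = - (f a - f b - g a * (a - b)) by ring.
by rewrite normrN -(sqrrN (b - a)) opprB; apply: T; rewrite ?lexx ?ba.
Qed.

Definition second_bound (u : R * R -> R) (M L : R) := forall z,
  `|z.1| <= M -> `|z.2| <= M ->
  [/\ `|pdx (pdx u) z| <= L, `|pdy (pdx u) z| <= L,
      `|pdx (pdy u) z| <= L & `|pdy (pdy u) z| <= L].

Lemma smooth_mean_value_x (u : R * R -> R) (y a b : R) : smooth u -> a <= b ->
  exists x, [/\ a <= x, x <= b & u (b, y) - u (a, y) = pdx u (x, y) * (b - a)].
Proof.
move=> su; rewrite le_eqVlt => /orP[/eqP <-|ab].
  by exists a; rewrite lexx !subrr mulr0.
have [x|x|x] := @MVT R (fun t => u (t, y)) (fun t => pdx u (t, y)) a b ab.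
- by move=> _; exact: smooth_is_derive_x.
- apply: continuous_subspaceT; apply: continuous_section_x.
  exact: smooth_continuous.
by rewrite in_itv/= => /andP[/ltW ax /ltW xb] e; exists x.
Qed.

Lemma smooth_mean_value_y (u : R * R -> R) (x a b : R) : smooth u -> a <= b ->
  exists y, [/\ a <= y, y <= b & u (x, b) - u (x, a) = pdy u (x, y) * (b - a)].
Proof.
move=> su; rewrite le_eqVlt => /orP[/eqP <-|ab].
  by exists a; rewrite lexx !subrr mulr0.
have [y|y|y] := @MVT R (fun t => u (x, t)) (fun t => pdy u (x, t)) a b ab.
- by move=> _; exact: smooth_is_derive_y.
- apply: continuous_subspaceT; apply: continuous_section_y.
  exact: smooth_continuous.
by rewrite in_itv/= => /andP[/ltW ay /ltW yb] e; exists y.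
Qed.

Lemma smooth_lipschitz_x (u : R * R -> R) (L M y : R) : smooth u ->
  (forall z, `|z.1| <= M -> `|z.2| <= M -> `|pdx u z| <= L) -> `|y| <= M ->
  forall t t', - M <= t -> t <= t' -> t' <= M ->
    `|u (t', y) - u (t, y)| <= L * (t' - t).
Proof.
move=> su hL yM t t' Mt tt tM.
have [x [tx xt ->]] := smooth_mean_value_x y su tt.
rewrite normrM (ger0_norm (x := t' - t)) ?subr_ge0// ler_wpM2r ?subr_ge0//.
by apply: hL => //=; rewrite ler_norml (le_trans Mt tx) (le_trans xt tM).
Qed.

Lemma smooth_lipschitz_y (u : R * R -> R) (L M x : R) : smooth u ->
  (forall z, `|z.1| <= M -> `|z.2| <= M -> `|pdy u z| <= L) -> `|x| <= M ->
  forall t t', - M <= t -> t <= t' -> t' <= M ->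
    `|u (x, t') - u (x, t)| <= L * (t' - t).
Proof.
move=> su hL xM t t' Mt tt tM.
have [y [ty yt ->]] := smooth_mean_value_y x su tt.
rewrite normrM (ger0_norm (x := t' - t)) ?subr_ge0// ler_wpM2r ?subr_ge0//.
by apply: hL => //=; rewrite ler_norml (le_trans Mt ty) (le_trans yt tM).
Qed.

Variables (K : I -> set (R * R)) (P : I -> R * R -> R) (v G1 G2 : R * R -> R).
Variables (M L : R).

(** Matching of values and gradients across cells is expressed by v, G1 and G2 being single
    functions; the mean value conditions take the place of differentiability of v. *)
Definition piecewise_smooth : Prop :=
  [/\ forall i, closed (K i), forall z, exists i, K i z, forall i, smooth (P i),
      forall i z, K i z -> [/\ v z = P i z, G1 z = pdx (P i) z & G2 z = pdy (P i) z] &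
      (forall i y, mean_value (fun t => K i (t, y)) (fun t => v (t, y)) (fun t => G1 (t, y))) /\
      (forall i x, mean_value (fun t => K i (x, t)) (fun t => v (x, t)) (fun t => G2 (x, t)))].

Hypothesis pw : piecewise_smooth.
Hypothesis L0 : 0 <= L.
Hypothesis hL : forall i, second_bound (P i) M L.

Let closed_x i (y : R) : closed [set t | K i (t, y)].
Proof.
have [cK _ _ _ _] := pw; apply: (closed_comp (f := fun t : R => (t, y))) (cK i).
by move=> t _; exact: (cvg_pair cvg_id (cvg_cst y)).
Qed.

Let closed_y i (x : R) : closed [set t | K i (x, t)].
Proof.
have [cK _ _ _ _] := pw; apply: (closed_comp (f := fun t : R => (x, t))) (cK i).
by move=> t _; exact: (cvg_pair (cvg_cst x) cvg_id).
Qed.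

(** The path from a to z through (z.1, a.2) is parallel to the axes and stays in the square, so that
    one-dimensional covers suffice. *)
Lemma piecewise_lipschitz z a : `|z.1| <= M -> `|z.2| <= M -> `|a.1| <= M -> `|a.2| <= M ->
  `|G1 z - G1 a| <= L * (`|z.1 - a.1| + `|z.2 - a.2|) /\
  `|G2 z - G2 a| <= L * (`|z.1 - a.1| + `|z.2 - a.2|).
Proof.
have [cK cov sP hP _] := pw.
move=> z1 z2 a1 a2.
have X (G : R * R -> R) (D : (R * R -> R) -> R * R -> R) :
    (forall i, smooth (D (P i))) ->
    (forall i z, K i z -> G z = D (P i) z) ->
    (forall i z, `|z.1| <= M -> `|z.2| <= M -> `|pdx (D (P i)) z| <= L) ->
    (forall i z, `|z.1| <= M -> `|z.2| <= M -> `|pdy (D (P i)) z| <= L) ->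
    `|G z - G a| <= L * (`|z.1 - a.1| + `|z.2 - a.2|).
  move=> sD hG hx hy.
  have e1 : `|G (z.1, a.2) - G (a.1, a.2)| <= L * `|z.1 - a.1|.
    apply: (@cover_lipschitz_abs (fun i => [set t | K i (t, a.2)]) (fun t => G (t, a.2)) L M) => //.
      by move=> t; have [i Ki] := cov (t, a.2); exists i.
    move=> i t t' Kt Kt' Mt tt tM; rewrite (hG i _ Kt) (hG i _ Kt').
    exact: (smooth_lipschitz_x (sD i) (hx i) a2 Mt tt tM).
  have e2 : `|G (z.1, z.2) - G (z.1, a.2)| <= L * `|z.2 - a.2|.
    apply: (@cover_lipschitz_abs (fun i => [set t | K i (z.1, t)]) (fun t => G (z.1, t)) L M) => //.
      by move=> t; have [i Ki] := cov (z.1, t); exists i.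
    move=> i t t' Kt Kt' Mt tt tM; rewrite (hG i _ Kt) (hG i _ Kt').
    exact: (smooth_lipschitz_y (sD i) (hy i) z1 Mt tt tM).
  move: e1 e2; rewrite -!surjective_pairing => e1 e2.
  have -> : G z - G a = (G z - G (z.1, a.2)) + (G (z.1, a.2) - G a) by ring.
  by apply: (le_trans (ler_normD _ _)); rewrite mulrDr addrC; exact: lerD.
split.
  apply: (X G1 pdx).
  - by move=> i; exact: smooth_pdx.
  - by move=> i w /hP[].
  - by move=> i w w1 w2; case: (hL i w1 w2).
  - by move=> i w w1 w2; case: (hL i w1 w2).
apply: (X G2 pdy).
- by move=> i; exact: smooth_pdy.
- by move=> i w /hP[].
- by move=> i w w1 w2; case: (hL i w1 w2).
- by move=> i w w1 w2; case: (hL i w1 w2).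
Qed.

(** Same path; the vertical part expands with G2 at the bend, and its Lipschitz bound moves it back
    to a. *)
Lemma piecewise_taylor z a : `|z.1| <= M -> `|z.2| <= M -> `|a.1| <= M -> `|a.2| <= M ->
  `|v z - v a - G1 a * (z.1 - a.1) - G2 a * (z.2 - a.2)| <=
    L * (`|z.1 - a.1| + `|z.2 - a.2|) ^+ 2.
Proof.
have [cK cov sP hP [mx my]] := pw.
move=> z1 z2 a1 a2.
have e1 : `|v (z.1, a.2) - v (a.1, a.2) - G1 (a.1, a.2) * (z.1 - a.1)| <=
    L * `|z.1 - a.1| ^+ 2.
  apply: (@cover_taylor_abs (fun i => [set t | K i (t, a.2)]) (fun t => v (t, a.2))
    (fun t => G1 (t, a.2)) L M) => //.
  - by move=> t; have [i Ki] := cov (t, a.2); exists i.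
  - move=> i t t' Kt Kt' Mt tt tM; have [_ -> _] := hP i _ Kt; have [_ -> _] := hP i _ Kt'.
    apply: (@smooth_lipschitz_x _ L M) => //; first exact: smooth_pdx.
    by move=> w w1 w2; case: (hL i w1 w2).
  - by move=> i; exact: mx.
have e2 : `|v (z.1, z.2) - v (z.1, a.2) - G2 (z.1, a.2) * (z.2 - a.2)| <=
    L * `|z.2 - a.2| ^+ 2.
  apply: (@cover_taylor_abs (fun i => [set t | K i (z.1, t)]) (fun t => v (z.1, t))
    (fun t => G2 (z.1, t)) L M) => //.
  - by move=> t; have [i Ki] := cov (z.1, t); exists i.
  - move=> i t t' Kt Kt' Mt tt tM; have [_ _ ->] := hP i _ Kt; have [_ _ ->] := hP i _ Kt'.
    apply: (@smooth_lipschitz_y _ L M) => //; first exact: smooth_pdy.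
    by move=> w w1 w2; case: (hL i w1 w2).
  - by move=> i; exact: my.
have [_ e3] := @piecewise_lipschitz (z.1, a.2) a z1 a2 a1 a2.
move: e1 e2 e3; rewrite -!surjective_pairing /= subrr normr0 addr0.
move: (normr_ge0 (z.1 - a.1)) (normr_ge0 (z.2 - a.2)) => n1 n2 e1 e2 e3.
have e4 : `|(G2 (z.1, a.2) - G2 a) * (z.2 - a.2)| <= L * (`|z.1 - a.1| * `|z.2 - a.2|).
  by rewrite normrM mulrA ler_wpM2r.
have -> : v z - v a - G1 a * (z.1 - a.1) - G2 a * (z.2 - a.2) =
    (v z - v (z.1, a.2) - G2 (z.1, a.2) * (z.2 - a.2)) +
    ((v (z.1, a.2) - v a - G1 a * (z.1 - a.1)) + (G2 (z.1, a.2) - G2 a) * (z.2 - a.2)).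
  by ring.
apply: (le_trans (ler_normD _ _)); apply: (le_trans (lerD e2 (ler_normD _ _))).
apply: (le_trans (lerD (lexx _) (lerD e1 e4))).
rewrite -!mulrDr ler_wpM2l//; have := mulr_ge0 n1 n2; rewrite sqrrD; lra.
Qed.

End piecewise_smooth.

Section jets.
Context {R : realType}.

Lemma smooth_piecewise (u : R * R -> R) : smooth u ->
  piecewise_smooth (fun _ : unit => setT) (fun _ => u) u (pdx u) (pdy u).
Proof.
move=> su; split => //.
split.
  move=> _ y t t' _ _ tt; have [x [h1 h2 h3]] := smooth_mean_value_x y su tt.
  by exists x.
move=> _ x t t' _ _ tt; have [y [h1 h2 h3]] := smooth_mean_value_y x su tt.
by exists y.
Qed.

(** Both functions have the same first order expansion at a, and each deviates from it by at most
    the Taylor remainder. *)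
Lemma jet_close (I : finType) (K : I -> set (R * R)) (P : I -> R * R -> R)
    (v G1 G2 u : R * R -> R) (M L : R) (z a : R * R) :
  piecewise_smooth K P v G1 G2 -> 0 <= L -> (forall i, second_bound (P i) M L) ->
  smooth u -> second_bound u M L ->
  v a = u a -> G1 a = pdx u a -> G2 a = pdy u a ->
  `|z.1| <= M -> `|z.2| <= M -> `|a.1| <= M -> `|a.2| <= M ->
  [/\ `|u z - v z| <= 2 * L * (`|z.1 - a.1| + `|z.2 - a.2|) ^+ 2,
      `|pdx u z - G1 z| <= 2 * L * (`|z.1 - a.1| + `|z.2 - a.2|) &
      `|pdy u z - G2 z| <= 2 * L * (`|z.1 - a.1| + `|z.2 - a.2|)].
Proof.
move=> pw L0 hL su hu e0 e1 e2 z1 z2 a1 a2.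
have sp := smooth_piecewise su.
have hu' : forall _ : unit, second_bound u M L by [].
have [l1 l2] := piecewise_lipschitz pw L0 hL z1 z2 a1 a2.
have t0 := piecewise_taylor pw L0 hL z1 z2 a1 a2.
have [l1' l2'] := piecewise_lipschitz sp L0 hu' z1 z2 a1 a2.
have t0' := piecewise_taylor sp L0 hu' z1 z2 a1 a2.
move: l1 l2 t0 l1' l2' t0'; rewrite e0 e1 e2.
move: (`|z.1 - a.1| + `|z.2 - a.2|) => d l1 l2 t0 l1' l2' t0'.
have two x : 2 * L * x = L * x + L * x by ring.
rewrite !two; split.
- have -> : u z - v z = (u z - u a - pdx u a * (z.1 - a.1) - pdy u a * (z.2 - a.2)) -
     (v z - u a - pdx u a * (z.1 - a.1) - pdy u a * (z.2 - a.2)) by ring.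
  by apply: (le_trans (ler_normB _ _)); exact: (lerD t0' t0).
- have -> : pdx u z - G1 z = (pdx u z - pdx u a) - (G1 z - pdx u a) by ring.
  by apply: (le_trans (ler_normB _ _)); exact: (lerD l1' l1).
have -> : pdy u z - G2 z = (pdy u z - pdy u a) - (G2 z - pdy u a) by ring.
by apply: (le_trans (ler_normB _ _)); exact: (lerD l2' l2).
Qed.

End jets.

(** * Smooth partition of unity on the line *)

Section bump.
Context {R : realType}.
Implicit Types (f w : R -> R) (t a c e : R).

Lemma zero_left f a : continuous f -> (forall t, t < a -> f t = 0) ->
  forall t, t <= a -> f t = 0.
Proof.
move=> cf h t; rewrite le_eqVlt => /orP[/eqP ->|]; last exact: h.
apply/eqP; apply: contrapT => /negP fa.
have [d /= d0 hd] : \forall s \near a, f s != 0.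
  exact: (cvgr_neq0 _ (cf a)).
have : f (a - d / 2) != 0.
  apply: hd => /=; rewrite opprB addrC subrK gtr0_norm ?divr_gt0//.
  by rewrite ltr_pdivrMr// ltr_pMr// ltr1n.
by rewrite h ?eqxx// ltrBlDr ltrDl divr_gt0.
Qed.

Lemma zero_right f a : continuous f -> (forall t, a < t -> f t = 0) ->
  forall t, a <= t -> f t = 0.
Proof.
move=> cf h t at'; have cg : continuous (fun t => f (- t)).
  by move=> s; apply: (continuous_comp (f := fun t => - t)); [exact: opp_continuous|exact: cf].
rewrite -(opprK t); apply: (@zero_left (fun t => f (- t)) (- a) cg); last by rewrite lerN2.
by move=> s sa; apply: h; rewrite ltrNr.
Qed.

Lemma derive1_open_cst f (U : set R) c : open U -> (forall t, U t -> f t = c) ->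
  forall t, U t -> derive1 f t = 0.
Proof.
move=> oU h t Ut; apply: derive1_is.
apply: (@is_derive_sq_bound _ _ _ 0).
have : nbhs t U by exact: open_nbhs_nbhs.
by apply: filterS => s Us; rewrite !h// subrr normr0 mul0r.
Qed.

Definition smooth1 f := forall k, Ck1 k f.

Lemma smooth1_derive1 f : smooth1 f -> smooth1 (derive1 f).
Proof. by move=> sf k; case: (sf k.+1) => _ []. Qed.

Lemma smooth1_continuous f : smooth1 f -> continuous f.
Proof. by move=> sf; exact: Ck1_continuous (sf 0%N). Qed.

Lemma smooth1_is_derive f t : smooth1 f -> is_derive t 1 f (derive1 f t).
Proof. by move=> sf; apply: is_derive_derive1; case: (sf 1%N) => _ []. Qed.

(** Covers [smooth_step] (e = 1) and its derivatives (e = 0), so that the partition of unity and its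
    derivatives are treated together. *)
Definition step f e : Prop :=
  [/\ smooth1 f, forall t, t <= 0 -> f t = 0 & forall t, 1 <= t -> f t = e].

Lemma step_smooth_step : step (@smooth_step R) 1.
Proof.
by split; [move=> k; exact: Ck1_smooth_step|exact: smooth_step_le0|exact: smooth_step_ge1].
Qed.

Lemma step_derive1 f e : step f e -> step (derive1 f) 0.
Proof.
move=> [sf h0 h1]; have sf' := smooth1_derive1 sf.
have cf' := smooth1_continuous sf'; split => // t ht.
  apply: (zero_left cf' _ ht); apply: (@derive1_open_cst _ [set t | t < 0] 0).
    exact: open_lt.
  by move=> s /= s0; apply: h0; exact: ltW.
apply: (zero_right cf' _ ht); apply: (@derive1_open_cst _ [set t | 1 < t] e).
  exact: open_gt.
by move=> s /= s0; apply: h1; exact: ltW.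
Qed.

(** For a step f this is supported in [-1, 1], and its integer translates telescope to the sum e. *)
Definition weight f t := f (t + 1) - f t.

Lemma weight_out f e t : step f e -> 1 <= `|t| -> weight f t = 0.
Proof.
move=> [_ h0 h1]; rewrite /weight ler_normr => /orP[t1|t1].
  by rewrite !h1 ?subrr//; lra.
by rewrite !h0 ?subrr//; lra.
Qed.

Lemma weight_sum f e t : step f e -> 0 <= t -> t <= 1 ->
  weight f t + weight f (t - 1) = e.
Proof.
move=> [_ h0 h1] t0 t1; rewrite /weight subrK h1; last by lra.
by rewrite (h0 (t - 1)); lra.
Qed.

Lemma is_derive_weight f t : smooth1 f -> is_derive t 1 (weight f) (weight (derive1 f) t).
Proof.
move=> sf; rewrite /weight.
have -> : derive1 f (t + 1) - derive1 f t = 1 * derive1 f (1 * t + 1) + (-1) * derive1 f t.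
  by rewrite !mul1r mulN1r.
have -> : (fun t => f (t + 1) - f t) = (fun t => f (1 * t + 1) + (-1) * f t).
  by apply/funext => s; rewrite mul1r mulN1r.
apply: is_derive_add.
  by apply: is_derive_affine; exact: smooth1_is_derive.
have := is_derive_mul (is_derive_cst (-1 : R) t 1) (smooth1_is_derive t sf).
by rewrite mul0r add0r.
Qed.

Lemma smooth1_weight f : smooth1 f -> smooth1 (weight f).
Proof.
move=> sf k; rewrite /weight.
have -> : (fun t => f (t + 1) - f t) = (fun t => f (1 * t + 1) + (cst (-1) t) * f t).
  by apply/funext => s; rewrite mul1r mulN1r.
apply: Ck1_add; first exact: Ck1_affine.
by apply: Ck1_mul => //; exact: Ck1_cst.
Qed.

Lemma weight_bounded f e : step f e -> exists C, forall t, `|weight f t| <= C.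
Proof.
move=> sf; have [s1 _ _] := sf.
have cw : continuous (fun z : R * R => weight f z.1).
  by apply: continuous_fst_comp; apply: smooth1_continuous; exact: smooth1_weight.
have [C C0 hC] := continuous_bounded_cbox 1 cw.
exists C => t; have [t1|t1] := leP 1 `|t|; first by rewrite (weight_out sf t1) normr0.
by apply: (hC (t, 0)); rewrite /= ?ltW// normr0.
Qed.

(** Only the translates l and l + 1 reach t, and their weights sum to e. For e = 0 the constant B
    cancels, so differentiated weights see only the errors A - B. *)
Lemma weight_sum_close f e (C eta : R) (n l : nat) t (A : nat -> R) (B : R) :
  step f e -> (forall t, `|weight f t| <= C) ->
  l%:R <= t -> t <= l.+1%:R -> (l.+1 < n)%N ->
  `|A l - B| <= eta -> `|A l.+1 - B| <= eta ->
  `|\sum_(j < n) weight f (t - j%:R) * A j - e * B| <= 2 * C * eta.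
Proof.
move=> sf hC lt tl ln hl hl1.
have ln' : (l < n)%N by exact: ltn_trans ln.
rewrite (bigD1 (Ordinal ln'))//= (bigD1 (Ordinal ln))/=; last first.
  by rewrite -val_eqE/= gtn_eqF.
rewrite big1 => [|j /andP[j1 j2]]; last first.
  rewrite (weight_out sf) ?mul0r//.
  move: j1 j2; rewrite -!val_eqE/= => j1 j2.
  have [jl|lj] := ltnP j l.
    have : j.+1%:R <= l%:R :> R by rewrite ler_nat.
    by rewrite -natr1 ler_normr => ?; apply/orP; left; lra.
  have jl2 : (l.+2 <= j)%N by rewrite ltn_neqAle eq_sym j2 ltn_neqAle eq_sym j1.
  have : l.+2%:R <= j%:R :> R by rewrite ler_nat.
  by move: tl; rewrite -!natr1 ler_normr => ? ?; apply/orP; right; lra.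
have := weight_sum sf (t := t - l%:R); rewrite addr0.
have -> : t - l%:R - 1 = t - l.+1%:R by rewrite -natr1; ring.
move=> <-; last by move: tl; rewrite -natr1; lra.
  have -> : weight f (t - l%:R) * A l + weight f (t - l.+1%:R) * A l.+1 -
      (weight f (t - l%:R) + weight f (t - l.+1%:R)) * B =
      weight f (t - l%:R) * (A l - B) + weight f (t - l.+1%:R) * (A l.+1 - B) by ring.
  apply: (le_trans (ler_normD _ _)); rewrite !normrM.
  have -> : 2 * C * eta = C * eta + C * eta by ring.
  by apply: lerD; apply: ler_pM.
by rewrite subr_ge0.
Qed.

End bump.

(** * Blending local functions on a grid *)

Section blend.
Context {R : realType}.
Variables (N c : R) (n : nat).
Implicit Types (f g : R -> R) (Q : nat -> nat -> R * R -> R) (z : R * R).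

Definition wx f (i : nat) z := weight f (N * z.1 + (c - i%:R)).
Definition wy f (j : nat) z := weight f (N * z.2 + (c - j%:R)).

(** General f and g make the derivative of a blend a combination of blends: differentiating a weight
    replaces f by its derivative and brings out N. *)
Definition blend f g Q z : R :=
  \sum_(i < n) \sum_(j < n) wx f i z * (wy g j z * Q i j z).

Lemma smooth_wx f i : smooth1 f -> smooth (wx f i).
Proof.
move=> sf k; apply: (@Ck_fst_comp _ _ (fun t => weight f (N * t + (c - i%:R)))).
by apply: Ck1_affine; exact: smooth1_weight.
Qed.

Lemma smooth_wy f j : smooth1 f -> smooth (wy f j).
Proof.
move=> sf k; apply: (@Ck_snd_comp _ _ (fun t => weight f (N * t + (c - j%:R)))).
by apply: Ck1_affine; exact: smooth1_weight.
Qed.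

Lemma pdx_wx f i z : smooth1 f -> pdx (wx f i) z = N * wx (derive1 f) i z.
Proof. by move=> sf; apply: pdx_is; apply: is_derive_affine; exact: is_derive_weight. Qed.

Lemma pdy_wx f i z : pdy (wx f i) z = 0.
Proof. by apply: pdy_is; exact: (is_derive_cst (weight f (N * z.1 + (c - i%:R))) z.2 1). Qed.

Lemma pdy_wy f i z : smooth1 f -> pdy (wy f i) z = N * wy (derive1 f) i z.
Proof. by move=> sf; apply: pdy_is; apply: is_derive_affine; exact: is_derive_weight. Qed.

Lemma pdx_wy f i z : pdx (wy f i) z = 0.
Proof. by apply: pdx_is; exact: (is_derive_cst (weight f (N * z.2 + (c - i%:R))) z.1 1). Qed.

Lemma smooth_blend_term f g Q i j : smooth1 f -> smooth1 g -> smooth (Q i j) ->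
  smooth (fun z => wx f i z * (wy g j z * Q i j z)).
Proof.
move=> sf sg sQ; apply: smoothM; first exact: smooth_wx.
by apply: smoothM => //; exact: smooth_wy.
Qed.

Lemma smooth_blend f g Q : smooth1 f -> smooth1 g -> (forall i j, smooth (Q i j)) ->
  smooth (blend f g Q).
Proof.
move=> sf sg sQ; apply: smooth_sum => i _; apply: smooth_sum => j _.
exact: smooth_blend_term.
Qed.

Lemma pdx_blend f g Q : smooth1 f -> smooth1 g -> (forall i j, smooth (Q i j)) ->
  pdx (blend f g Q) =
  lincomb N (blend (derive1 f) g Q) (blend f g (fun i j => pdx (Q i j))).
Proof.
move=> sf sg sQ; apply/funext => z.
have st i j := smooth_blend_term (i := i) (j := j) sf sg (sQ i j).
rewrite /blend pdx_sum; last by move=> i _; apply: smooth_sum => j _; exact: st.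
rewrite /lincomb big_distrr/= -big_split/=; apply: eq_bigr => i _.
rewrite pdx_sum; last by move=> j _; exact: st.
rewrite big_distrr/= -big_split/=; apply: eq_bigr => j _.
have s2 := smoothM (smooth_wy j sg) (sQ i j).
rewrite (pdxM (smooth_wx i sf) s2) pdx_wx//.
rewrite (pdxM (smooth_wy j sg) (sQ i j)) pdx_wy; ring.
Qed.

Lemma pdy_blend f g Q : smooth1 f -> smooth1 g -> (forall i j, smooth (Q i j)) ->
  pdy (blend f g Q) =
  lincomb N (blend f (derive1 g) Q) (blend f g (fun i j => pdy (Q i j))).
Proof.
move=> sf sg sQ; apply/funext => z.
have st i j := smooth_blend_term (i := i) (j := j) sf sg (sQ i j).
rewrite /blend pdy_sum; last by move=> i _; apply: smooth_sum => j _; exact: st.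
rewrite /lincomb big_distrr/= -big_split/=; apply: eq_bigr => i _.
rewrite pdy_sum; last by move=> j _; exact: st.
rewrite big_distrr/= -big_split/=; apply: eq_bigr => j _.
have s2 := smoothM (smooth_wy j sg) (sQ i j).
rewrite (pdyM (smooth_wx i sf) s2) pdy_wx//.
rewrite (pdyM (smooth_wy j sg) (sQ i j)) pdy_wy//; ring.
Qed.

Lemma blend_close f g (ef eg C eta B : R) Q z (k l : nat) :
  step f ef -> step g eg -> (forall t, `|weight f t| <= C) ->
  (forall t, `|weight g t| <= C) ->
  k%:R <= N * z.1 + c <= k.+1%:R -> l%:R <= N * z.2 + c <= l.+1%:R ->
  (k.+1 < n)%N -> (l.+1 < n)%N ->
  (forall i j, (k <= i <= k.+1)%N -> (l <= j <= l.+1)%N -> `|Q i j z - B| <= eta) ->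
  `|blend f g Q z - ef * eg * B| <= 4 * C ^+ 2 * eta.
Proof.
move=> sf sg Cf Cg /andP[k1 k2] /andP[l1 l2] kn ln hQ.
have inner i : (k <= i <= k.+1)%N ->
    `|\sum_(j < n) weight g (N * z.2 + c - j%:R) * Q i j z - eg * B| <= 2 * C * eta.
  move=> hi; apply: (weight_sum_close (A := fun j => Q i j z) sg Cg l1 l2 ln); apply: hQ => //.
    by rewrite leqnn leqnSn.
  by rewrite leqnn leqnSn.
have -> : blend f g Q z = \sum_(i < n) weight f (N * z.1 + c - i%:R) *
    \sum_(j < n) weight g (N * z.2 + c - j%:R) * Q i j z.
  apply: eq_bigr => i _; rewrite big_distrr/=; apply: eq_bigr => j _.
  by rewrite /wx /wy !addrA.
have -> : 4 * C ^+ 2 * eta = 2 * C * (2 * C * eta) by ring.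
rewrite -mulrA; apply: (weight_sum_close (A := fun i => \sum_(j < n)
  weight g (N * z.2 + c - j%:R) * Q i j z) sf Cf k1 k2 kn); apply: inner.
  by rewrite leqnn leqnSn.
by rewrite leqnn leqnSn.
Qed.

Definition second_close (u : R * R -> R) z (bxx bxy byx byy eta : R) :=
  [/\ `|pdx (pdx u) z - bxx| <= eta, `|pdy (pdx u) z - bxy| <= eta,
      `|pdx (pdy u) z - byx| <= eta & `|pdy (pdy u) z - byy| <= eta].

(** The tolerances eta / N^2, eta / N and eta balance the factors N^2, N and 1 brought by two, one
    or no differentiated weights. Each of the at most four terms of a derivative is then within 4
    C^2 eta. *)
Lemma blend_jet (C eta b bx by' bxx bxy byx byy : R) Q z (k l : nat) :
  1 <= N -> 0 <= eta ->
  (forall t, [/\ `|weight (@smooth_step R) t| <= C,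
      `|weight (derive1 (@smooth_step R)) t| <= C &
      `|weight (derive1 (derive1 (@smooth_step R))) t| <= C]) ->
  (forall i j, smooth (Q i j)) ->
  k%:R <= N * z.1 + c <= k.+1%:R -> l%:R <= N * z.2 + c <= l.+1%:R ->
  (k.+1 < n)%N -> (l.+1 < n)%N ->
  (forall i j, (k <= i <= k.+1)%N -> (l <= j <= l.+1)%N ->
    [/\ `|Q i j z - b| <= eta / N ^+ 2, `|pdx (Q i j) z - bx| <= eta / N,
        `|pdy (Q i j) z - by'| <= eta / N &
        second_close (Q i j) z bxx bxy byx byy eta]) ->
  let u := blend smooth_step smooth_step Q in
  [/\ `|u z - b| <= 16 * C ^+ 2 * eta, `|pdx u z - bx| <= 16 * C ^+ 2 * eta,
      `|pdy u z - by'| <= 16 * C ^+ 2 * eta &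
      second_close u z bxx bxy byx byy (16 * C ^+ 2 * eta)].
Proof.
move=> N1 eta0 hC sQ hk hl kn ln hQ u.
have N0 : 0 < N by exact: lt_le_trans N1.
set s0 := @smooth_step R in u hC *; set s1 := derive1 s0 in hC *.
set s2 := derive1 s1 in hC *.
have S0 : step s0 1 := step_smooth_step.
have S1 : step s1 0 := step_derive1 S0.
have S2 : step s2 0 := step_derive1 S1.
have [m0 _ _] := S0; have [m1 _ _] := S1; have [m2 _ _] := S2.
have C0 t : `|weight s0 t| <= C by case: (hC t).
have C1 t : `|weight s1 t| <= C by case: (hC t).
have C2 t : `|weight s2 t| <= C by case: (hC t).
have sQx i j := smooth_pdx (sQ i j); have sQy i j := smooth_pdy (sQ i j).
have BC f g ef eg D e A : step f ef -> step g eg -> (forall t, `|weight f t| <= C) ->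
    (forall t, `|weight g t| <= C) ->
    (forall i j, (k <= i <= k.+1)%N -> (l <= j <= l.+1)%N -> `|D i j z - A| <= e) ->
    `|blend f g D z - ef * eg * A| <= 4 * C ^+ 2 * e.
  by move=> *; exact: (blend_close (k := k) (l := l)).
have h0 i j (hi : (k <= i <= k.+1)%N) (hj : (l <= j <= l.+1)%N) :
  `|Q i j z - b| <= eta / N ^+ 2 by case: (hQ i j hi hj).
have h1 i j (hi : (k <= i <= k.+1)%N) (hj : (l <= j <= l.+1)%N) :
  `|pdx (Q i j) z - bx| <= eta / N by case: (hQ i j hi hj).
have h2 i j (hi : (k <= i <= k.+1)%N) (hj : (l <= j <= l.+1)%N) :
  `|pdy (Q i j) z - by'| <= eta / N by case: (hQ i j hi hj).
have h3 i j (hi : (k <= i <= k.+1)%N) (hj : (l <= j <= l.+1)%N) :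
  second_close (Q i j) z bxx bxy byx byy eta by case: (hQ i j hi hj).
pose K := 4 * C ^+ 2 * eta.
have K0 : 0 <= K by rewrite mulr_ge0// mulr_ge0// sqr_ge0.
have E2 : 4 * C ^+ 2 * (eta / N ^+ 2) = K / N ^+ 2 by rewrite mulrA.
have E1 : 4 * C ^+ 2 * (eta / N) = K / N by rewrite mulrA.
have iN : N^-1 <= 1 by rewrite invf_le1.
have iN0 : 0 <= N^-1 by rewrite invr_ge0 ltW.
have L2N : K / N ^+ 2 <= K.
  by rewrite ler_piMr// -exprVn exprn_ile1.
have L1N : K / N <= K by rewrite ler_piMr.
have Z2 x : `|x| <= K / N ^+ 2 -> `|N * (N * x)| <= K.
  move=> hx; rewrite !normrM (gtr0_norm N0) mulrA -expr2.
  by rewrite -ler_pdivlMl ?exprn_gt0// mulrC.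
have Z1 x : `|x| <= K / N -> `|N * x| <= K.
  by move=> hx; rewrite normrM (gtr0_norm N0) -ler_pdivlMl// mulrC.
have Z21 x : `|x| <= K / N ^+ 2 -> `|N * x| <= K.
  move=> hx; rewrite normrM (gtr0_norm N0) -ler_pdivlMl// mulrC.
  apply: (le_trans hx); rewrite expr2 invfM mulrA ler_piMr//.
  by rewrite mulr_ge0.
have four x1 x2 x3 x4 : `|x1| <= K -> `|x2| <= K -> `|x3| <= K -> `|x4| <= K ->
    `|x1 + x2 + (x3 + x4)| <= 16 * C ^+ 2 * eta.
  move=> a1 a2 a3 a4; apply: (le_trans (ler_normD _ _)).
  apply: (le_trans (lerD (ler_normD _ _) (ler_normD _ _))).
  apply: (le_trans (lerD (lerD a1 a2) (lerD a3 a4))).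
  by rewrite le_eqVlt; apply/orP; left; apply/eqP; rewrite /K; ring.
(* As soon as one weight is differentiated, the weights sum to 0 and the target value drops out. *)
have BC0 f g ef eg D e A : step f ef -> step g eg -> (forall t, `|weight f t| <= C) ->
    (forall t, `|weight g t| <= C) -> ef * eg = 0 ->
    (forall i j, (k <= i <= k.+1)%N -> (l <= j <= l.+1)%N -> `|D i j z - A| <= e) ->
    `|blend f g D z| <= 4 * C ^+ 2 * e.
  by move=> sf sg Cf Cg e0 /(BC _ _ _ _ _ _ _ sf sg Cf Cg); rewrite e0 mul0r subr0.
have BC1 D e A :
    (forall i j, (k <= i <= k.+1)%N -> (l <= j <= l.+1)%N -> `|D i j z - A| <= e) ->
    `|blend s0 s0 D z - A| <= 4 * C ^+ 2 * e.
  by move=> /(BC _ _ _ _ _ _ _ S0 S0 C0 C0); rewrite mulr1 mul1r.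
have b00 := BC1 _ _ _ h0; rewrite E2 in b00.
have b10 := BC0 _ _ _ _ _ _ _ S1 S0 C1 C0 (mul0r _) h0; rewrite E2 in b10.
have b01 := BC0 _ _ _ _ _ _ _ S0 S1 C0 C1 (mulr0 _) h0; rewrite E2 in b01.
have b20 := BC0 _ _ _ _ _ _ _ S2 S0 C2 C0 (mul0r _) h0; rewrite E2 in b20.
have b11 := BC0 _ _ _ _ _ _ _ S1 S1 C1 C1 (mul0r _) h0; rewrite E2 in b11.
have b02 := BC0 _ _ _ _ _ _ _ S0 S2 C0 C2 (mulr0 _) h0; rewrite E2 in b02.
have x00 := BC1 (fun i j => pdx (Q i j)) _ _ h1; rewrite E1 in x00.
have x10 := BC0 _ _ _ _ (fun i j => pdx (Q i j)) _ _ S1 S0 C1 C0 (mul0r _) h1; rewrite E1 in x10.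
have x01 := BC0 _ _ _ _ (fun i j => pdx (Q i j)) _ _ S0 S1 C0 C1 (mulr0 _) h1; rewrite E1 in x01.
have y00 := BC1 (fun i j => pdy (Q i j)) _ _ h2; rewrite E1 in y00.
have y10 := BC0 _ _ _ _ (fun i j => pdy (Q i j)) _ _ S1 S0 C1 C0 (mul0r _) h2; rewrite E1 in y10.
have y01 := BC0 _ _ _ _ (fun i j => pdy (Q i j)) _ _ S0 S1 C0 C1 (mulr0 _) h2; rewrite E1 in y01.
have [xx xy yx yy] : [/\ `|blend s0 s0 (fun i j => pdx (pdx (Q i j))) z - bxx| <= K,
    `|blend s0 s0 (fun i j => pdy (pdx (Q i j))) z - bxy| <= K,
    `|blend s0 s0 (fun i j => pdx (pdy (Q i j))) z - byx| <= K &
    `|blend s0 s0 (fun i j => pdy (pdy (Q i j))) z - byy| <= K].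
  by split; apply: BC1 => i j hi hj; case: (h3 i j hi hj).
have pxu := pdx_blend m0 m0 sQ; have pyu := pdy_blend m0 m0 sQ.
have s10 := smooth_blend m1 m0 sQ; have s01 := smooth_blend m0 m1 sQ.
have sx := smooth_blend m0 m0 sQx; have sy := smooth_blend m0 m0 sQy.
have z0 : `|0 : R| <= K by rewrite normr0.
split.
- have -> : u z - b = (u z - b) + 0 + (0 + 0) by ring.
  by apply: four => //; exact: le_trans b00 L2N.
- rewrite /u pxu /lincomb -/s1 -addrA -[X in `|X|]addr0 -[X in _ + X](addr0 0).
  by apply: four => //; [exact: Z21|exact: le_trans x00 L1N].
- rewrite /u pyu /lincomb -/s1 -addrA -[X in `|X|]addr0 -[X in _ + X](addr0 0).
  by apply: four => //; [exact: Z21|exact: le_trans y00 L1N].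
split.
- rewrite /u pxu pdx_lincomb// pdx_blend// pdx_blend// /lincomb -/s1 -/s2 mulrDr.
  rewrite -[X in `|X|]addrA -[X in _ + X]addrA.
  apply: four; [exact: (Z2 _ b20)|exact: (Z1 _ x10)|exact: (Z1 _ x10)|exact: xx].
- rewrite /u pxu pdy_lincomb// pdy_blend// pdy_blend// /lincomb -/s1 -/s2 mulrDr.
  rewrite -[X in `|X|]addrA -[X in _ + X]addrA.
  apply: four; [exact: (Z2 _ b11)|exact: (Z1 _ y10)|exact: (Z1 _ x01)|exact: xy].
- rewrite /u pyu pdx_lincomb// pdx_blend// pdx_blend// /lincomb -/s1 -/s2 mulrDr.
  rewrite -[X in `|X|]addrA -[X in _ + X]addrA.
  apply: four; [exact: (Z2 _ b11)|exact: (Z1 _ x01)|exact: (Z1 _ y10)|exact: yx].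
rewrite /u pyu pdy_lincomb// pdy_blend// pdy_blend// /lincomb -/s1 -/s2 mulrDr.
rewrite -[X in `|X|]addrA -[X in _ + X]addrA.
apply: four; [exact: (Z2 _ b02)|exact: (Z1 _ y01)|exact: (Z1 _ y01)|exact: yy].
Qed.

End blend.

(** * Convex cells: null boundary and dense interior *)

Section convex_cells.
Context {R : realType}.
Local Notation mu := (@lebesgue_measure R).
Local Notation mu2 := (@lebesgue_measure R \x @lebesgue_measure R)%E.
Implicit Types (K : set (R * R)) (p q z : R * R) (A : set R).

Lemma interior_boxP K z : K° z <-> exists2 e : R, 0 < e &
  forall w, `|w.1 - z.1| < e -> `|w.2 - z.2| < e -> K w.
Proof.
split=> [Kz|[e e0 h]].
  have [e e0 he] := open_boxP (open_interior K) Kz.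
  exists e => // w w1 w2; apply: interior_subset; apply: he; by rewrite distrC.
exists (ball z.1 e, ball z.2 e) => /=; first by split; exact: nbhsx_ballx.
by move=> w [/= w1 w2]; apply: h; rewrite distrC.
Qed.

(** Having no middle point, hence at most two points, is the form in which convexity delivers
    exceptional sets. *)
Lemma few_points_null A : (forall a b c, A a -> A b -> A c -> a < b -> b < c -> False) ->
  mu A = 0%E.
Proof.
move=> h; apply: countable_lebesgue_measure0; apply: finite_set_countable.
have [[p Ap]|nA] := pselect (A !=set0); last first.
  by rewrite (_ : A = set0)//; apply/seteqP; split => // x Ax; apply: nA; exists x.
have [[q [Aq qp]]|n1] := pselect (exists q : R, A q /\ q != p); last first.
  apply: (@sub_finite_set _ _ [set p]) => // x Ax /=.
  by apply: contrapT => /eqP xp; apply: n1; exists x.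
apply: (@sub_finite_set _ _ [set p; q]) => // x Ax.
apply: contrapT => /not_orP[/eqP xp /eqP xq].
have H a b c : A a -> A b -> A c -> a < b -> b < c -> False by exact: h.
move: qp xp xq; rewrite !neq_lt => /orP[] ? /orP[] ? /orP[] ?.
all: by [exact: (H x q p)|exact: (H q x p)|exact: (H q p x)|exact: (H p q x)
  |exact: (H p x q)|exact: (H x p q)|lra].
Qed.

Lemma null_sections K : measurable (K : set (measurableTypeR R * measurableTypeR R)) ->
  mu [set x | mu (xsection K x) != 0%E] = 0%E -> mu2 K = 0%E.
Proof.
move=> mK h.
have mf := measurable_fun_xsection mu mK.
transitivity (\int[mu]_(x in setT) (0 : \bar R))%E; last by rewrite integral0.
apply: ae_eq_integral => //.
exists [set x | mu (xsection K x) != 0%E]; split => //.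
  have -> : [set x | mu (xsection K x) != 0%E] = setT `&` (mu \o xsection K) @^-1` (~` [set 0%E]).
    by rewrite setTI; apply/seteqP; split => x /=; [move/eqP|move=> /eqP].
  by apply: mf => //; apply: measurableC; exact: emeasurable_set1.
by move=> x /= hx; apply/eqP => e; apply: hx => _.
Qed.

(** The vertical segment through (x, y) spans a triangle with a point on each side of it; together
    the two triangles contain a neighbourhood of (x, y). *)
Lemma convex_interior_of_cross K (x y x1 x2 u1 u2 y1 y2 : R) : convex_cell K ->
  K (x1, u1) -> K (x2, u2) -> K (x, y1) -> K (x, y2) ->
  x1 < x -> x < x2 -> y1 < y -> y < y2 -> K° (x, y).
Proof.
move=> [cK conv] K1 K2 Ky1 Ky2 lx1 lx2 ly1 ly2; apply/interior_boxP.
have side X U : K (X, U) -> X != x -> exists2 e : R, 0 < e & forall w : R * R,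
    0 <= (w.1 - x) / (X - x) -> `|w.1 - x| < e -> `|w.2 - y| < e -> K w.
  move=> KX Xx; have Xx0 : 0 < `|X - x| by rewrite normr_gt0 subr_eq0.
  (* Near abscissa x the vertical section of the triangle has ends [a] and [b] below; B bounds the
     slopes so that these ends move by at most m, while w.2 stays within m of y. *)
  pose m := Num.min (y - y1) (y2 - y) / 2.
  have m0 : 0 < m by rewrite divr_gt0// lt_min !subr_gt0 ly1.
  have m1 : y1 + m <= y - m.
    have : Num.min (y - y1) (y2 - y) <= y - y1 by rewrite ge_min lexx.
    by rewrite /m; move: (Num.min _ _) => a ?; lra.
  have m2 : y + m <= y2 - m.
    have : Num.min (y - y1) (y2 - y) <= y2 - y by rewrite ge_min lexx orbT.
    by rewrite /m; move: (Num.min _ _) => a ?; lra.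
  pose B := `|U - y1| + `|U - y2| + 1.
  have B0 : 0 < B by rewrite ltr_wpDl// addr_ge0.
  pose d := Num.min 1 (m / B).
  have d0 : 0 < d by rewrite lt_min ltr01 divr_gt0.
  exists (Num.min m (`|X - x| * d)); first by rewrite lt_min m0 mulr_gt0.
  move=> w; set s := (w.1 - x) / (X - x) => s0; rewrite !lt_min.
  move=> /andP[_ w1] /andP[w2 _].
  have sd : s < d.
    rewrite -(ger0_norm s0) /s normrM normfV ltr_pdivrMr// mulrC; exact: w1.
  have s1 : s < 1 by apply: (lt_le_trans sd); rewrite ge_min lexx.
  have sB : s * B <= m.
    by rewrite -ler_pdivlMr// (le_trans (ltW sd))// ge_min lexx orbT.
  have Xs : s * (X - x) = w.1 - x by rewrite /s mulfVK// subr_eq0.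
  have low : `|s * (U - y1)| <= m.
    rewrite normrM (ger0_norm s0); apply: le_trans sB; rewrite ler_wpM2l// /B.
    have := normr_ge0 (U - y2); lra.
  have upp : `|s * (U - y2)| <= m.
    rewrite normrM (ger0_norm s0); apply: le_trans sB; rewrite ler_wpM2l// /B.
    have := normr_ge0 (U - y1); lra.
  pose a := s * U + (1 - s) * y1; pose b := s * U + (1 - s) * y2.
  have Ka : K (w.1, a).
    have -> : w.1 = s * X + (1 - s) * x by rewrite -[LHS](subrK x) -Xs; ring.
    by apply: (conv (X, U) (x, y1)); rewrite ?s0 ?ltW.
  have Kb : K (w.1, b).
    have -> : w.1 = s * X + (1 - s) * x by rewrite -[LHS](subrK x) -Xs; ring.
    by apply: (conv (X, U) (x, y2)); rewrite ?s0 ?ltW.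
  have ab : 0 < b - a.
    have -> : b - a = (1 - s) * (y2 - y1) by rewrite /a /b; ring.
    by rewrite mulr_gt0//; lra.
  have aw : a <= w.2.
    move: low w2; rewrite /a ler_norml ltr_norml => /andP[? ?] /andP[? ?]; lra.
  have wb : w.2 <= b.
    move: upp w2; rewrite /b ler_norml ltr_norml => /andP[? ?] /andP[? ?]; lra.
  pose t := (b - w.2) / (b - a).
  have t0 : 0 <= t by rewrite divr_ge0 ?(ltW ab)// subr_ge0.
  have t1 : t <= 1 by rewrite ler_pdivrMr// mul1r lerD2l lerN2.
  have ht : t * (b - a) = b - w.2 by rewrite /t mulfVK// gt_eqF.
  have := conv (w.1, a) (w.1, b) t Ka Kb; rewrite t0 t1 => /(_ isT) /=.
  have -> : t * w.1 + (1 - t) * w.1 = w.1 by ring.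
  have -> : t * a + (1 - t) * b = w.2.
    have -> : t * a + (1 - t) * b = b - t * (b - a) by ring.
    by rewrite ht; ring.
  by rewrite -surjective_pairing.
have [e1 e10 h1] := side _ _ K1 (negbT (lt_eqF lx1)).
have [e2 e20 h2] := side _ _ K2 (negbT (gt_eqF lx2)).
exists (Num.min e1 e2); first by rewrite lt_min e10.
move=> w /=; rewrite !lt_min => /andP[a1 a2] /andP[b1 b2].
have [wx|/ltW xw] := leP w.1 x.
  apply: h1 => //; rewrite -mulrNN -invrN mulr_ge0 ?invr_ge0; lra.
by apply: h2 => //; rewrite mulr_ge0 ?invr_ge0; lra.
Qed.

(** By [convex_interior_of_cross], a vertical line with points of K on both sides meets the boundary
    part in at most two points. So at most two vertical sections can fail to be null. *)
Lemma convex_boundary_null K : convex_cell K -> mu2 (K `\` K°) = 0%E.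
Proof.
move=> cvK; have [cK conv] := cvK.
have mK := closed_measurable2 cK; have mi := open_measurable2 (open_interior K).
apply: null_sections; first exact: measurableD.
apply: few_points_null => x1 x x2 /= h1 h h2 lx1 lx2.
have ex (X : R) : mu (xsection (K `\` K°) X) != 0%E -> exists u, K (X, u).
  move=> hX; apply: contrapT => no; move/negP: hX; apply.
  rewrite (_ : xsection _ _ = set0) ?measure0//.
  by apply/seteqP; split => // u /xsectionP[Ku _]; apply: no; exists u.
have [u1 K1] := ex _ h1; have [u2 K2] := ex _ h2.
move/negP: h; apply; apply/eqP; apply: few_points_null => y1 y y2.
move=> /xsectionP[Ky1 _] /xsectionP[_ nK] /xsectionP[Ky2 _] ly1 ly2.
by apply: nK; exact: (convex_interior_of_cross cvK K1 K2 Ky1 Ky2).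
Qed.

Lemma enorm_le z : enorm z <= `|z.1| + `|z.2|.
Proof.
rewrite /enorm /dot -[leRHS]ger0_norm ?addr_ge0// -sqrtr_sqr ler_wsqrtr//.
have sq (t : R) : t * t = `|t| ^+ 2 by rewrite real_normK ?num_real// expr2.
rewrite sqrrD !sq.
have := mulr_ge0 (normr_ge0 z.1) (normr_ge0 z.2); lra.
Qed.

(** Contracting the inscribed disc towards p by a small factor l keeps it in the cell. *)
Lemma cell_interior_dense K sigma p (e : R) : convex_cell K -> shape_regular sigma K ->
  K p -> 0 < e -> exists q, [/\ K° q, `|q.1 - p.1| < e & `|q.2 - p.2| < e].
Proof.
move=> [_ conv] [c [r r0 [disc _]]] Kp e0.
pose B := `|c.1 - p.1| + `|c.2 - p.2| + 1.
have B0 : 0 < B by rewrite ltr_wpDl// addr_ge0.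
pose l := Num.min 1 (e / B).
have l0 : 0 < l by rewrite lt_min ltr01 divr_gt0.
have l1 : l <= 1 by rewrite ge_min lexx.
have lB : l * B <= e by rewrite -ler_pdivlMr// ge_min lexx orbT.
exists (p.1 + l * (c.1 - p.1), p.2 + l * (c.2 - p.2)); split.
(* A square of half-side r / 2 fits in the Euclidean disc of radius r. *)
- apply/interior_boxP; exists (l * (r / 2)); first by rewrite !mulr_gt0// divr_gt0.
  move=> w /= w1 w2; pose d1 := (w.1 - (p.1 + l * (c.1 - p.1))) / l.
  pose d2 := (w.2 - (p.2 + l * (c.2 - p.2))) / l.
  have D1 : `|d1| < r / 2 by rewrite /d1 normrM normfV (gtr0_norm l0) ltr_pdivrMr// (mulrC (r / 2)).
  have D2 : `|d2| < r / 2 by rewrite /d2 normrM normfV (gtr0_norm l0) ltr_pdivrMr// (mulrC (r / 2)).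
  have Kd : K (c.1 + d1, c.2 + d2).
    apply: disc => /=; apply: (le_lt_trans (enorm_le _)) => /=.
    have E (a b : R) : a + b - a = b by ring.
    by rewrite !E (splitr r) ltrD.
  have := conv _ _ l Kd Kp; rewrite l1 (ltW l0) => /(_ isT) /=.
  rewrite !mulrDr /d1 /d2 !(mulrC l (_ / l)) !mulfVK ?gt_eqF//.
  have -> : l * c.1 + (w.1 - (p.1 + l * (c.1 - p.1))) + (1 - l) * p.1 = w.1 by ring.
  have -> : l * c.2 + (w.2 - (p.2 + l * (c.2 - p.2))) + (1 - l) * p.2 = w.2 by ring.
  by rewrite -surjective_pairing.
- rewrite /= addrAC subrr add0r normrM (gtr0_norm l0); apply: lt_le_trans lB.
  by rewrite ltr_pM2l// /B; have := normr_ge0 (c.2 - p.2); lra.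
rewrite /= addrAC subrr add0r normrM (gtr0_norm l0); apply: lt_le_trans lB.
by rewrite ltr_pM2l// /B; have := normr_ge0 (c.1 - p.1); lra.
Qed.

End convex_cells.

Section polynomials.
Context {R : realType}.
Implicit Types (z p : R * R).

Lemma Ck1_exp (i k : nat) : Ck1 k (fun t : R => t ^+ i).
Proof.
elim: i k => [|i ih] k; first exact: Ck1_cst.
have idk j : Ck1 j (fun t : R => t).
  case: j => [|j]; first by split => // t; exact: cvg_id.
  by apply: (@Ck1S_is_derive _ _ _ (cst 1)); exact: Ck1_cst.
have -> : (fun t : R => t ^+ i.+1) = (fun t => t * t ^+ i).
  by apply/funext => t; rewrite exprS.
exact: Ck1_mul.
Qed.

Lemma smooth_poly_eval (k : nat) (c : nat -> nat -> R) : smooth (poly_eval k c).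
Proof.
apply: smooth_sum => i _; apply: smooth_sum => j _.
apply: smoothM; last by move=> l; apply: (@Ck_snd_comp _ _ (fun t => t ^+ j)); exact: Ck1_exp.
apply: smoothM; first exact: smooth_cst.
by move=> l; apply: (@Ck_fst_comp _ _ (fun t => t ^+ i)); exact: Ck1_exp.
Qed.

Lemma smooth_second_bound (I : finType) (P : I -> R * R -> R) (M : R) :
  (forall i, smooth (P i)) -> exists2 L, 0 <= L & forall i, second_bound (P i) M L.
Proof.
move=> sP.
have h i : exists L, 0 <= L /\ second_bound (P i) M L.
  have sx := smooth_pdx (sP i); have sy := smooth_pdy (sP i).
  have [c1 c10 h1] := continuous_bounded_cbox M (smooth_continuous (smooth_pdx sx)).
  have [c2 c20 h2] := continuous_bounded_cbox M (smooth_continuous (smooth_pdy sx)).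
  have [c3 c30 h3] := continuous_bounded_cbox M (smooth_continuous (smooth_pdx sy)).
  have [c4 c40 h4] := continuous_bounded_cbox M (smooth_continuous (smooth_pdy sy)).
  exists (c1 + c2 + c3 + c4); split; first by rewrite !addr_ge0.
  move=> z z1 z2; split.
  - by apply: (le_trans (h1 z z1 z2)); lra.
  - by apply: (le_trans (h2 z z1 z2)); lra.
  - by apply: (le_trans (h3 z z1 z2)); lra.
  - by apply: (le_trans (h4 z z1 z2)); lra.
pose L i := projT1 (cid (h i)).
have L0 i : 0 <= L i by case: (projT2 (cid (h i))).
have hL i : second_bound (P i) M (L i) by case: (projT2 (cid (h i))).
exists (\sum_i L i); first exact: sumr_ge0.
have LS i : L i <= \sum_i L i.
  by rewrite (bigD1 i)//= lerDl sumr_ge0.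
move=> i z z1 z2; have [b1 b2 b3 b4] := hL i z z1 z2.
by split; [exact: (le_trans b1 (LS i))|exact: (le_trans b2 (LS i))|
  exact: (le_trans b3 (LS i))|exact: (le_trans b4 (LS i))].
Qed.

End polynomials.

(** * Gradients of finite element functions on cells and on the boundary *)

Section gradient.
Context {R : realType} (Om : set (R * R)) (m k : nat) (sigma : R).
Variables (T : 'I_m -> set (R * R)) (v g1 g2 : R * R -> R).
Implicit Types (z p : R * R).
Hypothesis oOm : open Om.
Hypothesis bOm : bounded_set Om.
Hypothesis hT : shape_regular_partition Om sigma T.
Hypothesis c1 : {within closure Om, continuous g1}.
Hypothesis c2 : {within closure Om, continuous g2}.
Hypothesis dv : forall z, Om z ->
  is_derive z.1 1 (fun t => v (t, z.2)) (g1 z) /\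
  is_derive z.2 1 (fun t => v (z.1, t)) (g2 z).
Variable P : 'I_m -> R * R -> R.
Hypothesis sP : forall i, smooth (P i).
Hypothesis hP : forall i z, T i z -> v z = P i z.

Lemma zero_of_dense_zeros (A : set (R * R)) (h : R * R -> R) z :
  h x @[x --> within A (nbhs z)] --> h z ->
  (forall e, 0 < e -> exists w, [/\ A w, h w = 0, `|w.1 - z.1| < e & `|w.2 - z.2| < e]) ->
  h z = 0.
Proof.
move=> ch dz; apply/eqP; apply: contrapT => /negP hz.
have : within A (nbhs z) [set w | h w != 0] by exact: (cvgr_neq0 _ ch).
rewrite /within /= => -[[U1 U2] /= [n1 n2] hU].
have [e1 /= e10 h1] := n1; have [e2 /= e20 h2] := n2.
have [|w [Aw w0 w1 w2]] := dz (Num.min e1 e2); first by rewrite lt_min e10.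
move: w1 w2; rewrite !lt_min => /andP[w1 _] /andP[_ w2].
have := hU w; rewrite w0 eqxx => H; apply: notF; apply: H => //; split.
  by apply: h1; rewrite /= distrC.
by apply: h2; rewrite /= distrC.
Qed.

Lemma closure_near (A : set (R * R)) z (U : set (R * R)) : closure A z -> open U -> U z ->
  exists w, A w /\ U w.
Proof.
by move=> cz oU Uz; have [w []] := cz U (open_nbhs_nbhs (conj oU Uz)); exists w.
Qed.

Lemma cell_closure i z : T i z -> closure Om z.
Proof. by have [_ _ _ ->] := hT; exists i. Qed.

(** Clear at points of the domain interior to the cell; these are dense in the cell and both sides
    are continuous. *)
Lemma cell_gradient i z : T i z -> g1 z = pdx (P i) z /\ g2 z = pdy (P i) z.
Proof.
move=> Tz; have [cv sr _ _] := hT.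
have cz := cell_closure Tz.
(* Interior points of a cell are only known to lie in the closure of [Om], hence the second
   approximation. *)
have dense e : 0 < e -> exists w, [/\ Om w, (T i)° w, `|w.1 - z.1| < e & `|w.2 - z.2| < e].
  move=> e0; have [q [Kq q1 q2]] := cell_interior_dense (cv i) (sr i) Tz e0.
  pose U := (T i)° `&` [set w : R * R | `|w.1 - z.1| < e /\ `|w.2 - z.2| < e].
  have oU : open U.
    apply: openI; first exact: open_interior.
    have oA : open [set w : R * R | `|w.1 - z.1| < e].
      apply: (@open_comp _ _ (fun w : R * R => `|w.1 - z.1|) [set t | t < e]).
        move=> w _; apply: cvg_norm; apply: cvgB; [exact: cvg_fst|exact: cvg_cst].
      exact: open_lt.
    have oB : open [set w : R * R | `|w.2 - z.2| < e].
      apply: (@open_comp _ _ (fun w : R * R => `|w.2 - z.2|) [set t | t < e]).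
        move=> w _; apply: cvg_norm; apply: cvgB; [exact: cvg_snd|exact: cvg_cst].
      exact: open_lt.
    exact: openI.
  have [w [Ow [Tw [w1 w2]]]] := closure_near (cell_closure (interior_subset Kq)) oU
    (conj Kq (conj q1 q2)).
  by exists w.
have dP w : Om w -> (T i)° w -> g1 w = pdx (P i) w /\ g2 w = pdy (P i) w.
  move=> Ow Tw; have [d1 d2] := dv Ow; split.
    rewrite -(pdx_is d1); apply: (pdx_near (open_interior (T i)) Tw) => q Tq.
    by apply: hP; exact: interior_subset Tq.
  rewrite -(pdy_is d2); apply: (pdy_near (open_interior (T i)) Tw) => q Tq.
  by apply: hP; exact: interior_subset Tq.
have G (g d : R * R -> R) : {within closure Om, continuous g} -> smooth d ->
    (forall w, Om w -> (T i)° w -> g w = d w) -> g z = d z.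
  move=> cg sd h; apply/eqP; rewrite -subr_eq0; apply/eqP.
  apply: (@zero_of_dense_zeros (closure Om) (fun w => g w - d w)).
    apply: cvgB; first by move/subspace_continuousP: cg; exact.
    by apply: cvg_within_filter; exact: (smooth_continuous sd).
  move=> e e0; have [w [Ow Tw w1 w2]] := dense e e0.
  by exists w; split => //; [exact: subset_closure|rewrite h// subrr].
split.
  by apply: G => //; [exact: smooth_pdx|move=> w Ow Tw; case: (dP w Ow Tw)].
by apply: G => //; [exact: smooth_pdy|move=> w Ow Tw; case: (dP w Ow Tw)].
Qed.

Hypothesis v0 : forall p, boundary Om p -> v p = 0.
Hypothesis nv : normal_derivative_vanishes Om v.

Lemma norm_le_enorm z : `|z.1| + `|z.2| <= 2 * enorm z.
Proof.
have s0 : 0 <= dot z z by rewrite /dot -!expr2 addr_ge0 ?sqr_ge0.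
have H t : t ^+ 2 <= dot z z -> `|t| <= enorm z.
  by move=> ht; rewrite -sqrtr_sqr ler_wsqrtr.
have h1 : `|z.1| <= enorm z by apply: H; rewrite /dot -!expr2 lerDl sqr_ge0.
have h2 : `|z.2| <= enorm z by apply: H; rewrite /dot -!expr2 lerDr sqr_ge0.
lra.
Qed.

Lemma boundary_gradient p : boundary Om p -> g1 p = 0 /\ g2 p = 0.
Proof.
move=> bp; have [cv sr _ cO] := hT; have [cp ip] := bp.
pose a := g1 p; pose b := g2 p; pose n0 := Num.sqrt (a ^+ 2 + b ^+ 2).
have s0 : 0 <= a ^+ 2 + b ^+ 2 by rewrite addr_ge0 ?sqr_ge0.
have [n_0|nn0] := eqVneq n0 0.
  have : a ^+ 2 + b ^+ 2 = 0 by rewrite -(sqr_sqrtr s0) -/n0 n_0 expr0n.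
  move/eqP; rewrite paddr_eq0 ?sqr_ge0// !sqrf_eq0 => /andP[/eqP ? /eqP ?].
  by split.
have n00 : 0 < n0 by rewrite lt_neqAle eq_sym nn0 sqrtr_ge0.
have n02 : n0 ^+ 2 = a ^+ 2 + b ^+ 2 by rewrite sqr_sqrtr.
pose n : R * R := (a / n0, b / n0).
have [M' M0 hM] := bounded_cbox bOm.
pose M := `|p.1| + `|p.2| + 1.
have [L L0 hL] := smooth_second_bound M sP.
have un : unit_normal Om p n.
  split.
    rewrite /enorm /dot /= (_ : _ + _ = 1) ?sqrtr1//.
    have -> : a / n0 * (a / n0) + b / n0 * (b / n0) = (a ^+ 2 + b ^+ 2) / n0 ^+ 2.
      by field.
    by rewrite n02 divff// -n02 expf_neq0.
  (* The 1 keeps x in the square where L bounds second derivatives; the other bound makes the Taylor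
     remainder at most [e * n0 * |x - p|]. *)
  move=> e e0; pose d := Num.min 1 (e * n0 / (2 * L + 1)).
  have L1 : 0 < 2 * L + 1 by rewrite ltr_wpDl// mulr_ge0.
  have d0 : 0 < d by rewrite lt_min ltr01 divr_gt0// mulr_gt0.
  (* Cells are closed and finitely many, so near p each boundary point shares a cell with p, and one
     polynomial expands v from p to x. As v is 0 at both, the linear term is of the size of the
     remainder. *)
  have near1 : \forall x \near nbhs p, forall i, T i x -> T i p.
    apply: (@filter_forall _ _ (fun i x => T i x -> T i p) (nbhs p)) => i.
    have [Tp|nTp] := pselect (T i p); first by apply: nearW.
    have : nbhs p (~` T i).
      by apply: open_nbhs_nbhs; split => //; apply: closed_openC; case: (cv i).
    by apply: filterS => x nx Tx.
  have near2 : \forall x \near nbhs p, `|x.1 - p.1| + `|x.2 - p.2| < d.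
    have : (fun x : R * R => `|x.1 - p.1| + `|x.2 - p.2|) x @[x --> p] -->
      `|p.1 - p.1| + `|p.2 - p.2|.
      apply: cvgD; apply: cvg_norm; apply: cvgB.
      - exact: cvg_fst.
      - exact: cvg_cst.
      - exact: cvg_snd.
      - exact: cvg_cst.
    rewrite !subrr normr0 addr0 => h; exact: (cvgr_lt _ h).
  rewrite /within/=; apply: filterS2 near1 near2 => x n1 n2 bx.
  have [cx _] := bx; have [i _ Tx] : (\bigcup_i T i) x by rewrite -cO.
  have Tp := n1 i Tx.
  have [gx gy] := cell_gradient Tp.
  have hL' : forall _ : unit, second_bound (P i) M L by [].
  have xd (t u : R) : `|t - u| < 1 -> `|t| <= `|u| + 1.
    move=> tu; have -> : t = (t - u) + u by ring.
    by apply: (le_trans (ler_normD _ _)); rewrite addrC lerD2l ltW.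
  have x1 : `|x.1| <= M.
    have h : `|x.1 - p.1| < 1.
      move: n2; rewrite lt_min => /andP[n2 _]; apply: le_lt_trans n2.
      by rewrite lerDl.
    by apply: (le_trans (xd _ _ h)); rewrite /M; have := normr_ge0 p.2; lra.
  have x2 : `|x.2| <= M.
    have h : `|x.2 - p.2| < 1.
      move: n2; rewrite lt_min => /andP[n2 _]; apply: le_lt_trans n2.
      by rewrite lerDr.
    by apply: (le_trans (xd _ _ h)); rewrite /M; have := normr_ge0 p.1; lra.
  have p1 : `|p.1| <= M by rewrite /M; have := normr_ge0 p.2; lra.
  have p2 : `|p.2| <= M by rewrite /M; have := normr_ge0 p.1; lra.
  have := piecewise_taylor (smooth_piecewise (sP i)) L0 hL' x1 x2 p1 p2.
  rewrite -(hP Tx) -(hP Tp) v0// v0// -gx -gy -/a -/b subrr sub0r => h.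
  have -> : dot (x - p) n = - (- (a * (x.1 - p.1)) - b * (x.2 - p.2)) / n0.
    by rewrite /dot /=; field.
  rewrite normrM normrN normfV (gtr0_norm n00) ler_pdivrMr//.
  apply: (le_trans h); have e2 := norm_le_enorm (x - p).
  have d2 : L * 2 * (`|x.1 - p.1| + `|x.2 - p.2|) <= e * n0.
    have : `|x.1 - p.1| + `|x.2 - p.2| <= e * n0 / (2 * L + 1).
      by apply: (le_trans (ltW n2)); rewrite ge_min lexx orbT.
    rewrite ler_pdivlMr// => h2; apply: le_trans h2.
    by have := addr_ge0 (normr_ge0 (x.1 - p.1)) (normr_ge0 (x.2 - p.2)); lra.
  move: e2 d2; rewrite /=.
  have := addr_ge0 (normr_ge0 (x.1 - p.1)) (normr_ge0 (x.2 - p.2)).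
  have := sqrtr_ge0 (dot (x - p) (x - p)); rewrite -/(enorm (x - p)).
  move: (`|x.1 - p.1| + `|x.2 - p.2|) (enorm _) => r s s0' r0 rs rd.
  rewrite expr2 mulrA; apply: (@le_trans _ _ (L * r * (2 * s))).
    by rewrite ler_wpM2l// mulr_ge0.
  have -> : L * r * (2 * s) = (L * 2 * r) * s by ring.
  by rewrite (mulrAC e) ler_wpM2r.
exfalso.
have := nv bp un => lim0.
(* Along its own direction the gradient has derivative n0, its length, which is not 0. *)
have lim1 : (fun z => dot (pdx v z, pdy v z) n) x @[x --> within Om (nbhs p)] --> n0.
  have -> : n0 = dot (g1 p, g2 p) n.
    rewrite /dot /= -/a -/b; have : n0 * n0 = a ^+ 2 + b ^+ 2 by rewrite -expr2.
    by move=> e; rewrite !mulrA -mulrDl -!expr2 -e mulfK.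
  apply: (@cvg_trans _ ((fun z => dot (g1 z, g2 z) n) x @[x --> within Om (nbhs p)])).
    apply: near_eq_cvg; rewrite near_withinE; apply: nearW => x Ox.
    by have [d1 d2] := dv Ox; rewrite (pdx_is d1) (pdy_is d2).
  have sub (g : R * R -> R) : {within closure Om, continuous g} ->
    g x @[x --> within Om (nbhs p)] --> g p.
    move=> cg; move/subspace_continuousP: cg => /(_ p cp); apply: cvg_trans => A.
    move=> H; change (nbhs p (fun x => Om x -> A (g x))).
    apply: filterS (H : nbhs p (fun x => closure Om x -> A (g x))) => x hx Ox.
    by apply: hx; exact: subset_closure.
  by rewrite /dot /=; apply: cvgD; apply: cvgM; (exact: cvg_cst || exact: sub).
have pf : ProperFilter (within Om (nbhs p)) by exact: within_nbhs_proper.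
have e : 0 = n0 by exact: (cvg_unique (@norm_hausdorff _ _) lim0 lim1).
by move/eqP: nn0; apply.
Qed.

End gradient.

(** * Compactly supported smooth quasi-interpolation *)

Section quasi_interpolant.
Context {R : realType} (Om : set (R * R)) (I : finType).
Variables (K : I -> set (R * R)) (P : I -> R * R -> R) (v G1 G2 : R * R -> R).
Implicit Types (z a w : R * R).
Hypothesis oOm : open Om.
Hypothesis pw : piecewise_smooth K P v G1 G2.
Hypothesis out : forall a, ~ Om a -> [/\ v a = 0, G1 a = 0 & G2 a = 0].
Hypothesis uniq_cell : forall i k z, Om z -> K i z -> (K k)° z -> i = k.
Variables (M L C : R).
Hypothesis M0 : 0 < M.
Hypothesis OM : forall z, Om z -> `|z.1| < M /\ `|z.2| < M.
Hypothesis L0 : 0 <= L.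
Hypothesis hL : forall i, second_bound (P i) (M + 2) L.
Hypothesis hC : forall t, [/\ `|weight (@smooth_step R) t| <= C,
  `|weight (derive1 (@smooth_step R)) t| <= C &
  `|weight (derive1 (derive1 (@smooth_step R))) t| <= C].

Let cov z : exists i, K i z. Proof. by case: pw. Qed.
Let sP i : smooth (P i). Proof. by case: pw. Qed.
Let hP i z : K i z -> [/\ v z = P i z, G1 z = pdx (P i) z & G2 z = pdy (P i) z].
Proof. by case: pw => _ _ _ h _; exact: h. Qed.

Definition cell_of z : I := projT1 (cid (cov z)).

Lemma cell_ofP z : K (cell_of z) z.
Proof. exact: projT2 (cid (cov z)). Qed.

Variable N : R.
Hypothesis N1 : 1 <= N.

Let N0 : 0 < N. Proof. exact: lt_le_trans N1. Qed.

Definition node (i : nat) : R := i%:R / N - M.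
Definition support_box (i j : nat) : set (R * R) :=
  `[node i - N^-1, node i + N^-1]%classic `*` `[node j - N^-1, node j + N^-1]%classic.

Lemma support_boxP i j w : support_box i j w <->
  `|w.1 - node i| <= N^-1 /\ `|w.2 - node j| <= N^-1.
Proof.
have E (x y : R) : (x \in `[y - N^-1, y + N^-1]) = (`|x - y| <= N^-1).
  by rewrite in_itv/= ler_norml; apply/andP/andP => -[? ?]; split; lra.
by split => [[/=]|[h1 h2]]; rewrite ?E //; split; rewrite /= E.
Qed.

(** Dropping boxes that leave [Om] makes the blend a test function. Any cell containing the node
    will do, since v has the jet of its polynomial there. *)
Definition local_poly (i j : nat) : R * R -> R :=
  if `[< support_box i j `<=` Om >] then P (cell_of (node i, node j)) else cst 0.

Definition grid_size : nat := (Num.truncn (2 * M * N)).+3.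

Definition quasi_interp : R * R -> R :=
  blend N (N * M) grid_size smooth_step smooth_step local_poly.

Lemma smooth_local_poly i j : smooth (local_poly i j).
Proof. by rewrite /local_poly; case: ifP => _ //; exact: smooth_cst. Qed.

Let affineE (x : R) (i : nat) : N * x + (N * M - i%:R) = N * (x - node i).
Proof. by rewrite /node; field; rewrite gt_eqF. Qed.

Let far (x y : R) : ~ (`|x - y| <= N^-1) -> 1 <= `|N * (x - y)|.
Proof.
move=> /negP; rewrite -ltNge => h.
by rewrite normrM (gtr0_norm N0) -ler_pdivrMl// mulr1 ltW.
Qed.

Lemma test_sum (J : Type) (s : seq J) (F : J -> R * R -> R) :
  (forall i, test_function Om (F i)) -> test_function Om (fun z => \sum_(i <- s) F i z).
Proof.
move=> hF; elim: s => [|i s ih].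
  have -> : (fun z => \sum_(i <- [::]) F i z) = cst 0 by apply/funext => z; rewrite big_nil.
  exact: test_cst0.
have -> : (fun z => \sum_(j <- i :: s) F j z) = lincomb 1 (F i) (fun z => \sum_(j <- s) F j z).
  by apply/funext => z; rewrite /lincomb big_cons mul1r.
exact: test_lincomb.
Qed.

Lemma test_quasi_interp : test_function Om quasi_interp.
Proof.
have S0 := @step_smooth_step R; have [s0 _ _] := S0.
apply: test_sum => i; apply: test_sum => j; rewrite /local_poly.
case: asboolP => hb; last first.
  have -> : (fun z => wx N (N * M) smooth_step i z *
      (wy N (N * M) smooth_step j z * cst 0 z)) = cst 0.
    by apply/funext => z; rewrite /= !mulr0.
  exact: test_cst0.
apply: (test_of_support (K := support_box i j)) => //.
- exact: (@smooth_blend_term R N (N * M) _ _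
    (fun i j => P (cell_of (node i, node j))) i j s0 s0 (sP _)).
- by apply: compact_setX; exact: segment_compact.
move=> z nz; have [h1|h1] := pselect (`|z.1 - node i| <= N^-1).
  have h2 : ~ (`|z.2 - node j| <= N^-1) by move=> h2; apply: nz; apply/support_boxP.
  by rewrite /wy affineE (weight_out S0) ?mul0r ?mulr0//; exact: far.
by rewrite /wx affineE (weight_out S0) ?mul0r//; exact: far.
Qed.

Lemma grid_index (x : R) : `|x| < M -> exists l : nat,
  [/\ l%:R <= N * x + N * M <= l.+1%:R, (l.+1 < grid_size)%N &
    forall i, (l <= i <= l.+1)%N -> `|x - node i| <= N^-1].
Proof.
rewrite ltr_norml => /andP[x1 x2].
have t0 : 0 <= N * x + N * M by rewrite -mulrDr mulr_ge0 ?(ltW N0)//; lra.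
have /andP[h1 h2] := Num.Theory.truncn_itv t0.
exists (Num.truncn (N * x + N * M)); split.
- by rewrite h1 ltW.
- rewrite /grid_size !ltnS; apply: leqW; apply: Num.Theory.le_truncn.
  have -> : 2 * M * N = N * (M + M) by ring.
  by rewrite -mulrDr ler_pM2l//; lra.
move=> i; move: (Num.truncn _) h1 h2 => l h1 h2 /andP[li il].
rewrite -(ler_pM2l N0) divff ?gt_eqF// -[X in X * `|_|](gtr0_norm N0) -normrM.
have -> : N * (x - node i) = N * x + N * M - i%:R by rewrite -affineE addrA.
have : l%:R <= i%:R :> R by rewrite ler_nat.
have : i%:R <= l.+1%:R :> R by rewrite ler_nat.
move: h2; rewrite -natr1 ler_norml => *; apply/andP; split; lra.
Qed.

Let iN0 : 0 < N^-1. Proof. by rewrite invr_gt0. Qed.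
Let iN1 : N^-1 <= 1. Proof. by rewrite invf_le1. Qed.

(** In both cases the local function shares its value and gradient with v at some point a near z,
    and [jet_close] applies with |z - a|_1 <= 4 / N; thus 32 L = 2 L 4^2. The point a may lie
    outside [Om], within 2 / N <= 2 of z, hence the square of half-side M + 2. *)
Lemma local_poly_jet i j z : Om z -> `|z.1 - node i| <= N^-1 -> `|z.2 - node j| <= N^-1 ->
  [/\ `|local_poly i j z - v z| <= 32 * L / N ^+ 2,
      `|pdx (local_poly i j) z - G1 z| <= 32 * L / N,
      `|pdy (local_poly i j) z - G2 z| <= 32 * L / N &
      second_close (local_poly i j) z 0 0 0 0 (32 * L)].
Proof.
move=> Oz hi hj; have [z1 z2] := OM Oz.
have iNp := iN0; have iNl := iN1; have l0 := L0.
have L32 : L <= 32 * L by rewrite ler_peMl// ler1n.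
have L032 : 0 <= 32 * L by rewrite mulr_ge0.
(* The point a is the node for a kept box, and for a dropped box a point of it outside [Om], where
   v, its gradient and the local function all vanish. *)
have [a [a1 a2 [e0 e1 e2]]] : exists a, [/\ `|z.1 - a.1| <= 2 / N, `|z.2 - a.2| <= 2 / N &
    [/\ v a = local_poly i j a, G1 a = pdx (local_poly i j) a &
        G2 a = pdy (local_poly i j) a]].
  rewrite /local_poly; case: asboolP => hb.
    exists (node i, node j) => /=; split; [lra|lra|exact: hP (cell_ofP _)].
  have [a [ba na]] : exists a, support_box i j a /\ ~ Om a.
    apply: contrapT => no; apply: hb => w bw; apply: contrapT => nw.
    by apply: no; exists w.
  have [b1 b2] := (support_boxP i j a).1 ba.
  exists a; have [-> -> ->] := out na; split.
  - by move: hi b1; rewrite !ler_norml => /andP[? ?] /andP[? ?]; apply/andP; split; lra.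
  - by move: hj b2; rewrite !ler_norml => /andP[? ?] /andP[? ?]; apply/andP; split; lra.
  by rewrite pdx_cst pdy_cst.
have sb : second_bound (local_poly i j) (M + 2) L.
  rewrite /local_poly; case: ifP => _; first exact: hL.
  by move=> w _ _; rewrite !(pdx_cst, pdy_cst) /= normr0.
have M1 (x : R) : `|x| < M -> `|x| <= M + 2 by move=> /ltW h; lra.
have M2 (x y : R) : `|x| < M -> `|x - y| <= 2 / N -> `|y| <= M + 2.
  move=> xM xy; have -> : y = x - (x - y) by ring.
  by apply: (le_trans (ler_normB _ _)); lra.
have [j0 j1 j2] := jet_close pw L0 hL (smooth_local_poly i j) sb e0 e1 e2
  (M1 _ z1) (M1 _ z2) (M2 _ _ z1 a1) (M2 _ _ z2 a2).
have d4 : `|z.1 - a.1| + `|z.2 - a.2| <= 4 / N by lra.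
have d0 : 0 <= `|z.1 - a.1| + `|z.2 - a.2| by exact: addr_ge0.
have b1 x : x <= 2 * L * (`|z.1 - a.1| + `|z.2 - a.2|) -> x <= 32 * L / N.
  move=> h; apply: (le_trans h); apply: (@le_trans _ _ (2 * L * (4 / N))).
    by rewrite ler_wpM2l// mulr_ge0.
  by have := mulr_ge0 L0 (ltW iN0); lra.
split; [|exact: b1|exact: b1|].
  apply: (le_trans j0); apply: (@le_trans _ _ (2 * L * (4 / N) ^+ 2)).
    by rewrite ler_wpM2l ?mulr_ge0// lerXn2r// nnegrE// divr_ge0// ltW.
  by rewrite le_eqVlt; apply/orP; left; apply/eqP; field; rewrite gt_eqF.
have [s1 s2 s3 s4] := sb z (M1 _ z1) (M1 _ z2).
split; rewrite subr0; [exact: (le_trans s1 L32)|exact: (le_trans s2 L32)|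
  exact: (le_trans s3 L32)|exact: (le_trans s4 L32)].
Qed.

(** Free of N: this bound is what dominates the approximants. *)
Definition Kb : R := 16 * C ^+ 2 * (32 * L).

Lemma quasi_interp_bound z : Om z ->
  [/\ `|quasi_interp z - v z| <= Kb, `|pdx quasi_interp z - G1 z| <= Kb,
      `|pdy quasi_interp z - G2 z| <= Kb & second_close quasi_interp z 0 0 0 0 Kb].
Proof.
move=> Oz; have [z1 z2] := OM Oz.
have [k [hk kn nk]] := grid_index z1; have [l [hl ln nl]] := grid_index z2.
apply: (blend_jet N1 _ hC smooth_local_poly hk hl kn ln); first by rewrite mulr_ge0.
by move=> i j hi hj; apply: local_poly_jet => //; [exact: nk|exact: nl].
Qed.

(** Well inside a cell every active node lies in that cell and keeps its box, so all active local
    functions are P k. A partition of unity reproduces it: [blend_jet] with eta = 0. *)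
Lemma quasi_interp_exact k z e : 0 < e -> Om z -> 2 / N < e ->
  (forall w, `|w.1 - z.1| < e -> `|w.2 - z.2| < e -> Om w /\ (K k)° w) ->
  [/\ quasi_interp z = P k z, pdx quasi_interp z = pdx (P k) z,
      pdy quasi_interp z = pdy (P k) z &
      [/\ pdx (pdx quasi_interp) z = pdx (pdx (P k)) z,
          pdy (pdx quasi_interp) z = pdy (pdx (P k)) z,
          pdx (pdy quasi_interp) z = pdx (pdy (P k)) z &
          pdy (pdy quasi_interp) z = pdy (pdy (P k)) z]].
Proof.
move=> e0 Oz Ne he; have [z1 z2] := OM Oz.
have [k1 [hk kn nk]] := grid_index z1; have [l1 [hl ln nl]] := grid_index z2.
have eq i j : (k1 <= i <= k1.+1)%N -> (l1 <= j <= l1.+1)%N -> local_poly i j = P k.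
  move=> /nk hi /nl hj; rewrite /local_poly.
  have near (x y t : R) : `|x - y| <= N^-1 -> `|t - y| <= N^-1 -> `|t - x| < e.
    move=> h1 h2; apply: le_lt_trans Ne; move: h1 h2.
    by rewrite !ler_norml => /andP[? ?] /andP[? ?]; apply/andP; split; lra.
  have hb : support_box i j `<=` Om.
    move=> w /support_boxP[w1 w2].
    by have [] := he w (near _ _ _ hi w1) (near _ _ _ hj w2).
  rewrite asboolT//; congr P.
  have [Oc Kc] : Om (node i, node j) /\ (K k)° (node i, node j).
    apply: he => /=; [apply: (near _ _ _ hi)|apply: (near _ _ _ hj)];
      by rewrite subrr normr0 ltW.
  exact: uniq_cell Oc (cell_ofP _) Kc.
have Z0 (x : R) : `|x - x| <= 0 by rewrite subrr normr0.
have [|] := @blend_jet R N (N * M) grid_size C 0 (P k z) (pdx (P k) z) (pdy (P k) z)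
  (pdx (pdx (P k)) z) (pdy (pdx (P k)) z) (pdx (pdy (P k)) z) (pdy (pdy (P k)) z)
  local_poly z k1 l1 N1 (lexx 0) hC smooth_local_poly hk hl kn ln.
  move=> i j hi hj; rewrite (eq i j hi hj) !mul0r.
  by split; [exact: Z0|exact: Z0|exact: Z0|split; exact: Z0].
rewrite mulr0 -/quasi_interp => h1 h2 h3 [h4 h5 h6 h7].
have Z (x y : R) : `|x - y| <= 0 -> x = y by rewrite normr_le0 subr_eq0 => /eqP.
split; [exact: (Z _ _ h1)|exact: (Z _ _ h2)|exact: (Z _ _ h3)|].
split; [exact: (Z _ _ h4)|exact: (Z _ _ h5)|exact: (Z _ _ h6)|exact: (Z _ _ h7)].
Qed.

End quasi_interpolant.

Lemma eventually7 (A0 A1 A2 A3 A4 A5 A6 : nat -> Prop) :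
  (\forall n \near \oo, A0 n) -> (\forall n \near \oo, A1 n) ->
  (\forall n \near \oo, A2 n) -> (\forall n \near \oo, A3 n) ->
  (\forall n \near \oo, A4 n) -> (\forall n \near \oo, A5 n) ->
  (\forall n \near \oo, A6 n) ->
  exists n, A0 n /\ ([/\ A1 n, A2 n & A3 n] /\ [/\ A4 n, A5 n & A6 n]).
Proof.
move=> h0 h1 h2 h3 h4 h5 h6; near \oo => n; exists n.
split; [near: n; exact: h0|split].
  by split; near: n; [exact: h1|exact: h2|exact: h3].
by split; near: n; [exact: h4|exact: h5|exact: h6].
Unshelve. all: by end_near. Qed.

(** * Convergence of the quasi-interpolants in H^2 *)

Section piecewise_H20.
Context {R : realType} (Om : set (R * R)) (I : finType).
Local Notation mu2 := (@lebesgue_measure R \x @lebesgue_measure R)%E.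
Variables (K : I -> set (R * R)) (P : I -> R * R -> R) (v G1 G2 : R * R -> R).
Implicit Types (z a w : R * R) (D : (R * R -> R) -> R * R -> R).
Hypothesis oOm : open Om.
Hypothesis bOm : bounded_set Om.
Hypothesis pw : piecewise_smooth K P v G1 G2.
Hypothesis out : forall a, ~ Om a -> [/\ v a = 0, G1 a = 0 & G2 a = 0].
Hypothesis uniq_cell : forall i k z, Om z -> K i z -> (K k)° z -> i = k.
Hypothesis ae_cell : {ae mu2, forall z, Om z -> exists k, (K k)° z}.

Let mOm : measurable (Om : set (measurableTypeR R * measurableTypeR R)).
Proof. exact: open_measurable2. Qed.

Let fOm : (mu2 Om < +oo)%E.
Proof. exact: bounded_measure_lty. Qed.

Lemma family_bounded (u : I -> R * R -> R) : (forall i, smooth (u i)) ->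
  exists2 B, 0 <= B & forall i z, Om z -> `|u i z| <= B.
Proof.
move=> su; have [M M0 OM] := bounded_cbox bOm.
have h i : exists c, 0 <= c /\ forall z, Om z -> `|u i z| <= c.
  have [c c0 hc] := continuous_bounded_cbox M (smooth_continuous (su i)).
  by exists c; split => // z /OM[z1 z2]; apply: hc; exact: ltW.
pose c i := projT1 (cid (h i)).
have c0 i : 0 <= c i by case: (projT2 (cid (h i))).
have hc i z : Om z -> `|u i z| <= c i by case: (projT2 (cid (h i))) => _; apply.
exists (\sum_i c i); first exact: sumr_ge0.
move=> i z Oz; apply: (le_trans (hc i z Oz)).
by rewrite (bigD1 i)//= lerDl sumr_ge0.
Qed.

(** The cellwise derivative of v, up to a null set, written as a sum that is visibly measurable. *)
Definition gfield D z : R := \sum_i \1_((K i)°) z * D (P i) z.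

Lemma gfield_in D z k : Om z -> (K k)° z -> gfield D z = D (P k) z.
Proof.
move=> Oz Kz; rewrite /gfield (bigD1 k)//= big1 => [|i /eqP ik].
  by rewrite indicE mem_set// mul1r addr0.
rewrite indicE memNset ?mul0r// => Ki; apply: ik.
by apply: uniq_cell Oz _ Kz; exact: interior_subset Ki.
Qed.

Lemma gfield_bounded D : (forall i, smooth (D (P i))) ->
  exists B, forall z, Om z -> `|gfield D z| <= B.
Proof.
move=> sD; have [B B0 hB] := family_bounded sD.
exists (\sum_(i : I) B) => z Oz; apply: (le_trans (ler_norm_sum _ _ _)).
apply: ler_sum => i _; rewrite normrM -[leRHS]mul1r ler_pM//; last exact: hB.
by rewrite indicE; case: (_ \in _); rewrite ?normr1 ?normr0.
Qed.

Lemma L2_gfield D : (forall i, smooth (D (P i))) -> L2 Om (gfield D).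
Proof.
move=> sD; have [B hB] := gfield_bounded sD.
apply: (@L2_bounded _ _ mOm _ B) => //.
rewrite /gfield; apply: measurable_sum => i; apply: measurable_funM.
  exact: (measurable_indic (open_measurable2 (open_interior (K i)))).
apply: continuous_on_measurable => //; exact: smooth_continuous.
Qed.

(** Almost every point is interior to a cell, where the sequence is eventually constant; uniform
    bounds on a set of finite measure dominate. *)
Lemma gfield_cvg D (f : nat -> R * R -> R) (C : R) :
  (forall i, smooth (D (P i))) -> (forall n, smooth (f n)) ->
  (forall n z, Om z -> `|f n z| <= C) ->
  (forall k z, Om z -> (K k)° z -> \forall n \near \oo, f n z = D (P k) z) ->
  forall e, 0 < e -> \forall n \near \oo, nrm Om (fun z => gfield D z - f n z) < e.
Proof.
move=> sD sf hC hex e e0; have [B hB] := gfield_bounded sD.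
have h : sip Om (fun z => f n z - gfield D z) (fun z => f n z - gfield D z)
    @[n --> \oo] --> (0 : R).
  apply: (@ip_dominated _ _ mOm f (gfield D) (C + B)) => //.
  - exact: L2_gfield.
  - by move=> n; apply: continuous_on_measurable => //; exact: smooth_continuous.
  - by move=> n z Oz; apply: (le_trans (ler_normB _ _)); apply: lerD; [exact: hC|exact: hB].
  apply: (ae_imp ae_cell) => z hz Oz; have [k Kz] := hz Oz.
  rewrite (gfield_in D Oz Kz); apply: cvg_near_cst; exact: hex.
have e2 : 0 < e ^+ 2 by rewrite exprn_gt0.
have H : \forall n \near \oo,
    sip Om (fun z => f n z - gfield D z) (fun z => f n z - gfield D z) < e ^+ 2.
  exact: (cvgr_lt _ h).
apply: filterS H => n hn.
apply: lt_of_sqr_lt => //; first exact: nrm_ge0.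
by rewrite nrm_distC nrm_sq.
Qed.

Lemma piecewise_continuous : continuous v.
Proof.
have [cK cov sP hP _] := pw.
suff key (a : R * R) : v x @[x --> a] --> v a by move=> a; exact: key.
apply/cvgrPdist_lt => e e0.
have n1 : \forall x \near nbhs a, forall i, K i x -> K i a.
  apply: (@filter_forall _ _ (fun i x => K i x -> K i a) (nbhs a)) => i.
  have [Ka|nKa] := pselect (K i a); first by apply: nearW.
  have : nbhs a (~` K i) by apply: open_nbhs_nbhs; split => //; exact: closed_openC.
  by apply: filterS => x nx Kx.
have n2 : \forall x \near nbhs a, forall i, `|P i a - P i x| < e.
  apply: (@filter_forall _ _ (fun i x => `|P i a - P i x| < e) (nbhs a)) => i.
  have cP : P i x @[x --> a] --> P i a := @smooth_continuous _ _ (sP i) a.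
  by move/cvgrPdist_lt: cP => /(_ e e0).
apply: filterS2 n1 n2 => x h1 h2; have [i Kx] := cov x.
by have [-> _ _] := hP i x Kx; have [-> _ _] := hP i a (h1 i Kx); exact: h2.
Qed.

Lemma piecewise_H20 : H20 Om v.
Proof.
have [cK cov sP hP _] := pw.
have [M M0 OM] := bounded_cbox bOm.
have [L L0 hL] := smooth_second_bound (M + 2) sP.
have S0 := @step_smooth_step R; have S1 := step_derive1 S0; have S2 := step_derive1 S1.
have [C0 hC0] := weight_bounded S0; have [C1 hC1] := weight_bounded S1.
have [C2 hC2] := weight_bounded S2.
pose C := Num.max C0 (Num.max C1 C2).
have l0 : C0 <= C by rewrite le_max lexx.
have l1 : C1 <= C by rewrite !le_max lexx orbT.
have l2 : C2 <= C by rewrite !le_max lexx !orbT.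
have hC (t : R) : [/\ `|weight (@smooth_step R) t| <= C,
    `|weight (derive1 (@smooth_step R)) t| <= C &
    `|weight (derive1 (derive1 (@smooth_step R))) t| <= C].
  by split; [exact: (le_trans (hC0 t) l0)|exact: (le_trans (hC1 t) l1)
    |exact: (le_trans (hC2 t) l2)].
have sPx i := smooth_pdx (sP i); have sPy i := smooth_pdy (sP i).
have sPxx i := smooth_pdx (sPx i); have sPxy i := smooth_pdy (sPx i).
have sPyx i := smooth_pdx (sPy i); have sPyy i := smooth_pdy (sPy i).
have [B0 B00 hB0] := family_bounded sP.
have [Bx Bx0 hBx] := family_bounded sPx.
have [By By0 hBy] := family_bounded sPy.
pose N (n : nat) : R := n.+1%:R.
have N1 n : 1 <= N n by rewrite ler1n.
pose phi n := quasi_interp Om pw M (N n).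
have tphi n : test_function Om (phi n) by exact: test_quasi_interp.
have sphi n := test_smooth (tphi n).
have bd n z (Oz : Om z) := quasi_interp_bound pw out OM L0 hL hC (N1 n) Oz.
have ex k z : Om z -> (K k)° z -> \forall n \near \oo,
    [/\ phi n z = P k z, pdx (phi n) z = pdx (P k) z, pdy (phi n) z = pdy (P k) z &
      [/\ pdx (pdx (phi n)) z = pdx (pdx (P k)) z, pdy (pdx (phi n)) z = pdy (pdx (P k)) z,
          pdx (pdy (phi n)) z = pdx (pdy (P k)) z & pdy (pdy (phi n)) z = pdy (pdy (P k)) z]].
  move=> Oz Kz.
  have [e e0 he] : exists2 e : R, 0 < e & forall w,
      `|w.1 - z.1| < e -> `|w.2 - z.2| < e -> Om w /\ (K k)° w.
    have oU := openI oOm (open_interior (K k)).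
    have [e e0 h] := open_boxP oU (conj Oz Kz).
    by exists e => // w w1 w2; apply: h; rewrite distrC.
  exists (Num.truncn (2 / e)); first by [].
  move=> n hn; have {}hn : (Num.truncn (2 / e) <= n)%N by exact: hn.
  apply: (quasi_interp_exact pw uniq_cell OM hC (N1 n) e0 Oz _ he).
  rewrite ltr_pdivrMr ?ltr0n// mulrC -ltr_pdivrMr//.
  apply: (lt_le_trans (Num.Theory.truncnS_gt _)).
  by rewrite /N ler_nat.
pose Kc := Kb L C.
have tri (a b x y : R) : `|a - b| <= x -> `|b| <= y -> `|a| <= x + y.
  move=> h1 h2; rewrite -[a](subrK b); apply: (le_trans (ler_normD _ _)).
  exact: lerD h1 h2.
have c0 n z : Om z -> `|phi n z| <= Kc + B0.
  move=> Oz; have [b _ _ _] := bd n z Oz; apply: tri b _; have [i Kz] := cov z.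
  by have [-> _ _] := hP i z Kz; exact: hB0.
have cx n z : Om z -> `|pdx (phi n) z| <= Kc + Bx.
  move=> Oz; have [_ b _ _] := bd n z Oz; apply: tri b _; have [i Kz] := cov z.
  by have [_ -> _] := hP i z Kz; exact: hBx.
have cy n z : Om z -> `|pdy (phi n) z| <= Kc + By.
  move=> Oz; have [_ _ b _] := bd n z Oz; apply: tri b _; have [i Kz] := cov z.
  by have [_ _ ->] := hP i z Kz; exact: hBy.
have cxx n z : Om z -> `|pdx (pdx (phi n)) z| <= Kc.
  by move=> Oz; have [_ _ _ [b _ _ _]] := bd n z Oz; rewrite subr0 in b.
have cxy n z : Om z -> `|pdy (pdx (phi n)) z| <= Kc.
  by move=> Oz; have [_ _ _ [_ b _ _]] := bd n z Oz; rewrite subr0 in b.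
have cyx n z : Om z -> `|pdx (pdy (phi n)) z| <= Kc.
  by move=> Oz; have [_ _ _ [_ _ b _]] := bd n z Oz; rewrite subr0 in b.
have cyy n z : Om z -> `|pdy (pdy (phi n)) z| <= Kc.
  by move=> Oz; have [_ _ _ [_ _ _ b]] := bd n z Oz; rewrite subr0 in b.
have dxphi n := smooth_pdx (sphi n); have dyphi n := smooth_pdy (sphi n).
have g0 := @gfield_cvg (fun u => u) phi _ sP sphi c0.
have gx := @gfield_cvg pdx (fun n => pdx (phi n)) _ sPx dxphi cx.
have gy := @gfield_cvg pdy (fun n => pdy (phi n)) _ sPy dyphi cy.
have gxx := @gfield_cvg (pdx \o pdx) (fun n => pdx (pdx (phi n))) _ sPxx
  (fun n => smooth_pdx (dxphi n)) cxx.
have gxy := @gfield_cvg (pdy \o pdx) (fun n => pdy (pdx (phi n))) _ sPxy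
  (fun n => smooth_pdy (dxphi n)) cxy.
have gyx := @gfield_cvg (pdx \o pdy) (fun n => pdx (pdy (phi n))) _ sPyx
  (fun n => smooth_pdx (dyphi n)) cyx.
have gyy := @gfield_cvg (pdy \o pdy) (fun n => pdy (pdy (phi n))) _ sPyy
  (fun n => smooth_pdy (dyphi n)) cyy.
have Lv : L2 Om v.
  apply: (L2_continuous_bounded oOm bOm (C := B0) piecewise_continuous) => z Oz.
  by have [i Kz] := cov z; have [-> _ _] := hP i z Kz; exact: hB0.
have Lg := L2_gfield (D := fun u => u) sP.
have vg : ae_eq_on Om v (gfield (fun u => u)).
  apply: (ae_imp ae_cell) => z hz Oz; have [k Kz] := hz Oz.
  by rewrite (gfield_in _ Oz Kz); have [-> _ _] := hP k z (interior_subset Kz).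
apply: (@H20_of_approx _ _ oOm bOm v (gfield pdx) (gfield pdy) (gfield (pdx \o pdx))
  (gfield (pdy \o pdx)) (gfield (pdx \o pdy)) (gfield (pdy \o pdy))).
- exact: Lv.
- exact: (@L2_gfield pdx sPx).
- exact: (@L2_gfield pdy sPy).
- exact: (@L2_gfield (pdx \o pdx) sPxx).
- exact: (@L2_gfield (pdy \o pdx) sPxy).
- exact: (@L2_gfield (pdx \o pdy) sPyx).
- exact: (@L2_gfield (pdy \o pdy) sPyy).
move=> e pe.
have e0 k z (Oz : Om z) (Kz : (K k)° z) : \forall n \near \oo, phi n z = P k z.
  by apply: filterS (ex k z Oz Kz) => n [h _ _ _]; exact: h.
have n0 := g0 e0 e pe.
have e1x k z (Oz : Om z) (Kz : (K k)° z) : \forall n \near \oo, pdx (phi n) z = pdx (P k) z.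
  by apply: filterS (ex k z Oz Kz) => n [_ h _ _]; exact: h.
have nx := gx e1x e pe.
have ey k z (Oz : Om z) (Kz : (K k)° z) : \forall n \near \oo, pdy (phi n) z = pdy (P k) z.
  by apply: filterS (ex k z Oz Kz) => n [_ _ h _]; exact: h.
have ny := gy ey e pe.
have exx k z (Oz : Om z) (Kz : (K k)° z) :
    \forall n \near \oo, pdx (pdx (phi n)) z = pdx (pdx (P k)) z.
  by apply: filterS (ex k z Oz Kz) => n [_ _ _ [h _ _ _]]; exact: h.
have nxx := gxx exx e pe.
have exy k z (Oz : Om z) (Kz : (K k)° z) :
    \forall n \near \oo, pdy (pdx (phi n)) z = pdy (pdx (P k)) z.
  by apply: filterS (ex k z Oz Kz) => n [_ _ _ [_ h _ _]]; exact: h.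
have nxy := gxy exy e pe.
have eyx k z (Oz : Om z) (Kz : (K k)° z) :
    \forall n \near \oo, pdx (pdy (phi n)) z = pdx (pdy (P k)) z.
  by apply: filterS (ex k z Oz Kz) => n [_ _ _ [_ _ h _]]; exact: h.
have nyx := gyx eyx e pe.
have eyy k z (Oz : Om z) (Kz : (K k)° z) :
    \forall n \near \oo, pdy (pdy (phi n)) z = pdy (pdy (P k)) z.
  by apply: filterS (ex k z Oz Kz) => n [_ _ _ [_ _ _ h]]; exact: h.
have nyy := gyy eyy e pe.
have [n [h0 [[hx hxx hxy] [hy hyx hyy]]]] := eventually7 n0 nx nxx nxy ny nyx nyy.
exists (phi n); split; [exact: tphi| |split; [exact: hx|exact: hxx|exact: hxy]|
  split; [exact: hy|exact: hyx|exact: hyy]].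
have Lp := L2_test oOm bOm (tphi n).
rewrite (nrm_ae mOm (L2B mOm Lv Lp) (L2B mOm Lg Lp) (ae_eq_onB vg (ae_eq_on_refl _ _))).
exact: h0.
Qed.

End piecewise_H20.

(** * The finite element space inside H^2_0 *)

Section finite_elements.
Context {R : realType} (Om : set (R * R)) (m : nat) (sigma : R).
Local Notation mu2 := (@lebesgue_measure R \x @lebesgue_measure R)%E.
Variable T : 'I_m -> set (R * R).
Implicit Types (z p : R * R) (v : R * R -> R).
Hypothesis oOm : open Om.
Hypothesis bOm : bounded_set Om.
Hypothesis hT : shape_regular_partition Om sigma T.

(** The complement of [Om], with the zero function, is one more cell: extension by 0 becomes a
    piecewise smooth function on the plane. *)
Definition fe_cell (i : option 'I_m) : set (R * R) := if i is Some k then T k else ~` Om.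
Definition fe_piece (P : 'I_m -> R * R -> R) (i : option 'I_m) : R * R -> R :=
  if i is Some k then P k else cst 0.
Definition fe_extend (g : R * R -> R) z : R := if `[< closure Om z >] then g z else 0.

(** A cell meeting the interior of another would, by density of its own interior, meet it in
    interior points. *)
Lemma fe_cell_uniq i k z : Om z -> fe_cell i z -> (fe_cell k)° z -> i = k.
Proof.
have [cv sr disj _] := hT.
case: i k => [i|] [k|] //= Oz Ki Kk; last by case: (interior_subset Kk).
have [->//|ik] := eqVneq i k; exfalso.
have [e e0 he] := open_boxP (open_interior (T k)) Kk.
have [q [Tq q1 q2]] := cell_interior_dense (cv i) (sr i) Ki e0.
have : ((T i)° `&` (T k)°) q by split => //; apply: he; rewrite distrC.
by rewrite disj.
Qed.

Lemma fe_ae_cell : {ae mu2, forall z, Om z -> exists k, (fe_cell k)° z}.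
Proof.
have [cv sr disj cO] := hT.
have h : {ae mu2, forall z, forall i, T i z -> (T i)° z}.
  apply: (@filter_forall _ _ (fun i z => T i z -> (T i)° z) _ (ae_filter_ringOfSetsType mu2)) => i.
  exists (T i `\` (T i)°); split.
  - apply: measurableD; first by apply: closed_measurable2; case: (cv i).
    exact: open_measurable2 (open_interior _).
  - exact: convex_boundary_null.
  by move=> z /= /not_implyP.
apply: (ae_imp h) => z hz Oz.
have : closure Om z by exact: subset_closure.
by rewrite cO => -[i _ Tz]; exists (Some i); exact: hz.
Qed.

Lemma fe_piecewise_smooth v g1 g2 (P : 'I_m -> R * R -> R) :
  (forall i, smooth (P i)) -> (forall i z, T i z -> v z = P i z) ->
  (forall i z, T i z -> g1 z = pdx (P i) z /\ g2 z = pdy (P i) z) ->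
  (forall z, ~ Om z -> [/\ v z = 0, fe_extend g1 z = 0 & fe_extend g2 z = 0]) ->
  piecewise_smooth fe_cell (fe_piece P) v (fe_extend g1) (fe_extend g2).
Proof.
move=> sP hP hg out; have [cv sr _ cO] := hT.
have clT i z : T i z -> closure Om z by move=> Tz; rewrite cO; exists i.
have ext g i z : T i z -> fe_extend g z = g z.
  by move=> Tz; rewrite /fe_extend asboolT//; exact: clT Tz.
split.
- by case=> [i|] /=; [case: (cv i)|exact: open_closedC].
- move=> z; have [Oz|nOz] := pselect (Om z); last by exists None.
  have : closure Om z by exact: subset_closure.
  by rewrite cO => -[i _ Tz]; exists (Some i).
- by case=> [i|] /=; [exact: sP|exact: smooth_cst].
- case=> [i|] z /=; last by move=> /out[-> -> ->]; rewrite pdx_cst pdy_cst.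
  by move=> Tz; have [e1 e2] := hg i z Tz; rewrite !(ext _ i)// (hP i).
split.
  (* The complement of [Om] need not be convex, but v and its extended gradient vanish there, so t
     itself is an intermediate point. On a mesh cell, convexity keeps the point of the mean value
     theorem in the cell. *)
  case=> [i|] y t t' /= Kt Kt' tt; last first.
    exists t; split => //; have [-> _ _] := out _ Kt'; have [-> -> _] := out _ Kt.
    by rewrite subrr mul0r.
  have [x [tx xt e]] := smooth_mean_value_x y (sP i) tt.
  have Kx : T i (x, y).
    have [_ conv] := cv i; have [t_t|t_t] := eqVneq t t'.
      by have -> : x = t by apply/eqP; rewrite eq_le tx {1}t_t xt.
    have tp : 0 < t' - t by rewrite subr_gt0 lt_neqAle t_t.
    have := conv (t', y) (t, y) ((x - t) / (t' - t)) Kt' Kt.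
    rewrite divr_ge0 ?subr_ge0// ler_pdivrMr// mul1r lerD2r xt => /(_ isT) /=.
    congr (T i (_, _)); last by ring.
    by field; rewrite gt_eqF.
  exists x; split => //; rewrite (hP i _ Kt) (hP i _ Kt') (ext _ i)//.
  by have [-> _] := hg i _ Kx.
case=> [i|] x t t' /= Kt Kt' tt; last first.
  exists t; split => //; have [-> _ _] := out _ Kt'; have [-> _ ->] := out _ Kt.
  by rewrite subrr mul0r.
have [y [ty yt e]] := smooth_mean_value_y x (sP i) tt.
have Ky : T i (x, y).
  have [_ conv] := cv i; have [t_t|t_t] := eqVneq t t'.
    by have -> : y = t by apply/eqP; rewrite eq_le ty {1}t_t yt.
  have tp : 0 < t' - t by rewrite subr_gt0 lt_neqAle t_t.
  have := conv (x, t') (x, t) ((y - t) / (t' - t)) Kt' Kt.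
  rewrite divr_ge0 ?subr_ge0// ler_pdivrMr// mul1r lerD2r yt => /(_ isT) /=.
  congr (T i (_, _)); first by ring.
  by field; rewrite gt_eqF.
exists y; split => //; rewrite (hP i _ Kt) (hP i _ Kt') (ext _ i)//.
by have [_ ->] := hg i _ Ky.
Qed.

Lemma fe_space0_H20 (k : nat) (S : set (R * R -> R)) :
  C1_fe_space Om k T S -> fe_space0 Om S `<=` H20 Om.
Proof.
move=> [_ hS] v [Sv v0 nv]; have [[cv [g1 [g2 [cg1 cg2 dv]]] voff] pp] := hS v Sv.
pose P i := poly_eval k (projT1 (cid (pp i))).
have hP i z : T i z -> v z = P i z by exact: projT2 (cid (pp i)) z.
have sP i : smooth (P i) by exact: smooth_poly_eval.
have hg i z := @cell_gradient R Om m sigma T v g1 g2 hT cg1 cg2 dv P sP hP i z.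
have bg p := @boundary_gradient R Om m sigma T v g1 g2 bOm hT cg1 cg2 dv P sP hP v0 nv p.
have out z : ~ Om z -> [/\ v z = 0, fe_extend g1 z = 0 & fe_extend g2 z = 0].
  move=> nz; rewrite /fe_extend; case: asboolP => cz; last by rewrite voff.
  have bz : boundary Om z by split => // /interior_subset.
  by have [-> ->] := bg z bz; rewrite v0.
exact: (piecewise_H20 oOm bOm (fe_piecewise_smooth sP hP hg out) out fe_cell_uniq fe_ae_cell).
Qed.

End finite_elements.

Theorem corollary5p6 (R : realType) (Om : set (R * R))
    (hOm : domain Om) (hOm_bdd : bounded_set Om)
    (nu mu : R) (hnu : 0 < nu) (hmu : 0 < mu)
    (lam1 : R) (hlam1 : min_dirichlet_eigenvalue Om lam1)
    (sigma : R) (m : nat) (T : 'I_m -> set (R * R))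
    (hT : shape_regular_partition Om sigma T)
    (k : nat) (hk : (3 <= k)%N)
    (Sh : set (R * R -> R)) (hSh : C1_fe_space Om k T Sh)
    (F : (R * R -> R) -> R) (hF : Hm2 Om F) (hF0 : Hm2_nonzero Om F)
    (alpha : R) (halpha0 : 0 < alpha) (halpha : alpha < nu * lam1 / 4)
    (dt : R) (hdt0 : 0 < dt)
    (hdt : expR (alpha * dt) < nu * dt * lam1 / 4 + 1)
    (SN : nat -> (R * R -> R) -> (R * R -> R))
    (hSN : solution_operator Om (fe_space0 Om Sh) nu mu dt F SN) :
  exists rho0 : R,
    [/\ 0 <= rho0,
        rho0 ^+ 2 =
          mu ^+ 2 * expR (2 * alpha * dt) / (alpha * nu) * Hm2norm Om F ^+ 2 &
        bounded_absorbing_set Om (fe_space0 Om Sh) dt SN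
          (fe_ball Om (fe_space0 Om Sh) rho0)].
Proof.
have [oOm _ _] := hOm.
apply: (absorbing_ball oOm hOm_bdd _ hnu hmu hlam1 hF hF0 halpha0 halpha hdt0 hSN).
exact: (fe_space0_H20 oOm hOm_bdd hT hSh).
Qed.
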